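(* Let $\mathcal{A}$ be a small pre-additive category. For a sequence $$0\to L\to M\to N\to 0$$ in $\mathcal{A}\text{-}\mathrm{Mod}=(\mathcal{A},\mathrm{Ab})$, the following are equivalent. 1. The sequence is pure-exact. 2. The sequence is a direct limit of split exact sequences in $\mathcal{A}\text{-}\mathrm{Mod}$. 3. For any pp-pair $\varphi/\psi$ in the language of left $\mathcal{A}$-modules, the sequence $0\to \varphi L/\psi L\to\varphi M/\psi M\to\varphi N/\psi N\to 0$ is exact. 4. For any $Y\in\mathrm{Mod}\text{-}\mathcal{A}$, the induced sequence $0\to Y\otimes_{\mathcal{A}} L\to Y\otimes_{\mathcal{A}} M\to Y\otimes_{\mathcal{A}} N\to 0$ is exact. 5. For any pure-injective $Y\in\mathrm{Mod}\text{-}\mathcal{A}$, the induced sequence $0\to Y\otimes_{\mathcal{A}} L\to Y\otimes_{\mathcal{A}} M\to Y\otimes_{\mathcal{A}} N\to 0$ is exact. 6. The induced sequence $0\to N^*\to M^*\to L^*\to 0$ is split exact in $\mathrm{Mod}\text{-}\mathcal{A}$. Moreover, condition 4 need only be checked when $Y$ is finitely presented; that is, these conditions are also equivalent to the condition that the sequence in 4 is exact for every finitely presented $Y\in\mathrm{Mod}\text{-}\mathcal{A}$.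
   Context: $\mathrm{Ab}$ is the category of abelian groups. All functors are additive. For a small pre-additive category $\mathcal{A}$, $\mathcal{A}\text{-}\mathrm{Mod}=(\mathcal{A},\mathrm{Ab})$ is the category of additive functors $\mathcal{A}\to\mathrm{Ab}$ (left $\mathcal{A}$-modules), and $\mathrm{Mod}\text{-}\mathcal{A}=(\mathcal{A}^{\mathrm{op}},\mathrm{Ab})$ is the category of right $\mathcal{A}$-modules. ''Direct limit'' means directed colimit; a direct limit of sequences is taken in the category of sequences (diagrams) of modules. An object $X$ of a category with direct limits is finitely presented if the representable functor $\mathrm{Hom}(X,-)$ to $\mathrm{Ab}$ preserves direct limits. Pure-exactness: a sequence $0\to L\to M\to N\to 0$ in $\mathcal{A}\text{-}\mathrm{Mod}$ (or likewise in $\mathrm{Mod}\text{-}\mathcal{A}$) is pure-exact if for every finitely presented module $X$ the induced sequence $0\to\mathrm{Hom}(X,L)\to\mathrm{Hom}(X,M)\to\mathrm{Hom}(X,N)\to 0$ is exact. A module $Y$ is pure-injective if for every pure-exact sequence $0\to U\to V\to W\to 0$ every morphism $U\to Y$ extends along $U\to V$. Tensor product: for $Y\in\mathrm{Mod}\text{-}\mathcal{A}$ and $M\in\mathcal{A}\text{-}\mathrm{Mod}$, $Y\otimes_{\mathcal{A}}M$ is the abelian group given by the coend $\int^{A\in\mathcal{A}}(YA)\otimes_{\mathbb{Z}}(MA)$. Dual: for $M\in\mathcal{A}\text{-}\mathrm{Mod}$, $M^*\in\mathrm{Mod}\text{-}\mathcal{A}$ is given by $M^*A=\mathrm{Hom}_{\mathbb{Z}}(MA,\mathbb{Q}/\mathbb{Z})$.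 pp-pairs: the language of left $\mathcal{A}$-modules is many-sorted, with one sort for each object of $\mathcal{A}$ (the sort $A$ being interpreted in $M$ as the abelian group $MA$), and a function symbol for each morphism of $\mathcal{A}$, together with the abelian group operations on each sort. A pp formula $\varphi(x_1,\dots,x_n)$, with $x_i$ of sort $A_i$, is a formula $\exists y_1,\dots,y_m$ (with $y_j$ of sort $B_j$) $\bigwedge_{k=1}^{l}\big(\sum_i r_{ki}x_i+\sum_j s_{kj}y_j=0\big)$, where $r_{ki}:A_i\to C_k$ and $s_{kj}:B_j\to C_k$ are morphisms in $\mathcal{A}$; its solution set $\varphi M$ is a subgroup of $\bigoplus_i MA_i$, functorial in $M$. A pp-pair $\varphi/\psi$ consists of pp formulas $\varphi,\psi$ in the same free variables with $\psi M\subseteq\varphi M$ for every $M\in\mathcal{A}\text{-}\mathrm{Mod}$; it defines a functor $M\mapsto\varphi M/\psi M$ from $\mathcal{A}\text{-}\mathrm{Mod}$ to $\mathrm{Ab}$. *)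

(* Defs.v *)
From HB Require Import structures.
From mathcomp Require Import all_boot all_order all_algebra.
From mathcomp Require Import generic_quotient ring_quotient.
From mathcomp Require Import boolp freeg.

Set Implicit Arguments.
Unset Strict Implicit.
Unset Printing Implicit Defensive.

Import GRing.Theory.
Local Open Scope ring_scope.
Local Open Scope quotient_scope.

Record category := Category {
  obj :> Type;
  mor : obj -> obj -> Type;
  idm : forall a, mor a a;
  compm : forall a b c, mor b c -> mor a b -> mor a c;
  compm_idl : forall a b (f : mor a b), compm (idm b) f = f;
  compm_idr : forall a b (f : mor a b), compm f (idm a) = f;
  compmA : forall a b c d (h : mor c d) (g : mor b c) (f : mor a b),
    compm h (compm g f) = compm (compm h g) f }.

Record functor (C D : category) := Functor {
  fobj :> C -> D;
  fmor : forall a b, mor a b -> mor (fobj a) (fobj b);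
  fmor_id : forall a, fmor (idm a) = idm (fobj a);
  fmor_comp : forall a b c (g : mor b c) (f : mor a b),
    fmor (compm g f) = compm (fmor g) (fmor f) }.

Definition directed (d : Order.disp_t) (I : porderType d) : Prop :=
  inhabited I /\ forall i j : I, exists k : I, (i <= k)%O /\ (j <= k)%O.

Record diagram (C : category) (d : Order.disp_t) (I : porderType d) := Diagram {
  dg_obj :> I -> C;
  dg_map : forall i j, (i <= j)%O -> mor (dg_obj i) (dg_obj j);
  dg_id : forall i (h : (i <= i)%O), dg_map h = idm (dg_obj i);
  dg_comp : forall i j k (ij : (i <= j)%O) (jk : (j <= k)%O) (ik : (i <= k)%O),
    compm (dg_map jk) (dg_map ij) = dg_map ik }.

Record cocone (C : category) (d : Order.disp_t) (I : porderType d)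
    (D : diagram C I) (X : C) := Cocone {
  leg : forall i, mor (D i) X;
  leg_map : forall i j (ij : (i <= j)%O), compm (leg j) (dg_map D ij) = leg i }.

Definition is_colimit (C : category) (d : Order.disp_t) (I : porderType d)
    (D : diagram C I) (X : C) (c : cocone D X) : Prop :=
  forall (Z : C) (k : cocone D Z),
    exists! u : mor X Z, forall i, compm u (leg c i) = leg k i.

Definition is_direct_limit_of (C : category) (P : C -> Prop) (X : C) : Prop :=
  exists (d : Order.disp_t) (I : porderType d) (D : diagram C I)
         (c : cocone D X),
    [/\ directed I, forall i, P (D i) & is_colimit c].

Section MapCocone.
Variables (C D : category) (F : functor C D).
Variables (d : Order.disp_t) (I : porderType d).

Lemma map_diagram_id (E : diagram C I) i (h : (i <= i)%O) :
  fmor F (dg_map E h) = idm (F (E i)).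
Proof. by rewrite dg_id fmor_id. Qed.

Lemma map_diagram_comp (E : diagram C I) i j k
    (ij : (i <= j)%O) (jk : (j <= k)%O) (ik : (i <= k)%O) :
  compm (fmor F (dg_map E jk)) (fmor F (dg_map E ij)) = fmor F (dg_map E ik).
Proof. by rewrite -fmor_comp dg_comp. Qed.

Definition map_diagram (E : diagram C I) : diagram D I :=
  Diagram (map_diagram_id E) (map_diagram_comp E).

Lemma map_cocone_leg (E : diagram C I) X (c : cocone E X) i j
    (ij : (i <= j)%O) :
  compm (fmor F (leg c j)) (dg_map (map_diagram E) ij) = fmor F (leg c i).
Proof. by rewrite -fmor_comp leg_map. Qed.

Definition map_cocone (E : diagram C I) X (c : cocone E X) :
  cocone (map_diagram E) (F X) := Cocone (map_cocone_leg c).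

End MapCocone.

Definition preserves_direct_limits (C D : category) (F : functor C D) : Prop :=
  forall (d : Order.disp_t) (I : porderType d), directed I ->
  forall (E : diagram C I) (X : C) (c : cocone E X),
    is_colimit c -> is_colimit (map_cocone F c).

Definition addhom (U V : zmodType) : Type := {additive U -> V}.

Definition addhom_fun (U V : zmodType) (f : addhom U V) : {additive U -> V} := f.
Coercion addhom_fun : addhom >-> GRing.Additive.type.

Lemma addhom_ext (U V : zmodType) (f g : addhom U V) : f =1 g -> f = g.
Proof.
case: f g => [f [[Hf]]] [g [[Hg]]] /= /funext fg; subst g.
by rewrite (Prop_irrelevance Hf Hg).
Qed.

HB.instance Definition _ (U V : zmodType) := gen_eqMixin (addhom U V).
HB.instance Definition _ (U V : zmodType) := gen_choiceMixin (addhom U V).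

Section AddHomGroup.
Variables U V : zmodType.

Definition addhom_zero : addhom U V := (\0 : {additive U -> V}).
Definition addhom_opp (f : addhom U V) : addhom U V :=
  (\- f : {additive U -> V}).
Definition addhom_add (f g : addhom U V) : addhom U V :=
  (f \+ g : {additive U -> V}).

Fact addhom_addA : associative addhom_add.
Proof. by move=> f g h; apply: addhom_ext => x /=; rewrite addrA. Qed.
Fact addhom_addC : commutative addhom_add.
Proof. by move=> f g; apply: addhom_ext => x /=; rewrite addrC. Qed.
Fact addhom_add0 : left_id addhom_zero addhom_add.
Proof. by move=> f; apply: addhom_ext => x /=; rewrite add0r. Qed.
Fact addhom_addN : left_inverse addhom_zero addhom_opp addhom_add.
Proof. by move=> f; apply: addhom_ext => x /=; rewrite addNr. Qed.

HB.instance Definition _ := GRing.isZmodule.Build (addhom U V)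
  addhom_addA addhom_addC addhom_add0 addhom_addN.

End AddHomGroup.

Definition addhom_id (U : zmodType) : addhom U U := (idfun : {additive U -> U}).
Definition addhom_comp (U V W : zmodType) (g : addhom V W) (f : addhom U V) :
  addhom U W := (g \o f : {additive U -> W}).

Lemma addhom_idl U V (f : addhom U V) : addhom_comp (addhom_id V) f = f.
Proof. exact: addhom_ext. Qed.
Lemma addhom_idr U V (f : addhom U V) : addhom_comp f (addhom_id U) = f.
Proof. exact: addhom_ext. Qed.
Lemma addhom_compA U V W X (h : addhom W X) (g : addhom V W) (f : addhom U V) :
  addhom_comp h (addhom_comp g f) = addhom_comp (addhom_comp h g) f.
Proof. exact: addhom_ext. Qed.

Definition Ab : category := Category addhom_idl addhom_idr addhom_compA.

(* Exactness of 0 -> U -> V -> W -> 0 in Ab. *)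
Definition exact_Ab (U V W : zmodType) (f : addhom U V) (g : addhom V W) : Prop :=
  [/\ injective f,
      forall v, g v = 0 <-> exists u, f u = v
    & forall w, exists v, g v = w].

Section Subgroups.
Variable G : zmodType.

Definition generated (R : G -> Prop) : {pred G} := fun x =>
  `[< forall S : zmodClosed G, (forall r, R r -> r \in S) -> x \in S >].

Fact generated_zmod_closed R : zmod_closed (generated R).
Proof.
split=> [|x y /asboolP Rx /asboolP Ry]; apply/asboolP => S RS.
  exact: rpred0.
by rewrite rpredB ?Rx ?Ry.
Qed.
HB.instance Definition _ R :=
  GRing.isZmodClosed.Build G (generated R) (generated_zmod_closed R).

Definition subgroup (P : zmodClosed G) : Type := {x : G | x \in P}.
HB.instance Definition _ P := SubChoice.on (subgroup P).
HB.instance Definition _ P := [SubChoice_isSubZmodule of subgroup P by <:].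

Definition subgroup_in (P Q : zmodClosed G) : {pred subgroup P} :=
  fun x => val x \in Q.
Arguments subgroup_in P Q : clear implicits.
Fact subgroup_in_zmod_closed P Q : zmod_closed (subgroup_in P Q).
Proof.
split=> [|x y Qx Qy].
  by change (val (0 : subgroup P) \in Q); rewrite raddf0 rpred0.
by change (val (x - y) \in Q); rewrite raddfB rpredB.
Qed.
HB.instance Definition _ P Q :=
  GRing.isZmodClosed.Build (subgroup P) (subgroup_in P Q)
    (subgroup_in_zmod_closed P Q).

End Subgroups.
Arguments subgroup_in {G} P Q.

(* The additive map G/I -> H/J induced by F. *)
Section QuotMap.
Variables (G H : zmodType) (I : zmodClosed G) (J : zmodClosed H).
Variables (F : addhom G H) (FIJ : forall x, x \in I -> F x \in J).

Definition quot_map_fun (q : Quotient.quot I) : Quotient.quot J :=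
  \pi_(Quotient.quot J) (F (repr q)).

Lemma quot_map_pi (x : G) :
  quot_map_fun (\pi_(Quotient.quot I) x) = \pi_(Quotient.quot J) (F x).
Proof.
apply/eqP; rewrite -Quotient.idealrBE -raddfB FIJ //.
by rewrite Quotient.idealrBE reprK.
Qed.

Fact quot_map_zmod_morphism : zmod_morphism quot_map_fun.
Proof.
move=> p q; rewrite -[p]reprK -[q]reprK.
by rewrite -[_ - _]raddfB !quot_map_pi !raddfB.
Qed.
HB.instance Definition _ :=
  GRing.isZmodMorphism.Build _ _ quot_map_fun quot_map_zmod_morphism.

Definition quot_map : addhom (Quotient.quot I) (Quotient.quot J) :=
  (quot_map_fun : {additive _ -> _}).

End QuotMap.

(* Smallness: ob lives in the universe of the carriers of zmodType, which the
   construction of tensor products below enforces. *)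
Record preadditive := Preadditive {
  ob :> Type;
  Hom : ob -> ob -> zmodType;
  one : forall a, Hom a a;
  circ : forall a b c, Hom b c -> Hom a b -> Hom a c;
  circ_onel : forall a b (f : Hom a b), circ (one b) f = f;
  circ_oner : forall a b (f : Hom a b), circ f (one a) = f;
  circA : forall a b c d (h : Hom c d) (g : Hom b c) (f : Hom a b),
    circ h (circ g f) = circ (circ h g) f;
  circDl : forall a b c (g g' : Hom b c) (f : Hom a b),
    circ (g + g') f = circ g f + circ g' f;
  circDr : forall a b c (g : Hom b c) (f f' : Hom a b),
    circ g (f + f') = circ g f + circ g f' }.

Definition op (A : preadditive) : preadditive := {|
  ob := A;
  Hom := fun a b => Hom b a;
  one := @one A;
  circ := fun a b c g f => circ f g;
  circ_onel := fun a b f => circ_oner f;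
  circ_oner := fun a b f => circ_onel f;
  circA := fun a b c d h g f => esym (circA f g h);
  circDl := fun a b c g g' f => circDr f g g';
  circDr := fun a b c g f f' => circDl f f' g |}.

Record lmod (A : preadditive) := LMod {
  lm_ob :> A -> zmodType;
  lm_map : forall a b, Hom a b -> addhom (lm_ob a) (lm_ob b);
  lm_map1 : forall a, lm_map (one a) = addhom_id (lm_ob a);
  lm_mapM : forall a b c (g : Hom b c) (f : Hom a b),
    lm_map (circ g f) = addhom_comp (lm_map g) (lm_map f);
  lm_mapD : forall a b (f g : Hom a b), lm_map (f + g) = lm_map f + lm_map g }.

Definition rmod (A : preadditive) := lmod (op A).

Section ModuleMaps.
Variable A : preadditive.

Record mhom (M N : lmod A) := MHom {
  mh_fun :> forall a, addhom (M a) (N a);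
  mh_nat : forall a b (f : Hom a b) (x : M a),
    mh_fun b (lm_map M f x) = lm_map N f (mh_fun a x) }.

Lemma mhom_ext (M N : lmod A) (f g : mhom M N) :
  (forall a x, f a x = g a x) -> f = g.
Proof.
case: f g => [f Hf] [g Hg] /= fg.
have E : f = g.
  by apply: functional_extensionality_dep => a; exact: addhom_ext (fg a).
by subst g; rewrite (Prop_irrelevance Hf Hg).
Qed.

HB.instance Definition _ M N := gen_eqMixin (mhom M N).
HB.instance Definition _ M N := gen_choiceMixin (mhom M N).

Section Group.
Variables M N : lmod A.

Fact mhom_zero_nat a b (f : Hom a b) (x : M a) :
  (0 : addhom (M b) (N b)) (lm_map M f x)
    = lm_map N f ((0 : addhom (M a) (N a)) x).
Proof. by rewrite raddf0. Qed.
Definition mhom_zero : mhom M N := MHom mhom_zero_nat.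

Fact mhom_opp_nat (u : mhom M N) a b (f : Hom a b) (x : M a) :
  (- u b) (lm_map M f x) = lm_map N f ((- u a) x).
Proof. by rewrite /= raddfN mh_nat. Qed.
Definition mhom_opp (u : mhom M N) : mhom M N := MHom (mhom_opp_nat u).

Fact mhom_add_nat (u v : mhom M N) a b (f : Hom a b) (x : M a) :
  (u b + v b) (lm_map M f x) = lm_map N f ((u a + v a) x).
Proof. by rewrite /= raddfD !mh_nat. Qed.
Definition mhom_add (u v : mhom M N) : mhom M N := MHom (mhom_add_nat u v).

Fact mhom_addA : associative mhom_add.
Proof. by move=> u v w; apply: mhom_ext => a x /=; rewrite addrA. Qed.
Fact mhom_addC : commutative mhom_add.
Proof. by move=> u v; apply: mhom_ext => a x /=; rewrite addrC. Qed.
Fact mhom_add0 : left_id mhom_zero mhom_add.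
Proof. by move=> u; apply: mhom_ext => a x /=; rewrite add0r. Qed.
Fact mhom_addN : left_inverse mhom_zero mhom_opp mhom_add.
Proof. by move=> u; apply: mhom_ext => a x /=; rewrite addNr. Qed.

HB.instance Definition _ := GRing.isZmodule.Build (mhom M N)
  mhom_addA mhom_addC mhom_add0 mhom_addN.

End Group.

Fact mhom_id_nat (M : lmod A) a b (f : Hom a b) (x : M a) :
  addhom_id (M b) (lm_map M f x) = lm_map M f (addhom_id (M a) x).
Proof. by []. Qed.
Definition mhom_id (M : lmod A) : mhom M M := MHom (@mhom_id_nat M).

Fact mhom_comp_nat (L M N : lmod A) (g : mhom M N) (f : mhom L M)
    a b (r : Hom a b) (x : L a) :
  addhom_comp (g b) (f b) (lm_map L r x)
    = lm_map N r (addhom_comp (g a) (f a) x).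
Proof. by rewrite /= !mh_nat. Qed.
Definition mhom_comp (L M N : lmod A) (g : mhom M N) (f : mhom L M) :
  mhom L N := MHom (mhom_comp_nat g f).

Lemma mhom_idl M N (f : mhom M N) : mhom_comp (mhom_id N) f = f.
Proof. exact: mhom_ext. Qed.
Lemma mhom_idr M N (f : mhom M N) : mhom_comp f (mhom_id M) = f.
Proof. exact: mhom_ext. Qed.
Lemma mhom_compA K L M N (h : mhom M N) (g : mhom L M) (f : mhom K L) :
  mhom_comp h (mhom_comp g f) = mhom_comp (mhom_comp h g) f.
Proof. exact: mhom_ext. Qed.

Definition Mod : category := Category mhom_idl mhom_idr mhom_compA.

Definition hom_act_fun (X M N : lmod A) (f : mhom M N) (u : mhom X M) :
  mhom X N := mhom_comp f u.

Fact hom_act_zmod_morphism X M N (f : mhom M N) :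
  zmod_morphism (@hom_act_fun X M N f).
Proof. by move=> u v; apply: mhom_ext => a x /=; rewrite raddfB. Qed.
HB.instance Definition _ X M N f :=
  GRing.isZmodMorphism.Build _ _ (@hom_act_fun X M N f)
    (@hom_act_zmod_morphism X M N f).

Definition hom_act X M N (f : mhom M N) : addhom (mhom X M) (mhom X N) :=
  (hom_act_fun f : {additive _ -> _}).

Fact hom_act_id X M : hom_act X (mhom_id M) = addhom_id (mhom X M).
Proof. by apply: addhom_ext => u; exact: mhom_idl. Qed.
Fact hom_act_comp X L M N (g : mhom M N) (f : mhom L M) :
  hom_act X (mhom_comp g f) = addhom_comp (hom_act X g) (hom_act X f).
Proof. by apply: addhom_ext => u; apply: mhom_ext. Qed.

Definition hom_functor (X : lmod A) : functor Mod Ab :=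
  @Functor Mod Ab (fun M => mhom X M : zmodType) (hom_act X)
    (hom_act_id X) (@hom_act_comp X).

Definition finitely_presented (X : lmod A) : Prop :=
  preserves_direct_limits (hom_functor X).

(* A diagram L -> M -> N; no condition is put on the composite. *)
Record sequence := Sequence {
  sqL : lmod A; sqM : lmod A; sqN : lmod A;
  sqf : mhom sqL sqM;
  sqg : mhom sqM sqN }.

Record sqhom (S T : sequence) := SqHom {
  shL : mhom (sqL S) (sqL T);
  shM : mhom (sqM S) (sqM T);
  shN : mhom (sqN S) (sqN T);
  sh_f : mhom_comp shM (sqf S) = mhom_comp (sqf T) shL;
  sh_g : mhom_comp shN (sqg S) = mhom_comp (sqg T) shM }.

Lemma sqhom_ext S T (u v : sqhom S T) :
  shL u = shL v -> shM u = shM v -> shN u = shN v -> u = v.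
Proof.
case: u v => [u1 u2 u3 p q] [v1 v2 v3 p' q'] /= E1 E2 E3; subst.
by rewrite (Prop_irrelevance p p') (Prop_irrelevance q q').
Qed.

Definition sqhom_id S : sqhom S S.
Proof.
by exists (mhom_id _) (mhom_id _) (mhom_id _); rewrite mhom_idl mhom_idr.
Defined.

Definition sqhom_comp R S T (v : sqhom S T) (u : sqhom R S) : sqhom R T.
Proof.
exists (mhom_comp (shL v) (shL u)) (mhom_comp (shM v) (shM u))
       (mhom_comp (shN v) (shN u)).
- by rewrite -mhom_compA sh_f !mhom_compA sh_f.
- by rewrite -mhom_compA sh_g !mhom_compA sh_g.
Defined.

Lemma sqhom_idl S T (u : sqhom S T) : sqhom_comp (sqhom_id T) u = u.
Proof. by apply: sqhom_ext; exact: mhom_idl. Qed.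
Lemma sqhom_idr S T (u : sqhom S T) : sqhom_comp u (sqhom_id S) = u.
Proof. by apply: sqhom_ext; exact: mhom_idr. Qed.
Lemma sqhom_compA Q R S T (w : sqhom S T) (v : sqhom R S) (u : sqhom Q R) :
  sqhom_comp w (sqhom_comp v u) = sqhom_comp (sqhom_comp w v) u.
Proof. by apply: sqhom_ext; exact: mhom_compA. Qed.

Definition Seq : category := Category sqhom_idl sqhom_idr sqhom_compA.

(* Kernels and cokernels of module maps are computed objectwise. *)
Definition short_exact (S : sequence) : Prop :=
  forall a, exact_Ab (sqf S a) (sqg S a).

Definition split_exact (S : sequence) : Prop :=
  short_exact S /\
  exists s : mhom (sqN S) (sqM S), mhom_comp (sqg S) s = mhom_id (sqN S).

Definition pure_exact (S : sequence) : Prop :=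
  forall X : lmod A, finitely_presented X ->
    exact_Ab (hom_act X (sqf S)) (hom_act X (sqg S)).

Definition pure_injective (Y : lmod A) : Prop :=
  forall S : sequence, pure_exact S ->
  forall h : mhom (sqL S) Y, exists k : mhom (sqM S) Y,
    mhom_comp k (sqf S) = h.

End ModuleMaps.

Definition pprod (n : nat) (G : 'I_n -> zmodType) : Type := forall i, G i.

Section Products.
Variables (n : nat) (G : 'I_n -> zmodType).

HB.instance Definition _ := gen_eqMixin (pprod G).
HB.instance Definition _ := gen_choiceMixin (pprod G).

Definition pprod_zero : pprod G := fun i => 0.
Definition pprod_opp (x : pprod G) : pprod G := fun i => - x i.
Definition pprod_add (x y : pprod G) : pprod G := fun i => x i + y i.

Fact pprod_addA : associative pprod_add.
Proof.
by move=> x y z; apply: functional_extensionality_dep => i; exact: addrA.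
Qed.
Fact pprod_addC : commutative pprod_add.
Proof.
by move=> x y; apply: functional_extensionality_dep => i; exact: addrC.
Qed.
Fact pprod_add0 : left_id pprod_zero pprod_add.
Proof. by move=> x; apply: functional_extensionality_dep => i; exact: add0r. Qed.
Fact pprod_addN : left_inverse pprod_zero pprod_opp pprod_add.
Proof. by move=> x; apply: functional_extensionality_dep => i; exact: addNr. Qed.

HB.instance Definition _ := GRing.isZmodule.Build (pprod G)
  pprod_addA pprod_addC pprod_add0 pprod_addN.

End Products.

Section PP.
Variable A : preadditive.

(* The formula exists y, /\_k sum_i r_ki x_i + sum_j s_kj y_j = 0, with free
   variables x_i of sort s i and bound variables y_j of sort B j. *)
Record pp_formula (n : nat) (s : 'I_n -> A) := PPFormula {
  pp_m : nat;
  pp_B : 'I_pp_m -> A;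
  pp_l : nat;
  pp_C : 'I_pp_l -> A;
  pp_r : forall k i, Hom (s i) (pp_C k);
  pp_s : forall k j, Hom (pp_B j) (pp_C k) }.

Arguments pp_B {n s} p j : rename.
Arguments pp_C {n s} p k : rename.
Arguments pp_r {n s} p k i : rename.
Arguments pp_s {n s} p k j : rename.

Definition pp_tuples (n : nat) (s : 'I_n -> A) (M : lmod A) : zmodType :=
  pprod (fun i => M (s i)).

Definition pp_sol (n : nat) (s : 'I_n -> A) (M : lmod A) (phi : pp_formula s) :
    {pred pp_tuples s M} := fun x =>
  `[< exists y : pp_tuples (pp_B phi) M, forall k,
        \sum_i lm_map M (pp_r phi k i) (x i)
          + \sum_j lm_map M (pp_s phi k j) (y j) = 0 >].
Arguments pp_sol {n s} M phi.

Fact pp_sol_zmod_closed n (s : 'I_n -> A) M (phi : pp_formula s) :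
  zmod_closed (pp_sol M phi).
Proof.
split=> [|x x' /asboolP[y Hy] /asboolP[y' Hy']]; apply/asboolP.
  exists 0 => k.
  by rewrite !big1 ?addr0 // => i _; exact: raddf0.
exists (y - y') => k.
rewrite (eq_bigr (fun i => lm_map M (pp_r phi k i) (x i)
  - lm_map M (pp_r phi k i) (x' i))); last by move=> i _; exact: raddfB.
rewrite (eq_bigr (fun j => lm_map M (pp_s phi k j) (y j)
  - lm_map M (pp_s phi k j) (y' j))); last by move=> j _; exact: raddfB.
by rewrite !sumrB addrACA -opprD Hy Hy' subrr.
Qed.
HB.instance Definition _ n (s : 'I_n -> A) M (phi : pp_formula s) :=
  GRing.isZmodClosed.Build _ (pp_sol M phi) (pp_sol_zmod_closed M phi).

Record pp_pair (n : nat) (s : 'I_n -> A) := PPPair {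
  pp_num : pp_formula s;
  pp_den : pp_formula s;
  pp_incl : forall M : lmod A, {subset pp_sol M pp_den <= pp_sol M pp_num} }.

Section Functor.
Variables (n : nat) (s : 'I_n -> A).

Definition pp_map_fun M N (h : mhom M N) (x : pp_tuples s M) : pp_tuples s N :=
  fun i => h (s i) (x i).
Fact pp_map_zmod_morphism M N (h : mhom M N) : zmod_morphism (pp_map_fun h).
Proof.
by move=> x y; apply: functional_extensionality_dep => i; exact: raddfB.
Qed.
HB.instance Definition _ M N (h : mhom M N) :=
  GRing.isZmodMorphism.Build _ _ (pp_map_fun h) (pp_map_zmod_morphism h).

Lemma pp_map_sol M N (h : mhom M N) (phi : pp_formula s) x :
  x \in pp_sol M phi -> pp_map_fun h x \in pp_sol N phi.
Proof.
move=> /asboolP[y Hy]; apply/asboolP; exists (fun j => h _ (y j)) => k.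
rewrite -[RHS](raddf0 (h (pp_C phi k))) -[in RHS](Hy k) raddfD !raddf_sum.
by congr (_ + _); apply: eq_bigr => i _; rewrite mh_nat.
Qed.

Definition pp_quot (M : lmod A) (p : pp_pair s) : zmodType :=
  Quotient.quot
    (subgroup_in (pp_sol M (pp_num p)) (pp_sol M (pp_den p))).

Definition pp_sub_fun M N (h : mhom M N) (phi : pp_formula s)
    (x : subgroup (pp_sol M phi)) : subgroup (pp_sol N phi) :=
  Sub (pp_map_fun h (val x)) (pp_map_sol h (valP x)).
Fact pp_sub_zmod_morphism M N (h : mhom M N) (phi : pp_formula s) :
  zmod_morphism (@pp_sub_fun M N h phi).
Proof. by move=> x y; apply: val_inj; rewrite /= !raddfB. Qed.
HB.instance Definition _ M N (h : mhom M N) (phi : pp_formula s) :=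
  GRing.isZmodMorphism.Build _ _ (@pp_sub_fun M N h phi)
    (@pp_sub_zmod_morphism M N h phi).
Definition pp_sub M N (h : mhom M N) (phi : pp_formula s) :
  addhom (subgroup (pp_sol M phi)) (subgroup (pp_sol N phi)) :=
  (@pp_sub_fun M N h phi : {additive _ -> _}).

Lemma pp_sub_den M N (h : mhom M N) (p : pp_pair s)
    (x : subgroup (pp_sol M (pp_num p))) :
  x \in subgroup_in (pp_sol M (pp_num p)) (pp_sol M (pp_den p)) ->
  pp_sub h (pp_num p) x
    \in subgroup_in (pp_sol N (pp_num p)) (pp_sol N (pp_den p)).
Proof. exact: pp_map_sol. Qed.

Definition pp_quot_map M N (h : mhom M N) (p : pp_pair s) :
  addhom (pp_quot M p) (pp_quot N p) := quot_map (@pp_sub_den M N h p).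

End Functor.
End PP.

Section Tensor.
Variable A : preadditive.
Implicit Types (Y : rmod A) (M N : lmod A).

(* The right action y |-> y.f of f : a -> b. *)
Definition ract Y (a b : A) (f : Hom a b) : addhom (Y b) (Y a) :=
  @lm_map (op A) Y b a f.

Record tgen Y M := TGen { tg_ob : A; tg_y : Y tg_ob; tg_m : M tg_ob }.
HB.instance Definition _ Y M := gen_eqMixin (tgen Y M).
HB.instance Definition _ Y M := gen_choiceMixin (tgen Y M).

Definition tfree Y M : zmodType := {freeg (tgen Y M)}.

Definition tbasis Y M (a : A) (y : Y a) (m : M a) : tfree Y M :=
  Freeg [:: (1, TGen y m)].

(* The first two families of relators give the sum over a of Y a (x)_Z M a,
   the third one passes to the coend. *)
Inductive trel Y M : tfree Y M -> Prop :=
| TRelDl a (y y' : Y a) (m : M a) :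
    trel (tbasis (y + y') m - (tbasis y m + tbasis y' m))
| TRelDr a (y : Y a) (m m' : M a) :
    trel (tbasis y (m + m') - (tbasis y m + tbasis y m'))
| TRelBal (a b : A) (f : Hom a b) (y : Y b) (m : M a) :
    trel (tbasis (ract Y f y) m
          - tbasis y (lm_map M f m)).

Definition tensor Y M : zmodType := Quotient.quot (generated (@trel Y M)).

Definition tens Y M (a : A) (y : Y a) (m : M a) : tensor Y M :=
  \pi_(Quotient.quot (generated (@trel Y M))) (tbasis y m).

Definition tlift_fun Y M (T : zmodType) (beta : forall a : A, Y a -> M a -> T)
    (x : tfree Y M) : T :=
  fglift (fun g : tgen Y M => beta (tg_ob g) (tg_y g) (tg_m g) : zmodule T) x.
Fact tlift_zmod_morphism Y M (T : zmodType) (beta : forall a : A, Y a -> M a -> T) :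
  zmod_morphism (tlift_fun beta).
Proof.
exact: (@lift_is_additive int (tgen Y M) (zmodule T)).
Qed.
HB.instance Definition _ Y M (T : zmodType) (beta : forall a : A, Y a -> M a -> T) :=
  GRing.isZmodMorphism.Build _ _ (tlift_fun beta) (tlift_zmod_morphism beta).

Lemma tlift_basis Y M (T : zmodType) (beta : forall a : A, Y a -> M a -> T) a y m :
  tlift_fun beta (tbasis y m) = beta a y m.
Proof. by rewrite /tlift_fun /tbasis liftU. Qed.

Lemma tfree_ind Y M (P : tfree Y M -> Prop) : P 0 ->
  (forall x y, P x -> P y -> P (x - y)) ->
  (forall a (y : Y a) (m : M a), P (tbasis y m)) -> forall x, P x.
Proof.
move=> P0 PB Pb x.
have PN z : P z -> P (- z) by move=> Pz; rewrite -sub0r; exact: PB.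
have PD y z : P y -> P z -> P (y + z).
  by move=> Py Pz; rewrite -[z]opprK; apply: PB => //; exact: PN.
rewrite -(freeg_sumE x); elim/big_ind: _ => // g _.
have -> : Freeg [:: (coeff g x, g)] = tbasis (tg_y g) (tg_m g) *~ coeff g x.
  by rewrite /tbasis freegU_mulz intz; move: (coeff g x) => k; case: (g).
have PMn n : P (tbasis (tg_y g) (tg_m g) *+ n).
  by elim: n => [|n IH]; rewrite ?mulr0n // mulrS; exact: PD.
by case: (coeff g x) => k; [exact: PMn | apply: PN; exact: PMn].
Qed.

(* The universal property of the coend of Y a (x)_Z M a. *)
Definition balanced Y M (T : zmodType) (beta : forall a : A, Y a -> M a -> T) :=
  [/\ forall a y y' m, beta a (y + y') m = beta a y m + beta a y' m,
      forall a y m m', beta a y (m + m') = beta a y m + beta a y m'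
    & forall (a b : A) (f : Hom a b) (y : Y b) (m : M a),
        beta a (ract Y f y) m
          = beta b y (lm_map M f m)].

Lemma tens_rel Y M (x y : tfree Y M) : trel (x - y) ->
  \pi_(Quotient.quot (generated (@trel Y M))) x
    = \pi_(Quotient.quot (generated (@trel Y M))) y.
Proof.
move=> R; apply/eqP; rewrite -Quotient.idealrBE.
by apply/asboolP => S; apply.
Qed.

Lemma tens_balanced Y M : balanced (@tens Y M).
Proof.
split=> *; rewrite /tens -?raddfD; apply: tens_rel;
  [exact: TRelDl | exact: TRelDr | exact: TRelBal].
Qed.

Lemma addhom_generated (G H : zmodType) (R : G -> Prop) (h : addhom G H) :
  (forall r, R r -> h r = 0) -> forall x, x \in generated R -> h x = 0.
Proof.
move=> hR x /asboolP Rx.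
pose K : {pred G} := fun x => h x == 0.
have Kz : zmod_closed K.
  split=> [|u v /eqP hu /eqP hv]; apply/eqP; first exact: raddf0.
  by rewrite raddfB hu hv subr0.
pose Km := GRing.isZmodClosed.Build G K Kz.
pose KS : zmodClosed G := HB.pack K Km.
by apply/eqP; apply: (Rx KS) => r /hR/eqP.
Qed.

Lemma tensor_universal Y M (T : zmodType) (beta : forall a : A, Y a -> M a -> T) :
  balanced beta ->
  exists! h : addhom (tensor Y M) T, forall a y m, h (tens y m) = beta a y m.
Proof.
move=> [bDl bDr bB].
pose l : addhom (tfree Y M) T := (tlift_fun beta : {additive _ -> _}).
have lE a (y : Y a) (m : M a) : l (tbasis y m) = beta a y m.
  exact: tlift_basis.
have l0 x : x \in generated (@trel Y M) -> l x = 0.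
  apply: addhom_generated => r [] *; rewrite raddfB ?[l (_ + _)]raddfD !lE.
  - by rewrite bDl subrr.
  - by rewrite bDr subrr.
  - by rewrite bB subrr.
pose k (q : tensor Y M) : T := l (repr q).
have kE x : k (\pi_(Quotient.quot (generated (@trel Y M))) x) = l x.
  apply/eqP; rewrite -subr_eq0 -raddfB; apply/eqP/l0.
  by rewrite Quotient.idealrBE reprK.
have ka : zmod_morphism k.
  move=> p q; rewrite -[p]reprK -[q]reprK -raddfB !kE; exact: raddfB.
pose kA := GRing.isZmodMorphism.Build _ _ k ka.
pose kh : {additive tensor Y M -> T} := HB.pack k kA.
exists (kh : addhom _ _); split=> [a y m|h hE].
  by rewrite -lE; exact: kE.
apply: addhom_ext => q; rewrite -[q]reprK; move: (repr q).
elim/tfree_ind => [|x y Hx Hy|a y m].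
- by rewrite !raddf0.
- by rewrite !raddfB Hx Hy.
- rewrite -/(tens y m) hE -lE; exact: kE.
Qed.

(* Y (x) h : Y (x) M -> Y (x) N, mapping y (x) m to y (x) h m. *)
Definition tfree_map Y M N (h : mhom M N) : addhom (tfree Y M) (tfree Y N) :=
  (tlift_fun (fun a (y : Y a) m => tbasis y (h a m)) : {additive _ -> _}).

Lemma tfree_map_rel Y M N (h : mhom M N) x :
  x \in generated (@trel Y M) -> tfree_map Y h x \in generated (@trel Y N).
Proof.
move=> /asboolP Rx; apply/asboolP => S RS.
pose K : {pred tfree Y M} := fun x => tfree_map Y h x \in S.
have Kz : zmod_closed K.
  split=> [|u v hu hv]; rewrite unfold_in /K ?raddf0 ?raddfB ?rpred0 //.
  exact: rpredB.
pose Km := GRing.isZmodClosed.Build _ K Kz.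
pose KS : zmodClosed (tfree Y M) := HB.pack K Km.
have bE a y m : tfree_map Y h (tbasis y m) = tbasis y (h a m).
  exact: tlift_basis.
apply: (Rx KS) => r Hr; change (tfree_map Y h r \in S).
case: Hr => [a y y' m|a y m m'|a b f y m]; rewrite raddfB.
- rewrite [tfree_map _ _ (_ + _)]raddfD !bE; apply: RS; exact: TRelDl.
- rewrite [tfree_map _ _ (_ + _)]raddfD !bE [h a (_ + _)]raddfD.
  apply: RS; exact: TRelDr.
- rewrite !bE mh_nat; apply: RS; exact: TRelBal.
Qed.

Definition tensor_map Y M N (h : mhom M N) : addhom (tensor Y M) (tensor Y N) :=
  quot_map (@tfree_map_rel Y M N h).

Lemma tensor_mapE Y M N (h : mhom M N) a (y : Y a) (m : M a) :
  tensor_map Y h (tens y m) = tens y (h a m).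
Proof.
apply: etrans (quot_map_pi (@tfree_map_rel Y M N h) _) _.
by congr (\pi_(_) _); exact: tlift_basis.
Qed.

End Tensor.

Definition int_in_rat : {pred rat} := fun x => x \is a Num.int.
Fact int_in_rat_zmod_closed : zmod_closed int_in_rat.
Proof. by split=> [|x y Zx Zy]; [exact: rpred0 | exact: rpredB]. Qed.
HB.instance Definition _ :=
  GRing.isZmodClosed.Build rat int_in_rat int_in_rat_zmod_closed.

Definition QZ : zmodType := Quotient.quot int_in_rat.

Section Dual.
Variable A : preadditive.

Definition precomp_fun (U V : zmodType) (f : addhom U V) (u : addhom V QZ) :
  addhom U QZ := addhom_comp u f.
Fact precomp_zmod_morphism U V (f : addhom U V) :
  zmod_morphism (precomp_fun f).
Proof. by move=> u v; apply: addhom_ext. Qed.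
HB.instance Definition _ U V (f : addhom U V) :=
  GRing.isZmodMorphism.Build _ _ (precomp_fun f) (precomp_zmod_morphism f).
Definition precomp U V (f : addhom U V) : addhom (addhom V QZ) (addhom U QZ) :=
  (precomp_fun f : {additive _ -> _}).

Definition dual (M : lmod A) : rmod A.
Proof.
exists (fun a : op A => addhom (M a) QZ : zmodType)
       (fun a b f => precomp (@lm_map A M b a f)).
- by move=> a; apply: addhom_ext => u; apply: addhom_ext => x /=; rewrite lm_map1.
- move=> a b c g f; apply: addhom_ext => u; apply: addhom_ext => x /=.
  by rewrite lm_mapM.
- move=> a b f g; apply: addhom_ext => u; apply: addhom_ext => x /=.
  by rewrite lm_mapD /= raddfD.
Defined.

Fact dual_map_nat M N (h : mhom M N) (a b : op A) (f : Hom a b) (u : dual N a) :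
  precomp (h b) (lm_map (dual N) f u) = lm_map (dual M) f (precomp (h a) u).
Proof. by apply: addhom_ext => x /=; rewrite mh_nat. Qed.
Definition dual_map M N (h : mhom M N) : mhom (dual N) (dual M) :=
  @MHom (op A) (dual N) (dual M) (fun a => precomp (h a)) (dual_map_nat h).

Definition dual_seq (S : sequence A) : sequence (op A) :=
  Sequence (dual_map (sqg S)) (dual_map (sqf S)).

End Dual.

(* Main.v *)
From HB Require Import structures.
From mathcomp Require Import all_boot all_order all_algebra.
From mathcomp Require Import generic_quotient ring_quotient.
From mathcomp Require Import boolp classical_sets.
Require Import Defs.

Set Implicit Arguments.
Unset Strict Implicit.
Unset Printing Implicit Defensive.

Import GRing.Theory.
Local Open Scope ring_scope.
Local Open Scope quotient_scope.

(** All the conditions are compared with one elementary statement about the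
    sequence 0 -> L -> M -> N -> 0, called [system_pure] below: it is short
    exact, and every solution in N of a finite homogeneous linear system over
    [A] lifts to a solution of the same system in M.

    A finite system is a finite presentation, and its solutions in a module
    are the maps from the presented module. Presented modules are finitely
    presented in the categorical sense ([presented_fp]), because elements of
    a direct limit, and equalities between them, live at some stage
    ([colimit_elementwise]). So pure-exactness implies [system_pure].

    Conversely let N be the quotient of a free module P by K. It is the direct
    limit of the modules P / R for finite subsets R of K, and under
    [system_pure] every map from P / R to N lifts to M
    ([pure_lift_span_quot]). Hence the pullbacks of the sequence along the
    maps P / R -> N split, and the sequence is their direct limit
    ([system_pure_limit_of_split]). Moreover a finitely presented X, being
    the direct limit of its own approximations, is a retract of one of them,
    which gives back pure-exactness ([system_pure_pure_exact]). A direct limit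
    of split sequences is [system_pure] because a solution in N already is
    one at some stage.

    For pp formulas, a pp formula is a linear system with some unknowns
    quantified away, so its solutions lift along M -> N and are reflected
    along L -> M ([pp_sol_lift], [pp_sol_reflect]); the systems themselves,
    as pairs with denominator 0, give the converse.

    Tensoring with Y commutes with direct limits and keeps split sequences
    exact, whence the exactness of Y (x) S for every Y
    ([limit_of_split_tensor_exact]). When Y is presented by the transpose of a
    system, Y (x) M is the cokernel of that system on M, and injectivity of
    Y (x) L -> Y (x) M says that the system has a solution in L once it has one
    in M; this is [system_pure] again ([tensor_injective_lifting]), and only
    finitely presented Y are used.

    Finally Hom(Y (x) M, Q/Z) = Hom(Y, M^* ), and Q/Z is an injective
    cogenerator. Thus duals are pure-injective ([dual_pure_injective]).
    Tensoring with the pure-injective module L^* allows the evaluation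
    character to be extended from L^* (x) L to L^* (x) M, which is a section of
    M^* -> L^*. In the other direction such a section extends the characters
    of Y (x) L to Y (x) M, so Y (x) L -> Y (x) M is injective for all Y
    ([dual_split_tensor_injective]). *)

(** * Additive maps, subgroups and quotients *)

Section AdditiveMaps.

Lemma dep_choice (I : Type) (T : I -> Type) (P : forall i, T i -> Prop) :
  (forall i, exists x, P i x) -> exists f : forall i, T i, forall i, P i (f i).
Proof.
move=> H; exists (fun i => projT1 (cid (H i))) => i; exact: projT2 (cid (H i)).
Qed.

Definition mk_addhom (U V : zmodType) (f : U -> V) (fB : zmod_morphism f) :
  addhom U V :=
  (HB.pack f (GRing.isZmodMorphism.Build U V f fB) : {additive U -> V}).

Fact mk_subgroup_closed (G : zmodType) (P : G -> Prop) (P0 : P 0)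
  (PB : forall x y, P x -> P y -> P (x - y)) :
  zmod_closed ((fun x => `[< P x >]) : {pred G}).
Proof.
split=> [|x y /asboolP Px /asboolP Py]; apply/asboolP => //; exact: PB.
Qed.

Definition mk_subgroup (G : zmodType) (P : G -> Prop) (P0 : P 0)
    (PB : forall x y, P x -> P y -> P (x - y)) : zmodClosed G :=
  HB.pack ((fun x => `[< P x >]) : {pred G})
    (GRing.isZmodClosed.Build G _ (mk_subgroup_closed P0 PB)).

Lemma mk_subgroupP (G : zmodType) (P : G -> Prop) (P0 : P 0)
    (PB : forall x y, P x -> P y -> P (x - y)) x :
  reflect (P x) (x \in mk_subgroup P0 PB).
Proof. exact: asboolP. Qed.

Section Quotients.
Variables (G : zmodType) (I : zmodClosed G).

Definition proj : addhom G (Quotient.quot I) :=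
  (\pi_(Quotient.quot I) : {additive _ -> _}).

Lemma proj_eq0 x : proj x = 0 <-> x \in I.
Proof.
rewrite -[x in x \in _]subr0 Quotient.idealrBE -(raddf0 proj).
by split=> /eqP.
Qed.

Lemma proj_surj (q : Quotient.quot I) : exists x, proj x = q.
Proof. by exists (repr q); apply: reprK. Qed.

Section Lift.
Variables (T : zmodType) (h : addhom G T) (h0 : forall x, x \in I -> h x = 0).

Lemma quot_lift_eq x : h (repr (proj x)) = h x.
Proof.
apply/eqP; rewrite -subr_eq0 -raddfB; apply/eqP/h0/proj_eq0.
by rewrite raddfB [X in X - _]reprK subrr.
Qed.

Fact quot_lift_zmod : zmod_morphism (fun q : Quotient.quot I => h (repr q)).
Proof.
move=> p q; have [x <-] := proj_surj p; have [y <-] := proj_surj q.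
by rewrite -raddfB !quot_lift_eq raddfB.
Qed.

Definition quot_lift : addhom (Quotient.quot I) T := mk_addhom quot_lift_zmod.

Lemma quot_liftE x : quot_lift (proj x) = h x.
Proof. exact: quot_lift_eq. Qed.

End Lift.
End Quotients.

Lemma injective_ker0 (U V : zmodType) (f : addhom U V) :
  (forall u, f u = 0 -> u = 0) -> injective f.
Proof.
move=> f0 x y E; apply/eqP; rewrite -subr_eq0; apply/eqP/f0.
by rewrite raddfB E subrr.
Qed.

Lemma injective_eq0 (U V : zmodType) (f : addhom U V) u :
  injective f -> f u = 0 -> u = 0.
Proof. by move=> fi fu; apply: fi; rewrite raddf0. Qed.

End AdditiveMaps.

(** * Characters with values in a divisible group *)

Section Characters.

Definition divisible (D : zmodType) :=
  forall (q : D) n, (0 < n)%N -> exists p, p *+ n = q.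

(** The graph of an additive map defined on some subgroup of [V]. Working with
    graphs lets Zorn's lemma act on plain relations, with no subgroup types. *)
Record additive_graph (V D : zmodType) (R : V -> D -> Prop) : Prop := {
  graph0 : R 0 0;
  graphB : forall u v p q, R u p -> R v q -> R (u - v) (p - q);
  graph_fun : forall q, R 0 q -> q = 0 }.

Section Graphs.
Variables (V D : zmodType).
Implicit Types (R : V -> D -> Prop).

Lemma graphN R : additive_graph R -> forall u p, R u p -> R (- u) (- p).
Proof.
by move=> Rg u p Rup; rewrite -sub0r -[- p]sub0r; apply: graphB => //; exact: graph0.
Qed.

Lemma graphD R : additive_graph R ->
  forall u v p q, R u p -> R v q -> R (u + v) (p + q).
Proof.
move=> Rg u v p q Rup Rvq; rewrite -[v]opprK -[q]opprK.
by apply: graphB => //; exact: graphN.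
Qed.

Lemma graphMn R : additive_graph R -> forall u p n, R u p -> R (u *+ n) (p *+ n).
Proof.
move=> Rg u p n Rup; elim: n => [|n IH]; rewrite ?mulr0n; first exact: graph0.
by rewrite !mulrS; exact: graphD.
Qed.

Lemma graph_uniq R : additive_graph R -> forall u p q, R u p -> R u q -> p = q.
Proof.
move=> Rg u p q Rp Rq; apply/eqP; rewrite -subr_eq0; apply/eqP.
by apply: (graph_fun Rg); rewrite -(subrr u); exact: graphB.
Qed.

Definition graph_extend R (v : V) (q : D) : V -> D -> Prop := fun u p =>
  exists u0 p0 (k : int), [/\ R u0 p0, u = u0 + v *~ k & p = p0 + q *~ k].

(** The extension stays single-valued as soon as [q] is compatible with the
    multiples of [v] that already have a value. *)
Lemma graph_extend_additive R v q : additive_graph R ->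
  (forall n p, R (v *+ n) p -> p = q *+ n) -> additive_graph (graph_extend R v q).
Proof.
move=> Rg Rvq.
have Rz (k : int) p : R (v *~ k) p -> p = q *~ k.
  case: k => n; first exact: Rvq.
  rewrite NegzE !mulrNz -!pmulrn => /(graphN Rg); rewrite opprK => /Rvq <-.
  by rewrite opprK.
split.
- exists 0, 0, 0; split; rewrite ?mulr0z ?addr0 //; exact: graph0.
- move=> _ _ _ _ [u0 [p0 [k [R0 -> ->]]]] [u1 [p1 [l [R1 -> ->]]]].
  exists (u0 - u1), (p0 - p1), (k - l); split; first exact: graphB.
  + by rewrite mulrzBr opprD addrACA.
  + by rewrite mulrzBr opprD addrACA.
- move=> _ [u0 [p0 [k [R0 E ->]]]].
  have E1 : v *~ k = - u0 by apply/eqP; rewrite -addr_eq0 addrC -E.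
  have := graphN Rg R0; rewrite -E1 => /Rz <-; exact: addrN.
Qed.

Lemma graph_extend_sub R v q u p : R u p -> graph_extend R v q u p.
Proof. by move=> Rup; exists u, p, 0; rewrite !mulr0z !addr0. Qed.

Lemma graph_extend_val R v q : additive_graph R -> graph_extend R v q v q.
Proof. by move=> Rg; exists 0, 0, 1; rewrite !mulr1z !add0r; split=> //; exact: graph0. Qed.

(** The order of [x] modulo [H]; an infinite order is encoded by [n = 0]. *)
Definition order_in (H : V -> Prop) (x : V) (n : nat) : Prop :=
  forall k, H (x *+ k) <-> (n %| k)%N.

Lemma ex_order_in (H : V -> Prop) (x : V) : H 0 ->
  (forall u v, H u -> H v -> H (u - v)) -> exists n, order_in H x n.
Proof.
move=> H0 HB.
have HN u : H u -> H (- u) by move=> Hu; rewrite -sub0r; exact: HB.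
have HD u v : H u -> H v -> H (u + v).
  by move=> Hu Hv; rewrite -[v]opprK; apply: HB => //; exact: HN.
have HM u n : H u -> H (u *+ n).
  by move=> Hu; elim: n => [|n IH]; rewrite ?mulr0n // mulrS; exact: HD.
have [[m [m0 Hm]]|noH] := pselect (exists m, (0 < m)%N /\ H (x *+ m)); last first.
  exists 0%N => k; split=> [Hk|]; last by rewrite dvd0n => /eqP->; rewrite mulr0n.
  by case: k Hk => // k Hk; case: noH; exists k.+1.
have exP : exists m, (0 < m)%N && `[< H (x *+ m) >].
  by exists m; rewrite m0; apply/asboolP.
case: (ex_minnP exP) => n /andP[n0 /asboolP Hn] min.
exists n => k; split=> [Hk|/dvdnP[j ->]]; last by rewrite mulnC mulrnA; exact: HM.
rewrite /dvdn; apply: contraT; rewrite -lt0n => r0.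
have /min : (0 < k %% n)%N && `[< H (x *+ (k %% n)) >].
  rewrite r0; apply/asboolP.
  have -> : x *+ (k %% n) = x *+ k - (x *+ n) *+ (k %/ n).
    by rewrite {2}(divn_eq k n) mulrnDr mulnC mulrnA addrAC subrr add0r.
  by apply: HB => //; exact: HM.
by rewrite leqNgt ltn_mod n0.
Qed.

Hypothesis Ddiv : divisible D.

(** Let [n] be the order of [v] modulo the domain of [R]. If [n > 0], an
    [n]-th part of the value at [v *+ n] is a possible value at [v]; it exists
    by divisibility. If [n = 0], every value is possible. *)
Lemma graph_extend_exists R v : additive_graph R -> exists q,
  additive_graph (graph_extend R v q).
Proof.
move=> Rg; pose H u := exists p, R u p.
have [||n Hn] := @ex_order_in H v.
- by exists 0; exact: graph0.
- by move=> u w [p Rp] [q Rq]; exists (p - q); exact: graphB.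
have [p Rp] : exists p, R (v *+ n) p by apply/Hn; exact: dvdnn.
have [q qE] : exists q, q *+ n = p.
  case: (posnP n) => [n0|/Ddiv//]; exists 0; rewrite mul0rn.
  by apply/esym/(graph_fun Rg); move: Rp; rewrite n0 mulr0n.
exists q; apply: graph_extend_additive => // k e Re.
have /dvdnP[j kE] : (n %| k)%N by apply/Hn; exists e.
apply: (graph_uniq Rg Re); rewrite kE mulnC !mulrnA qE; exact: graphMn.
Qed.

(** By Zorn's lemma there is a maximal graph above [R]; it is total, since
    otherwise one more element could be added to its domain. *)
Lemma additive_graph_total R : additive_graph R ->
  exists h : addhom V D, forall v q, R v q -> h v = q.
Proof.
move=> Rg.
pose T := {R' : V -> D -> Prop |
             additive_graph R' /\ forall v q, R v q -> R' v q}.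
pose le (s t : T) := `[< forall v q, sval s v q -> sval t v q >].
pose mkT R' g s : T := exist _ R' (conj g s).
have t0 : T by exists R.
have [||C Ctot|[M [Mg RM]] Mmax] := @ZL_preorder T t0 le.
- by move=> t; apply/asboolP.
- by move=> r s t /asboolP rs /asboolP st; apply/asboolP => v q /rs/st.
- have [[c Cc]|noC] := pselect (exists c, C c); last first.
    by exists t0 => s Cs; case: noC; exists s.
  have Ug : additive_graph (fun v q => exists2 s, C s & sval s v q).
    split.
    + exists c => //; case: (svalP c) => cg _; exact: graph0.
    + move=> u v p q [s Cs su] [t Ct tv].
      case: (Ctot s t Cs Ct) => /asboolP le_st.
        exists t => //; case: (svalP t) => tg _; apply: graphB => //; exact: le_st.
      exists s => //; case: (svalP s) => sg _; apply: graphB => //; exact: le_st.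
    + by move=> q [s Cs]; case: (svalP s) => sg _; exact: graph_fun.
  have Us : forall v q, R v q -> exists2 s, C s & sval s v q.
    by move=> v q Rvq; exists c => //; case: (svalP c) => _; apply.
  exists (mkT _ Ug Us) => s Cs; apply/asboolP => v q sv /=.
  by exists s.
have Mtot v : exists q, M v q.
  have [q Mq] := graph_extend_exists v Mg.
  have MM' : forall u p, R u p -> graph_extend M v q u p.
    by move=> u p /RM; exact: graph_extend_sub.
  exists q.
  have /Mmax/asboolP : le (mkT _ Mg RM) (mkT _ Mq MM').
    by apply/asboolP => u p /=; exact: graph_extend_sub.
  by apply; exact: graph_extend_val.
have [h hM] := choice Mtot.
have hB : zmod_morphism h.
  by move=> u v; apply: (graph_uniq Mg (hM _)); exact: graphB.
exists (mk_addhom hB) => v q /RM; exact: graph_uniq.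
Qed.

End Graphs.

Lemma divisible_injective (D U V : zmodType) (i : addhom U V) (h : addhom U D) :
  divisible D -> injective i -> exists k : addhom V D, forall u, k (i u) = h u.
Proof.
move=> Dd ii.
have [|k kE] := @additive_graph_total V D Dd (fun v q => exists2 u, v = i u & q = h u).
  split.
  - by exists 0; rewrite raddf0.
  - by move=> _ _ _ _ [u -> ->] [v -> ->]; exists (u - v); rewrite raddfB.
  - by move=> q [u iu ->]; rewrite (_ : u = 0) ?raddf0 //; apply: ii; rewrite raddf0.
by exists k => u; apply: kE; exists u.
Qed.

Definition qz : addhom rat QZ := proj int_in_rat.

Lemma qz_eq0 x : qz x = 0 <-> x \is a Num.int.
Proof. exact: proj_eq0. Qed.

Lemma QZ_divisible : divisible QZ.
Proof.
move=> q n n0; have [x <-] := proj_surj q; exists (qz (x / n%:R)).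
rewrite -raddfMn -[_ *+ _]mulr_natr mulfVK // Num.Theory.pnatr_eq0 -lt0n //.
Qed.

(** On the subgroup generated by [H] and [x], send [H] to 0 and [x] to [1/m],
    where [m] is the order of [x] modulo [H], or 2 when this order is
    infinite; then extend by divisibility of Q/Z. *)
Lemma character_separates (V : zmodType) (H : V -> Prop) (x : V) : H 0 ->
  (forall u v, H u -> H v -> H (u - v)) -> ~ H x ->
  exists h : addhom V QZ, (forall u, H u -> h u = 0) /\ h x <> 0.
Proof.
move=> H0 HB Hx.
have [n Hn] := ex_order_in x H0 HB.
have n1 : n != 1%N by apply: contra_notN Hx => /eqP n1; apply/(Hn 1%N); rewrite n1.
pose m := if n == 0%N then 2%N else n.
have m1 : (1 < m)%N by rewrite /m; case: eqP => // n0; case: n n0 n1 {Hn m} => [|[]].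
pose q := qz (m%:R^-1).
have Rg : additive_graph (fun u (p : QZ) => H u /\ p = 0).
  split=> // [u v _ _ [Hu ->] [Hv ->]|q0 []//].
  by split; [exact: HB | rewrite subrr].
have m0 : (m%:R : rat) != 0 by rewrite Num.Theory.pnatr_eq0; case: m m1 {q}.
have Eg : additive_graph (graph_extend (fun u (p : QZ) => H u /\ p = 0) x q).
  apply: graph_extend_additive => // k p [/Hn nk ->].
  have /dvdnP[j ->] : (m %| k)%N.
    by rewrite /m; case: eqP nk => // ->; rewrite dvd0n => /eqP->.
  rewrite mulnC mulrnA (_ : q *+ m = 0) ?mul0rn //.
  rewrite (_ : q *+ m = qz (m%:R^-1 * m%:R)).
    by rewrite mulVf //; apply/qz_eq0; exact: rpred1.
  by rewrite mulr_natr raddfMn.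
have [h hE] := additive_graph_total QZ_divisible Eg.
exists h; split=> [u Hu|].
  by apply: hE; apply: graph_extend_sub.
rewrite (hE x q); last exact: graph_extend_val.
move=> /qz_eq0/Num.Theory.intrP[z mz].
have : (1 : rat) = m%:R * z%:~R by rewrite -mz mulfV.
move=> /eqP; rewrite (_ : m%:R * z%:~R = (m%:Z * z)%:~R); last by rewrite intrM.
rewrite -[1](_ : 1%:~R = 1) // eqr_int => /eqP /(congr1 absz); rewrite abszM /=.
by move/esym/eqP; rewrite muln_eq1 => /andP[/eqP E _]; rewrite E in m1.
Qed.

Lemma character_detects (V : zmodType) (x : V) :
  (forall h : addhom V QZ, h x = 0) -> x = 0.
Proof.
move=> hx; apply: contrapT => x0.
have [//||//|h [_ /(_ (hx h))]//] := @character_separates V (fun u => u = 0) x.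
by move=> u v -> ->; rewrite subrr.
Qed.

End Characters.

(** * Modules: short exact sequences, quotients, germs along a directed poset *)

Section MapsOfModules.
Variable A : preadditive.

Lemma mhom_app (M N : lmod A) (f g : mhom M N) : f = g -> forall a x, f a x = g a x.
Proof. by move=> ->. Qed.

End MapsOfModules.

Section ShortExact.
Variables (A : preadditive) (S : sequence A) (Se : short_exact S).

Lemma short_exact_comp0 b (x : sqL S b) : sqg S b (sqf S b x) = 0.
Proof. by have [_ fg _] := Se b; apply/fg; exists x. Qed.

(** A short exact sequence makes [sqL S] the kernel of [sqg S]: preimages
    under the injection [sqf S] are unique, hence additive and natural. *)
Lemma kernel_factor (X : lmod A) (v : mhom X (sqM S)) :
  mhom_comp (sqg S) v = 0 -> exists u, mhom_comp (sqf S) u = v.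
Proof.
move=> gv.
have /dep_choice[u uE] : forall b, exists u : X b -> sqL S b,
    forall x, sqf S b (u x) = v b x.
  move=> b; have [_ fg _] := Se b.
  have /choice[u uE] : forall x, exists y, sqf S b y = v b x.
    by move=> x; apply/fg; have /mhom_app/(_ b x) := gv.
  by exists u.
have uB b : zmod_morphism (u b).
  move=> x y; have [fi _ _] := Se b; apply: fi.
  by rewrite raddfB !uE raddfB.
have uN b b' (f : Hom b b') x :
    mk_addhom (uB b') (lm_map X f x) = lm_map (sqL S) f (mk_addhom (uB b) x).
  by have [fi _ _] := Se b'; apply: fi; rewrite mh_nat /= !uE mh_nat.
by exists (MHom uN); apply: mhom_ext => b x; exact: uE.
Qed.

(** [id - s g] lands in the kernel of [g], so it factors through [f]; the
    factor is the retraction. *)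
Lemma split_retraction (s : mhom (sqN S) (sqM S)) :
  mhom_comp (sqg S) s = mhom_id (sqN S) ->
  exists r : mhom (sqM S) (sqL S), mhom_comp r (sqf S) = mhom_id (sqL S) /\
    mhom_id (sqM S) = mhom_comp (sqf S) r + mhom_comp s (sqg S).
Proof.
move=> sE; pose v := mhom_id (sqM S) - mhom_comp s (sqg S).
have vE b x : v b x = x - s b (sqg S b x) by [].
have gs b x : sqg S b (s b x) = x by exact (mhom_app sE x).
have [r rE] : exists r, mhom_comp (sqf S) r = v.
  by apply: kernel_factor; apply: mhom_ext => b x; rewrite /= raddfB gs subrr.
have fr b x : sqf S b (r b x) = x - s b (sqg S b x).
  by rewrite -vE -rE.
exists r; split; apply: mhom_ext => b x /=; last by rewrite fr subrK.
have [fi _ _] := Se b; apply: fi; rewrite fr.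
by rewrite short_exact_comp0 // raddf0 subr0.
Qed.

End ShortExact.

Section QuotientModules.
Variables (A : preadditive) (M : lmod A) (I : forall a, zmodClosed (M a)).
Hypothesis I_stable : forall a b (f : Hom a b) x, x \in I a -> lm_map M f x \in I b.

Definition quotient_mod_map a b (f : Hom a b) :
  addhom (Quotient.quot (I a)) (Quotient.quot (I b)) :=
  quot_map (fun x Ix => I_stable f Ix).

Lemma quotient_mod_mapE a b (f : Hom a b) x :
  quotient_mod_map f (proj (I a) x) = proj (I b) (lm_map M f x).
Proof. exact: (quot_map_pi (fun x Ix => I_stable f Ix)). Qed.

Definition quotient_mod : lmod A.
Proof.
exists (fun a => Quotient.quot (I a) : zmodType) quotient_mod_map.
- move=> a; apply: addhom_ext => q; have [x <-] := proj_surj q.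
  by rewrite quotient_mod_mapE lm_map1.
- move=> a b c g f; apply: addhom_ext => q; have [x <-] := proj_surj q.
  rewrite -[RHS]/(quotient_mod_map g (quotient_mod_map f (proj _ x))).
  by rewrite !quotient_mod_mapE lm_mapM.
- move=> a b f g; apply: addhom_ext => q; have [x <-] := proj_surj q.
  rewrite -[RHS]/(quotient_mod_map f (proj _ x) + quotient_mod_map g (proj _ x)).
  by rewrite !quotient_mod_mapE lm_mapD [LHS](raddfD (proj (I b))).
Defined.

Definition quotient_proj : mhom M quotient_mod :=
  @MHom A M quotient_mod (fun a => proj (I a)) (fun a b f x => esym (quotient_mod_mapE f x)).

Lemma quotient_proj_eq0 a (x : M a) : quotient_proj a x = 0 <-> x \in I a.
Proof. exact: proj_eq0. Qed.

Lemma quotient_proj_surj a (q : quotient_mod a) : exists x, quotient_proj a x = q.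
Proof. exact: proj_surj. Qed.

Section Lift.
Variables (N : lmod A) (h : mhom M N).
Hypothesis h0 : forall a x, x \in I a -> h a x = 0.

Fact quotient_desc_nat a b (f : Hom a b) (q : quotient_mod a) :
  quot_lift (@h0 b) (lm_map quotient_mod f q) = lm_map N f (quot_lift (@h0 a) q).
Proof.
have [x <-] := proj_surj q.
rewrite [lm_map quotient_mod f _](quotient_mod_mapE f x) [LHS](quot_liftE (@h0 b)).
by rewrite [quot_lift _ _](quot_liftE (@h0 a)) mh_nat.
Qed.

Definition quotient_desc : mhom quotient_mod N := MHom quotient_desc_nat.

Lemma quotient_descE a x : quotient_desc a (quotient_proj a x) = h a x.
Proof. exact: quot_liftE. Qed.

End Lift.
End QuotientModules.

Section DependentProduct.
Variables (I : Type) (G : I -> zmodType).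

Definition dep_prod : Type := forall i, G i.
HB.instance Definition _ := gen_eqMixin dep_prod.
HB.instance Definition _ := gen_choiceMixin dep_prod.

Definition dprod_add (x y : dep_prod) : dep_prod := fun i => x i + y i.
Fact dprod_addA : associative dprod_add.
Proof. by move=> x y z; apply: functional_extensionality_dep => i; exact: addrA. Qed.
Fact dprod_addC : commutative dprod_add.
Proof. by move=> x y; apply: functional_extensionality_dep => i; exact: addrC. Qed.
Fact dprod_add0 : left_id (fun i => 0) dprod_add.
Proof. by move=> x; apply: functional_extensionality_dep => i; exact: add0r. Qed.
Fact dprod_addN : left_inverse (fun i => 0) (fun x i => - x i) dprod_add.
Proof. by move=> x; apply: functional_extensionality_dep => i; exact: addNr. Qed.
HB.instance Definition _ := GRing.isZmodule.Build dep_prod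
  dprod_addA dprod_addC dprod_add0 dprod_addN.

End DependentProduct.

Section Germs.
Variables (d : Order.disp_t) (I : porderType d) (dirI : directed I).

(** The group of germs, a product modulo the families that vanish from some
    index on, detects vanishing in a direct limit: an element of a stage has
    germ 0 exactly when some transition map kills it. No choice of
    representatives is involved in its construction. *)
Definition eventually_zero (G : I -> zmodType) (x : dep_prod G) : Prop :=
  exists i, forall j, (i <= j)%O -> x j = 0.

Fact eventually_zero0 G : eventually_zero (0 : dep_prod G).
Proof. by case: dirI => [[i] _]; exists i. Qed.

Fact eventually_zeroB G (x y : dep_prod G) :
  eventually_zero x -> eventually_zero y -> eventually_zero (x - y).
Proof.
move=> [i Hi] [j Hj]; have [k [ik jk]] := dirI.2 i j; exists k => l kl.
rewrite -[LHS]/(x l - y l) Hi ?Hj ?subrr //; exact: Order.POrderTheory.le_trans kl.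
Qed.

Definition null_germs G : zmodClosed (dep_prod G) :=
  mk_subgroup (eventually_zero0 G) (@eventually_zeroB G).

Definition germ_group G : zmodType := Quotient.quot (null_germs G).

Fact dprod_map_zmod (G H : I -> zmodType) (f : forall i, addhom (G i) (H i)) :
  zmod_morphism ((fun x i => f i (x i)) : dep_prod G -> dep_prod H).
Proof. by move=> x y; apply: functional_extensionality_dep => i; exact: raddfB. Qed.

Definition dep_prod_map G H (f : forall i, addhom (G i) (H i)) :
  addhom (dep_prod G) (dep_prod H) := mk_addhom (dprod_map_zmod f).

Fact dprod_map_null G H (f : forall i, addhom (G i) (H i)) x :
  x \in null_germs G -> dep_prod_map f x \in null_germs H.
Proof.
move=> /mk_subgroupP[i Hi]; apply/mk_subgroupP; exists i => j ij.
by rewrite /= Hi // raddf0.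
Qed.

Definition germs_map G H (f : forall i, addhom (G i) (H i)) :
  addhom (germ_group G) (germ_group H) := quot_map (@dprod_map_null G H f).

Lemma germs_mapE G H (f : forall i, addhom (G i) (H i)) (x : dep_prod G) :
  germs_map f (proj (null_germs G) x) = proj (null_germs H) (dep_prod_map f x).
Proof. exact: (quot_map_pi (@dprod_map_null G H f)). Qed.

Section Embedding.
Variables (G : I -> zmodType) (t : forall i j, (i <= j)%O -> addhom (G i) (G j)).
Hypothesis tM : forall i j k (ij : (i <= j)%O) (jk : (j <= k)%O) (ik : (i <= k)%O) x,
  t jk (t ij x) = t ik x.

Definition restart i (x : G i) : dep_prod G := fun j =>
  if pselect (i <= j)%O is left ij then t ij x else 0.

Lemma restartE i j (ij : (i <= j)%O) x : restart x j = t ij x.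
Proof.
rewrite /restart; case: pselect => [ij'|]; last by rewrite ij.
by rewrite (bool_irrelevance ij ij').
Qed.

Fact restart_zmod i : zmod_morphism (@restart i).
Proof.
move=> x y; apply: functional_extensionality_dep => j.
rewrite -[RHS]/(restart x j - restart y j) /restart.
by case: pselect => ij; rewrite ?raddfB ?subr0.
Qed.

Definition germ i : addhom (G i) (germ_group G) :=
  addhom_comp (proj (null_germs G)) (mk_addhom (@restart_zmod i)).

Lemma germ_map i j (ij : (i <= j)%O) x : germ j (t ij x) = germ i x.
Proof.
rewrite -[LHS]/(proj (null_germs G) (restart (t ij x))).
rewrite -[RHS]/(proj (null_germs G) (restart x)).
apply/eqP; rewrite -subr_eq0 -raddfB; apply/eqP/proj_eq0/mk_subgroupP.
exists j => k jk; have ik := Order.POrderTheory.le_trans ij jk.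
rewrite -[LHS]/(restart (t ij x) k - restart x k).
by rewrite (restartE jk) (restartE ik) (tM ij jk ik) subrr.
Qed.

Lemma germ_eq0 i x : germ i x = 0 -> exists j (ij : (i <= j)%O), t ij x = 0.
Proof.
move=> /proj_eq0/mk_subgroupP[k Hk]; have [j [ij kj]] := dirI.2 i k.
by exists j, ij; rewrite -(restartE ij); exact: Hk.
Qed.

End Embedding.

Section Descent.
Variables (G : I -> zmodType) (t : forall i j, (i <= j)%O -> addhom (G i) (G j)).
Variables (X : zmodType) (l : forall i, addhom (G i) X).
Hypothesis lt : forall i j (ij : (i <= j)%O) x, l j (t ij x) = l i x.
Hypothesis l_surj : forall x, exists i e, l i e = x.
Hypothesis l_eq0 : forall i e, l i e = 0 -> exists j (ij : (i <= j)%O), t ij e = 0.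

(** Two representatives of an element of [X] agree at a common later stage, so
    the value of a compatible family on them is the same; this defines the map
    out of [X]. *)
Lemma elementwise_descent (Z : zmodType) (k : forall i, addhom (G i) Z) :
  (forall i j (ij : (i <= j)%O) x, k j (t ij x) = k i x) ->
  exists! u : addhom X Z, forall i e, u (l i e) = k i e.
Proof.
move=> kt.
have k0 i e : l i e = 0 -> k i e = 0.
  by move=> /l_eq0[j [ij E]]; rewrite -(kt i j ij) E raddf0.
(* Relations in X between elements of three stages hold at a common later stage. *)
have kB i j m e e' e'' : l i e = l j e' - l m e'' -> k i e = k j e' - k m e''.
  have [n [inn jn]] := dirI.2 i j; have [p [np mp]] := dirI.2 n m.
  have ip := Order.POrderTheory.le_trans inn np.
  have jp := Order.POrderTheory.le_trans jn np.
  rewrite -(lt ip) -(lt jp) -(lt mp) -(kt _ _ ip) -(kt _ _ jp) -(kt _ _ mp).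
  move=> E; have /k0 : l p (t ip e - (t jp e' - t mp e'')) = 0.
    by rewrite raddfB [X in _ - X]raddfB E subrr.
  by rewrite raddfB [X in _ - X]raddfB => /eqP; rewrite subr_eq0 => /eqP.
have [u uE] : exists u : X -> Z, forall i e, u (l i e) = k i e.
  have /choice[u uP] : forall x, exists z, forall i e, l i e = x -> k i e = z.
    move=> x; have [i [e <-]] := l_surj x; exists (k i e) => j e' E.
    have := @kB j i i e' e 0; rewrite (raddf0 (l i)) (raddf0 (k i)) !subr0; exact.
  by exists u => i e; rewrite -(uP _ i e).
have uB : zmod_morphism u.
  move=> x y; have [i [e <-]] := l_surj x; have [j [e' <-]] := l_surj y.
  have [m [e'' E]] := l_surj (l i e - l j e').
  by rewrite -E !uE; exact: kB.
exists (mk_addhom uB); split=> [//|v vE]; apply: addhom_ext => x.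
by have [i [e <-]] := l_surj x; rewrite vE -uE.
Qed.

End Descent.
End Germs.

Definition Ab_elementwise (d : Order.disp_t) (I : porderType d)
    (D : diagram Ab I) (X : zmodType) (c : cocone D X) : Prop :=
  (forall x : X, exists i (e : (D i : zmodType)), (leg c i : addhom _ _) e = x) /\
  (forall i (e : (D i : zmodType)), (leg c i : addhom _ _) e = 0 ->
     exists j (ij : (i <= j)%O), (dg_map D ij : addhom _ _) e = 0).

Lemma Ab_elementwise_colimit d (I : porderType d) (D : diagram Ab I) X
    (c : cocone D X) :
  directed I -> Ab_elementwise c -> is_colimit c.
Proof.
move=> dirI [cs c0] Z k.
have mapE (E : diagram Ab I) (Y : zmodType) (h : cocone E Y) i j (ij : (i <= j)%O) x :
    (leg h j : addhom _ _) ((dg_map E ij : addhom _ _) x) = (leg h i : addhom _ _) x.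
  by rewrite -[in RHS](leg_map h ij).
have [u [uE uU]] := @elementwise_descent d I dirI (fun i => D i) (dg_map D) X (leg c)
  (mapE _ _ c) cs c0 Z (leg k) (mapE _ _ k).
exists u; split=> [i|v vE]; first by apply: addhom_ext => e; exact: uE.
by apply: uU => i e; rewrite -vE.
Qed.

(** * Direct limits of modules, described by elements *)

Section ModuleColimits.
Variable A : preadditive.

Section Elementwise.
Variables (d : Order.disp_t) (I : porderType d).
Variables (D : diagram (Mod A) I) (X : lmod A).

Definition dg_hom i j (ij : (i <= j)%O) : mhom (D i) (D j) := dg_map D ij.
Definition leg_hom (c : cocone D X) i : mhom (D i) X := leg c i.

Lemma dg_homM i j k (ij : (i <= j)%O) (jk : (j <= k)%O) (ik : (i <= k)%O) a x :
  dg_hom jk a (dg_hom ij a x) = dg_hom ik a x.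
Proof. by rewrite /dg_hom -(dg_comp D ij jk ik). Qed.

Lemma leg_hom_map (c : cocone D X) i j (ij : (i <= j)%O) a x :
  leg_hom c j a (dg_hom ij a x) = leg_hom c i a x.
Proof. by rewrite /leg_hom -(leg_map c ij). Qed.

Definition elementwise (c : cocone D X) : Prop :=
  (forall a (x : X a), exists i e, leg_hom c i a e = x) /\
  (forall i a e, leg_hom c i a e = 0 -> exists j (ij : (i <= j)%O), dg_hom ij a e = 0).

Hypothesis dirI : directed I.

(** The elements that come from some stage form a submodule [J], and the
    projection onto [X / J] agrees with 0 on every stage. By the uniqueness
    part of the universal property it is 0, so [J] is everything. *)
Lemma colimit_surj (c : cocone D X) : is_colimit c ->
  forall a (x : X a), exists i e, leg_hom c i a e = x.
Proof.
move=> cc.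
pose P a (x : X a) := exists i e, leg_hom c i a e = x.
have P0 a : P a 0 by case: dirI => [[i] _]; exists i, 0; rewrite raddf0.
have PB a x y : P a x -> P a y -> P a (x - y).
  move=> [i [e <-]] [j [e' <-]]; have [k [ik jk]] := dirI.2 i j.
  exists k, (dg_hom ik a e - dg_hom jk a e').
  by rewrite raddfB !leg_hom_map.
pose J a := mk_subgroup (P0 a) (PB a).
have Jst a b (f : Hom a b) x : x \in J a -> lm_map X f x \in J b.
  move=> /mk_subgroupP[i [e <-]]; apply/mk_subgroupP; exists i, (lm_map (D i) f e).
  by rewrite mh_nat.
pose k0 i : mhom (D i) (quotient_mod Jst) := 0.
have k0M i j (ij : (i <= j)%O) : mhom_comp (k0 j) (dg_hom ij) = k0 i.
  exact: mhom_ext.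
have [u [_ uU]] := cc (quotient_mod Jst) (Cocone (C := Mod A) (X := quotient_mod Jst) k0M).
have E : quotient_proj Jst = 0.
  rewrite -(uU 0); last by move=> i; exact: mhom_ext.
  rewrite -(uU (quotient_proj Jst)) // => i; apply: mhom_ext => a e.
  by apply/quotient_proj_eq0/mk_subgroupP; exists i, e.
move=> a x; suff /mk_subgroupP : x \in J a by [].
by apply/(quotient_proj_eq0 Jst); rewrite E.
Qed.

Definition germ_mod : lmod A.
Proof.
exists (fun a => germ_group dirI (fun i => (D i : lmod A) a))
       (fun a b f => germs_map dirI (fun i => lm_map (D i : lmod A) f)).
- move=> a; apply: addhom_ext => q; have [x <-] := proj_surj q.
  rewrite germs_mapE; congr (proj _ _).
  by apply: functional_extensionality_dep => i /=; rewrite lm_map1.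
- move=> a b c g f; apply: addhom_ext => q; have [x <-] := proj_surj q.
  rewrite germs_mapE -[RHS]/(germs_map dirI _ (germs_map dirI _ _)) !germs_mapE.
  congr (proj _ _).
  by apply: functional_extensionality_dep => i /=; rewrite lm_mapM.
- move=> a b f g; apply: addhom_ext => q; have [x <-] := proj_surj q.
  rewrite germs_mapE -[RHS]/(germs_map dirI _ _ + germs_map dirI _ _) !germs_mapE.
  rewrite -[RHS](raddfD (proj _)); congr (proj _ _).
  by apply: functional_extensionality_dep => i /=; rewrite lm_mapD.
Defined.

Definition germ_fun i a : addhom ((D i : lmod A) a) (germ_mod a) :=
  germ dirI (fun i j ij => dg_hom ij a) i.

Fact germ_nat i a b (f : Hom a b) x :
  germ_fun i b (lm_map (D i : lmod A) f x) = lm_map germ_mod f (germ_fun i a x).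
Proof.
rewrite -[RHS]/(germs_map dirI _ (proj _ _)) germs_mapE.
congr (proj _ _); apply: functional_extensionality_dep => j /=.
by rewrite /restart; case: pselect => ij; rewrite ?mh_nat ?raddf0.
Qed.

Definition germ_hom i : mhom (D i) germ_mod := MHom (@germ_nat i).

(** For the second half, the map from [X] to the module of germs given by the
    universal property sends the image of [e] to the germ of [e]; the germ is
    0 only if some transition map kills [e]. *)
Lemma colimit_elementwise (c : cocone D X) : is_colimit c -> elementwise c.
Proof.
move=> cc; split; first exact: colimit_surj.
have gM i j (ij : (i <= j)%O) :
    mhom_comp (germ_hom j) (dg_hom ij) = germ_hom i.
  apply: mhom_ext => a x; apply: (germ_map dirI) => // *; exact: dg_homM.
have [u [uE _]] := cc germ_mod (Cocone (C := Mod A) (X := germ_mod) gM).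
move=> i a e ce0; apply: (germ_eq0 (dirI := dirI) (t := fun i j ij => dg_hom ij a)).
have <- : u a (leg_hom c i a e) = germ dirI (fun i j ij => dg_hom ij a) i e.
  by rewrite -[LHS]/((compm u (leg c i) : mhom _ _) a e) uE.
by rewrite ce0 raddf0.
Qed.

(** The universal property holds objectwise by [elementwise_descent], and its
    uniqueness part makes the resulting maps natural. *)
Lemma elementwise_colimit (c : cocone D X) : elementwise c -> is_colimit c.
Proof.
move=> [cs c0] Z k.
have kM i j (ij : (i <= j)%O) a x :
    (leg k j : mhom _ _) a (dg_hom ij a x) = (leg k i : mhom _ _) a x.
  by rewrite -(leg_map k ij).
have H := fun a : A => @elementwise_descent d I dirI (fun i => (D i : lmod A) a)
  (fun i j ij => dg_hom ij a) (X a) (fun i => leg_hom c i a)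
  (fun i j ij => @leg_hom_map c i j ij a) (cs a) (fun i => c0 i a)
  (Z a) (fun i => (leg k i : mhom _ _) a) (fun i j ij => kM i j ij a).
have [u uP] : exists u : forall a, addhom (X a) ((Z : lmod A) a), _ := dep_choice H.
have uN a b (f : Hom a b) x : u b (lm_map X f x) = lm_map (Z : lmod A) f (u a x).
  have [i [e <-]] := cs a x.
  by rewrite -mh_nat (uP a).1 (uP b).1 mh_nat.
exists (MHom uN); split=> [i|v vE].
  by apply: mhom_ext => a e; exact: (uP a).1.
apply: mhom_ext => a x /=; rewrite ((uP a).2 ((v : mhom _ _) a)) // => i e.
by rewrite -vE.
Qed.

End Elementwise.
End ModuleColimits.

(** The adjunction is recorded only as a bijection of Hom-sets natural in the
    source, which is all that the universal property of a colimit sees. *)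
Section LeftAdjoint.
Variables (C D : category) (F : functor C D) (R : D -> C).
Variables (phi : forall c e, mor (F c) e -> mor c (R e)).
Variables (psi : forall c e, mor c (R e) -> mor (F c) e).
Hypothesis phiK : forall c e (f : mor (F c) e), psi (phi f) = f.
Hypothesis psiK : forall c e (g : mor c (R e)), phi (psi g) = g.
Hypothesis phi_nat : forall c c' e (f : mor (F c') e) (g : mor c c'),
  phi (compm f (fmor F g)) = compm (phi f) g.

Lemma left_adjoint_colimit d (I : porderType d) (E : diagram C I) X
    (c : cocone E X) :
  is_colimit c -> is_colimit (map_cocone F c).
Proof.
move=> cc Z k.
have kM i j (ij : (i <= j)%O) : compm (phi (leg k j)) (dg_map E ij) = phi (leg k i).
  by rewrite -phi_nat; congr (phi _); exact: (leg_map k ij).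
have psi_nat x y z (f : mor y (R z)) (g : mor x y) :
    psi (compm f g) = compm (psi f) (fmor F g).
  by rewrite -[RHS]phiK phi_nat psiK.
have [u [uE uU]] := cc _ (Cocone kM).
exists (psi u); split=> [i|v vE] /=; first by rewrite -psi_nat uE phiK.
by rewrite -[v]phiK (uU (phi v)) // => i; rewrite -phi_nat vE.
Qed.
End LeftAdjoint.

(** * Direct limits of sequences *)

Section SequenceColimits.
Variable A : preadditive.

Definition zero_group : zmodType := pprod (fun _ : 'I_0 => int : zmodType).

Lemma zero_group_eq (x y : zero_group) : x = y.
Proof. by apply: functional_extensionality_dep => -[]. Qed.

Definition zero_mod : lmod A.
Proof.
by exists (fun _ => zero_group) (fun _ _ _ => 0) => *; apply: addhom_ext => x;
  exact: zero_group_eq.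
Defined.

Lemma to_zero_mod M (f g : mhom M zero_mod) : f = g.
Proof. by apply: mhom_ext => a x; exact: zero_group_eq. Qed.

Definition evL : functor (Seq A) (Mod A) :=
  @Functor (Seq A) (Mod A) (@sqL A) (@shL A) (fun _ => erefl) (fun _ _ _ _ _ => erefl).
Definition evM : functor (Seq A) (Mod A) :=
  @Functor (Seq A) (Mod A) (@sqM A) (@shM A) (fun _ => erefl) (fun _ _ _ _ _ => erefl).
Definition evN : functor (Seq A) (Mod A) :=
  @Functor (Seq A) (Mod A) (@sqN A) (@shN A) (fun _ => erefl) (fun _ _ _ _ _ => erefl).

(** The right adjoints of the three evaluation functors send [Z] to Z -> 0 ->
    0, to Z = Z -> 0 and to Z = Z = Z. So evaluation preserves colimits, and
    colimits of sequences are computed termwise. *)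
Definition seqL (Z : lmod A) : sequence A :=
  @Sequence A Z zero_mod zero_mod 0 0.
Definition seqM (Z : lmod A) : sequence A :=
  @Sequence A Z Z zero_mod (mhom_id Z) 0.
Definition seqN (Z : lmod A) : sequence A :=
  @Sequence A Z Z Z (mhom_id Z) (mhom_id Z).

Definition to_seqL (S : sequence A) Z (f : mhom (sqL S) Z) : sqhom S (seqL Z) :=
  @SqHom A S (seqL Z) f 0 0 (to_zero_mod _ _) (to_zero_mod _ _).
Definition to_seqM (S : sequence A) Z (f : mhom (sqM S) Z) : sqhom S (seqM Z) :=
  @SqHom A S (seqM Z) (mhom_comp f (sqf S)) f 0 (esym (mhom_idl _)) (to_zero_mod _ _).
Definition to_seqN (S : sequence A) Z (f : mhom (sqN S) Z) : sqhom S (seqN Z) :=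
  @SqHom A S (seqN Z) (mhom_comp (mhom_comp f (sqg S)) (sqf S)) (mhom_comp f (sqg S)) f
    (esym (mhom_idl _)) (esym (mhom_idl _)).

Section Components.
Variables (d : Order.disp_t) (I : porderType d).
Variables (D : diagram (Seq A) I) (S : sequence A) (c : cocone D S).

Lemma seq_colimit_L : is_colimit c -> is_colimit (map_cocone evL c).
Proof.
apply: (@left_adjoint_colimit (Seq A) (Mod A) evL seqL to_seqL
          (fun S Z (u : sqhom S (seqL Z)) => shL u)) => //.
- move=> T Z u; apply: sqhom_ext => //; exact: to_zero_mod.
- move=> T T' Z f g; apply: sqhom_ext => //; exact: to_zero_mod.
Qed.

Lemma seq_colimit_M : is_colimit c -> is_colimit (map_cocone evM c).
Proof.
apply: (@left_adjoint_colimit (Seq A) (Mod A) evM seqM to_seqM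
          (fun S Z (u : sqhom S (seqM Z)) => shM u)) => //.
- move=> T Z u; apply: sqhom_ext => //; last exact: to_zero_mod.
  exact: etrans (sh_f u) (mhom_idl _).
- move=> T T' Z f g; apply: sqhom_ext => //; last exact: to_zero_mod.
  by apply: mhom_ext => a x; exact (congr1 (fun y => (f : mhom _ _) a y) (mhom_app (sh_f g) x)).
Qed.

Lemma seq_colimit_N : is_colimit c -> is_colimit (map_cocone evN c).
Proof.
apply: (@left_adjoint_colimit (Seq A) (Mod A) evN seqN to_seqN
          (fun S Z (u : sqhom S (seqN Z)) => shN u)) => //.
- move=> T Z u; apply: sqhom_ext => //=.
    by rewrite [mhom_comp (shN u) _](sh_g u) mhom_idl [LHS](sh_f u) mhom_idl.
  by rewrite [LHS](sh_g u) mhom_idl.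
- move=> T T' Z f g; apply: sqhom_ext => //; apply: mhom_ext => a x.
    refine (etrans (congr1 (fun y => (f : mhom _ _) a y) (mhom_app (sh_g g) (sqf T a x))) _).
    exact (congr1 (fun y => (f : mhom _ _) a (sqg T' a y)) (mhom_app (sh_f g) x)).
  exact (congr1 (fun y => (f : mhom _ _) a y) (mhom_app (sh_g g) x)).
Qed.

(** The three limit maps commute with the maps of the sequences because maps
    out of a colimit are determined on the stages. *)
Lemma seq_colimit_components :
  is_colimit (map_cocone evL c) -> is_colimit (map_cocone evM c) ->
  is_colimit (map_cocone evN c) -> is_colimit c.
Proof.
move=> cL cM cN Z k.
have [l [lE lU]] := cL _ (map_cocone evL k).
have [m [mE mU]] := cM _ (map_cocone evM k).
have [n [nE nU]] := cN _ (map_cocone evN k).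
have lf : mhom_comp m (sqf S) = mhom_comp (sqf Z) l.
  have fM i j (ij : (i <= j)%O) :
      mhom_comp (mhom_comp (sqf Z) (shL (leg k j))) (shL (dg_map D ij))
      = mhom_comp (sqf Z) (shL (leg k i)).
    by rewrite -(leg_map k ij) -mhom_compA.
  have [u [_ uU]] := cL _ (Cocone (C := Mod A) (D := map_diagram evL D) fM).
  rewrite -(uU (mhom_comp m (sqf S))); last first.
    move=> i; rewrite -[LHS]mhom_compA -(sh_f (leg c i)) mhom_compA.
    by rewrite [mhom_comp m _](mE i) (sh_f (leg k i)).
  by apply: uU => i; rewrite -[LHS]mhom_compA; congr mhom_comp; exact: lE.
have mg : mhom_comp n (sqg S) = mhom_comp (sqg Z) m.
  have gM i j (ij : (i <= j)%O) :
      mhom_comp (mhom_comp (sqg Z) (shM (leg k j))) (shM (dg_map D ij))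
      = mhom_comp (sqg Z) (shM (leg k i)).
    by rewrite -(leg_map k ij) -mhom_compA.
  have [u [_ uU]] := cM _ (Cocone (C := Mod A) (D := map_diagram evM D) gM).
  rewrite -(uU (mhom_comp n (sqg S))); last first.
    move=> i; rewrite -[LHS]mhom_compA -(sh_g (leg c i)) mhom_compA.
    by rewrite [mhom_comp n _](nE i) (sh_g (leg k i)).
  by apply: uU => i; rewrite -[LHS]mhom_compA; congr mhom_comp; exact: mE.
exists (SqHom lf mg); split=> [i|v vE].
  by apply: sqhom_ext; [exact: lE|exact: mE|exact: nE].
apply: sqhom_ext; [apply: lU|apply: mU|apply: nU] => i /=.
- by rewrite -vE.
- by rewrite -vE.
- by rewrite -vE.
Qed.

End Components.
End SequenceColimits.

(** * Finite linear systems and finitely presented modules *)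

Section LinearSystems.
Variable A : preadditive.

Section System.
Variables (n : nat) (a : 'I_n -> A) (l : nat) (c : 'I_l -> A).
Variable r : forall k i, Hom (a i) (c k).

Definition system_map_fun (M : lmod A) (x : pp_tuples a M) : pp_tuples c M :=
  fun k => \sum_i lm_map M (r k i) (x i).

Fact system_map_zmod M : zmod_morphism (@system_map_fun M).
Proof.
move=> x y; apply: functional_extensionality_dep => k.
rewrite -[RHS]/(system_map_fun x k - system_map_fun y k) /system_map_fun -sumrB.
by apply: eq_bigr => i _; exact: raddfB.
Qed.

Definition system_map M : addhom (pp_tuples a M) (pp_tuples c M) :=
  mk_addhom (@system_map_zmod M).

Lemma system_map_nat M N (h : mhom M N) (x : pp_tuples a M) :
  system_map N (pp_map_fun h x) = pp_map_fun h (system_map M x).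
Proof.
apply: functional_extensionality_dep => k; rewrite /= /system_map_fun /pp_map_fun.
by rewrite raddf_sum; apply: eq_bigr => i _; rewrite mh_nat.
Qed.

End System.

Section Delta.
Variables (T : eqType) (a : T -> A).

(** The diagonal and the other entries live in different Hom groups, hence the
    transport along [i = j]. *)
Definition delta (i j : T) : Hom (a j) (a i) :=
  if pselect (i = j) is left e then eq_rect i (fun j => Hom (a j) (a i)) (one (a i)) j e
  else 0.

Lemma delta_diag i : delta i i = one (a i).
Proof.
rewrite /delta; case: pselect => // e.
by rewrite (Prop_irrelevance e (erefl i)).
Qed.

Lemma delta_neq i j : i != j -> delta i j = 0.
Proof. by rewrite /delta; case: pselect => // e /eqP. Qed.

End Delta.

Section DeltaSums.
Variables (n : nat) (a : 'I_n -> A).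

Lemma sum_delta_l i (T : zmodType) (phi : forall j, Hom (a j) (a i) -> T) :
  (forall j, phi j 0 = 0) -> \sum_j phi j (delta a i j) = phi i (one (a i)).
Proof.
move=> phi0; rewrite (bigD1 i) //= delta_diag big1 ?addr0 // => j ji.
by rewrite delta_neq // eq_sym.
Qed.

Lemma sum_delta_r i (T : zmodType) (phi : forall j, Hom (a i) (a j) -> T) :
  (forall j, phi j 0 = 0) -> \sum_j phi j (delta a j i) = phi i (one (a i)).
Proof.
move=> phi0; rewrite (bigD1 i) //= delta_diag big1 ?addr0 // => j ji.
by rewrite delta_neq.
Qed.

End DeltaSums.

Lemma circ0r (a b c : A) (g : Hom b c) : circ g (0 : Hom a b) = 0.
Proof. by apply: (addrI (circ g 0)); rewrite -circDr !addr0. Qed.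
Lemma circ0l (a b c : A) (f : Hom a b) : circ (0 : Hom b c) f = 0.
Proof. by apply: (addrI (circ 0 f)); rewrite -circDl !addr0. Qed.

Fact circ_l_zmod (a b c : A) (g : Hom b c) : zmod_morphism (fun f : Hom a b => circ g f).
Proof.
move=> x y; apply/eqP; rewrite eq_sym subr_eq; apply/eqP.
by rewrite -circDr subrK.
Qed.
Definition circ_l a b c (g : Hom b c) : addhom (Hom a b) (Hom a c) :=
  mk_addhom (@circ_l_zmod a b c g).

Fact circ_r_zmod (a b c : A) (f : Hom a b) : zmod_morphism (fun g : Hom b c => circ g f).
Proof.
move=> x y; apply/eqP; rewrite eq_sym subr_eq; apply/eqP.
by rewrite -circDl subrK.
Qed.
Definition circ_r a b c (f : Hom a b) : addhom (Hom b c) (Hom a c) :=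
  mk_addhom (@circ_r_zmod a b c f).

Fact lm_act_zmod (M : lmod A) a b (x : M a) : zmod_morphism (fun f : Hom a b => lm_map M f x).
Proof.
move=> f g; apply/eqP; rewrite eq_sym subr_eq; apply/eqP.
by rewrite -[RHS]/((lm_map M (f - g) + lm_map M g) x) -lm_mapD subrK.
Qed.
Definition lm_act (M : lmod A) a b (x : M a) : addhom (Hom a b) (M b) :=
  mk_addhom (@lm_act_zmod M a b x).

Section Presented.
Variables (n : nat) (a : 'I_n -> A) (l : nat) (c : 'I_l -> A).
Variable r : forall k i, Hom (a i) (c k).

Fact free_map_zmod b b' (f : Hom b b') :
  zmod_morphism ((fun v i => circ f (v i)) :
    pprod (fun i => Hom (a i) b) -> pprod (fun i => Hom (a i) b')).
Proof.
move=> v w; apply: functional_extensionality_dep => i.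
exact: (raddfB (@circ_l (a i) b b' f)).
Qed.

Definition free_map b b' (f : Hom b b') := mk_addhom (@free_map_zmod b b' f).

Definition free_mod : lmod A.
Proof.
exists (fun b => pprod (fun i => Hom (a i) b) : zmodType) free_map.
- move=> b; apply: addhom_ext => v; apply: functional_extensionality_dep => i.
  exact: circ_onel.
- move=> b b' b'' g f; apply: addhom_ext => v.
  apply: functional_extensionality_dep => i; exact/esym/circA.
- move=> b b' f g; apply: addhom_ext => v.
  apply: functional_extensionality_dep => i; exact: circDl.
Defined.

Definition row_span b (v : free_mod b) : Prop :=
  exists w : pprod (fun k => Hom (c k) b),
    forall i, v i = \sum_k circ (w k) (r k i).

Fact row_span0 b : @row_span b 0.
Proof. by exists 0 => i; rewrite big1 // => k _; exact: circ0l. Qed.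

Fact row_spanB b (v v' : free_mod b) : row_span v -> row_span v' -> row_span (v - v').
Proof.
move=> [w wE] [w' w'E]; exists (w - w') => i.
rewrite -[LHS]/(v i - v' i) wE w'E -sumrB.
by apply: eq_bigr => k _; exact/esym/(raddfB (circ_r _ _)).
Qed.

Definition relations b : zmodClosed (free_mod b) := mk_subgroup (@row_span0 b) (@row_spanB b).

Fact relations_stable b b' (f : Hom b b') v :
  v \in relations b -> lm_map free_mod f v \in relations b'.
Proof.
move=> /mk_subgroupP[w wE]; apply/mk_subgroupP; exists (fun k => circ f (w k)) => i.
rewrite -[LHS]/(circ f (v i)) wE -[LHS]/(circ_l _ f _) raddf_sum.
by apply: eq_bigr => k _; exact: circA.
Qed.

(** Maps from this module to [M] are the solutions in [M] of the system [r]: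
    see [presented_solves], [presented_descE] and [presented_ext]. *)
Definition presented : lmod A := quotient_mod relations_stable.

Definition generator (i : 'I_n) : presented (a i) :=
  quotient_proj relations_stable (a i) (delta a i : free_mod (a i)).

Lemma presented_span b (v : free_mod b) :
  quotient_proj relations_stable b v = \sum_i lm_map presented (v i) (generator i).
Proof.
transitivity (\sum_i quotient_proj relations_stable b (lm_map free_mod (v i) (delta a i))).
  rewrite -raddf_sum; congr (quotient_proj _ _ _).
  apply: functional_extensionality_dep => j.
  pose ev : addhom (free_mod b) (Hom (a j) b) :=
    @mk_addhom _ _ (fun v : free_mod b => v j) (fun _ _ => erefl).
  rewrite -[RHS]/(ev _) raddf_sum /=.
  rewrite (sum_delta_r (phi := fun i d => circ (v i) d)) ?circ_oner //.
  by move=> i; exact: circ0r.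
by apply: eq_bigr => i _; rewrite mh_nat.
Qed.

Lemma presented_ext (M : lmod A) (h h' : mhom presented M) :
  (forall i, h _ (generator i) = h' _ (generator i)) -> h = h'.
Proof.
move=> E; apply: mhom_ext => b q; have [v <-] := quotient_proj_surj q.
by rewrite presented_span !raddf_sum; apply: eq_bigr => i _; rewrite !mh_nat E.
Qed.

Lemma generator_solves : system_map r presented generator = 0.
Proof.
apply: functional_extensionality_dep => k /=.
rewrite /system_map_fun -(presented_span (r k : free_mod (c k))).
rewrite [RHS](_ : _ = 0) //.
apply/(quotient_proj_eq0 relations_stable)/mk_subgroupP; exists (delta c k) => i.
rewrite (sum_delta_l (phi := fun j d => circ d (r j i))) ?circ_onel //.
by move=> j; exact: circ0l.
Qed.

Section Descent.
Variables (M : lmod A) (x : pp_tuples a M).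
Hypothesis x_solves : system_map r M x = 0.

Fact free_desc_zmod b :
  zmod_morphism (fun v : free_mod b => \sum_i lm_map M (v i) (x i)).
Proof.
move=> v w; rewrite -sumrB; apply: eq_bigr => i _.
exact: (raddfB (lm_act _ (x i)) (v i) (w i)).
Qed.

Fact free_desc_nat b b' (f : Hom b b') (v : free_mod b) :
  mk_addhom (@free_desc_zmod b') (lm_map free_mod f v) =
  lm_map M f (mk_addhom (@free_desc_zmod b) v).
Proof.
rewrite /= raddf_sum; apply: eq_bigr => i _.
by rewrite lm_mapM.
Qed.

Definition free_desc : mhom free_mod M := MHom free_desc_nat.

Fact free_desc0 b (v : free_mod b) : v \in relations b -> free_desc b v = 0.
Proof.
move=> /mk_subgroupP[w wE] /=.
transitivity (\sum_i \sum_k lm_map M (w k) (lm_map M (r k i) (x i))).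
  apply: eq_bigr => i _; rewrite wE -[LHS]/(lm_act _ (x i) _) raddf_sum.
  by apply: eq_bigr => k _; rewrite /= lm_mapM.
rewrite exchange_big big1 // => k _.
rewrite -raddf_sum -[X in lm_map M _ X]/(system_map r M x k) x_solves.
exact: raddf0.
Qed.

Definition presented_desc : mhom presented M := quotient_desc relations_stable free_desc0.

Lemma presented_descE i : presented_desc _ (generator i) = x i.
Proof.
rewrite [LHS](quotient_descE relations_stable free_desc0) /=.
rewrite (sum_delta_l (phi := fun j d => lm_map M d (x j))) ?lm_map1 //.
by move=> j; exact: raddf0 (lm_act _ (x j)).
Qed.

End Descent.

Lemma presented_solves (M : lmod A) (h : mhom presented M) :
  system_map r M (fun i => h _ (generator i)) = 0.
Proof.
rewrite -[X in system_map r M X]/(pp_map_fun h generator) system_map_nat generator_solves.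
by apply: functional_extensionality_dep => k; exact: raddf0.
Qed.

End Presented.
End LinearSystems.

(** * Purity as lifting of solutions of linear systems *)

Lemma directed_common (d : Order.disp_t) (I : porderType d) (n : nat)
    (P : 'I_n -> I -> Prop) : directed I ->
  (forall k i j, (i <= j)%O -> P k i -> P k j) -> (forall k, exists i, P k i) ->
  exists i, forall k, P k i.
Proof.
move=> [[i0] dirI] mono /choice[i iP].
have [j jP] : exists j, forall k, k \in enum 'I_n -> (i k <= j)%O.
  elim: (enum 'I_n) => [|k s [j IH]]; first by exists i0.
  have [m [jm km]] := dirI j (i k); exists m => k'.
  rewrite inE => /orP[/eqP-> //|/IH ij].
  exact: Order.POrderTheory.le_trans jm.
by exists j => k; apply: mono (iP k); apply: jP; rewrite mem_enum.
Qed.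

(** Same argument as for modules: the projection onto the quotient by the
    union of the images agrees with 0 on every stage. *)
Lemma Ab_colimit_surj (d : Order.disp_t) (I : porderType d) (dirI : directed I)
    (D : diagram Ab I) (X : zmodType) (c : cocone D X) : is_colimit c ->
  forall x : X, exists i (e : (D i : zmodType)), (leg c i : addhom _ _) e = x.
Proof.
move=> cc.
pose P (x : X) := exists i (e : (D i : zmodType)), (leg c i : addhom _ _) e = x.
have P0 : P 0 by case: dirI => [[i] _]; exists i, 0; rewrite raddf0.
have PB x y : P x -> P y -> P (x - y).
  move=> [i [e <-]] [j [e' <-]]; have [k [ik jk]] := dirI.2 i j.
  exists k, ((dg_map D ik : addhom _ _) e - (dg_map D jk : addhom _ _) e').
  by rewrite raddfB -(leg_map c ik) -(leg_map c jk).
pose Q : zmodType := Quotient.quot (mk_subgroup P0 PB).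
have k0M i j (ij : (i <= j)%O) :
    addhom_comp (0 : addhom (D j) Q) (dg_map D ij : addhom _ _) = 0.
  exact: addhom_ext.
have [u [_ uU]] := cc Q (Cocone (C := Ab) (X := Q) k0M).
have E : proj (mk_subgroup P0 PB) = 0.
  rewrite -(uU 0); last by move=> i; exact: addhom_ext.
  rewrite -(uU (proj (mk_subgroup P0 PB))) // => i; apply: addhom_ext => e.
  by apply/proj_eq0/mk_subgroupP; exists i, e.
move=> x; apply/(mk_subgroupP P0 PB)/proj_eq0; by rewrite E.
Qed.

Section Purity.
Variable A : preadditive.

Section PresentedFP.
Variables (n : nat) (a : 'I_n -> A) (l : nat) (c : 'I_l -> A).
Variable r : forall k i, Hom (a i) (c k).

(** A map from [presented r] to a direct limit is a solution of a finite
    system. Finitely many coordinates come from a common stage, and finitely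
    many equations hold at a later one; in the same way, a solution that
    becomes 0 in the limit does so at some stage. *)
Lemma presented_fp : finitely_presented (presented r).
Proof.
move=> d I dirI D X cc /colimit_elementwise-/(_ dirI)[cs c0].
apply: Ab_elementwise_colimit => //; split=> [u|i u E].
- pose x i := (u : mhom _ _) (a i) (generator r i).
  have [i iP] : exists i, forall k, exists e, leg_hom cc i (a k) e = x k.
    apply: (directed_common dirI) => k; last exact: cs.
    by move=> i j ij [e eE]; exists (dg_hom D ij _ e); rewrite leg_hom_map.
  have [e eE] := dep_choice iP.
  have /= xe : pp_map_fun (leg_hom cc i) e = x.
    by apply: functional_extensionality_dep => k; exact: eE.
  have [j jP] : exists j, forall k, exists ij : (i <= j)%O,
      dg_hom D ij (c k) (system_map r _ e k) = 0.
    apply: (directed_common dirI) => k.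
      move=> j m jm [ij E]; have im := Order.POrderTheory.le_trans ij jm.
      by exists im; rewrite -(dg_homM ij jm im) E raddf0.
    apply: c0; have := system_map_nat r (leg_hom cc i) e.
    move=> /(congr1 (fun f => f k)); rewrite xe /pp_map_fun => <-.
    by have -> := presented_solves (u : mhom (presented r) X).
  have [m [im jm]] := dirI.2 i j.
  have e'S : system_map r (D m) (pp_map_fun (dg_hom D im) e) = 0.
    apply: functional_extensionality_dep => k; rewrite system_map_nat /pp_map_fun.
    by have [ij E] := jP k; rewrite -(dg_homM ij jm im) E raddf0.
  exists m, (presented_desc e'S : mhom _ _).
  apply: (@presented_ext A n a l c r X) => k.
  rewrite -[LHS]/(leg_hom cc m (a k) (presented_desc e'S _ (generator r k))).
  by rewrite presented_descE /pp_map_fun leg_hom_map eE.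
- have [j jP] : exists j, forall k, exists ij : (i <= j)%O,
      dg_hom D ij (a k) ((u : mhom _ _) _ (generator r k)) = 0.
    apply: (directed_common dirI) => k.
      move=> j m jm [ij E']; have im := Order.POrderTheory.le_trans ij jm.
      by exists im; rewrite -(dg_homM ij jm im) E' raddf0.
    by apply: c0; exact: mhom_app E _ (generator r k).
  have [m [im jm]] := dirI.2 i j.
  exists m, im; apply: (@presented_ext A n a l c r (D m)) => k /=.
  have [ij Eij] := jP k.
  by rewrite -[LHS]/(dg_hom D im _ _) -(dg_homM ij jm im) Eij raddf0.
Qed.

End PresentedFP.

(** With short exactness, this is the elementary form of purity, through which
    all the conditions are compared. *)
Definition solution_lifting (S : sequence A) : Prop :=
  forall n (a : 'I_n -> A) l (c : 'I_l -> A) (r : forall k i, Hom (a i) (c k))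
    (x : pp_tuples a (sqN S)), system_map r (sqN S) x = 0 ->
  exists y : pp_tuples a (sqM S),
    system_map r (sqM S) y = 0 /\ forall i, sqg S (a i) (y i) = x i.

Definition system_pure (S : sequence A) : Prop :=
  short_exact S /\ solution_lifting S.

#[local] Arguments presented_desc : simpl never.

Section FreeOnOne.
Variable b : A.
Let c : 'I_0 -> A := fun _ => b.
Let r : forall (k : 'I_0) (i : 'I_1), Hom b (c k) := fun _ _ => 0.

(** The functor Hom(b, -), as the module presented by one generator and no
    relation, so that it is covered by [presented_fp]. *)
Definition representable : lmod A := presented (a := fun _ => b) r.

Definition unit_elt : representable b := generator (a := fun _ => b) r ord0.

Lemma representable_fp : finitely_presented representable.
Proof. exact: presented_fp. Qed.

Lemma no_relation M (x : pp_tuples (fun _ : 'I_1 => b) M) : system_map r M x = 0.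
Proof. by apply: functional_extensionality_dep => -[]. Qed.

Definition yoneda (M : lmod A) (x : M b) : mhom representable M :=
  presented_desc (no_relation (fun _ : 'I_1 => x)).

#[local] Arguments yoneda : simpl never.

Lemma yonedaE (M : lmod A) (x : M b) : yoneda x b unit_elt = x.
Proof. exact: presented_descE. Qed.

Lemma yoneda_ext (M : lmod A) (h h' : mhom representable M) :
  h b unit_elt = h' b unit_elt -> h = h'.
Proof.
move=> E; apply: (@presented_ext A 1 (fun _ => b) 0 c r) => i.
by rewrite (ord1 i).
Qed.

End FreeOnOne.

#[local] Arguments yoneda : simpl never.

Lemma hom_actE (X M N : lmod A) (f : mhom M N) (u : mhom X M) a x :
  hom_act X f u a x = f a (u a x).
Proof. by []. Qed.

(** Hom(representable b, M) is M b, so purity tested on representables is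
    short exactness at [b]. *)
Lemma pure_exact_short (S : sequence A) : pure_exact S -> short_exact S.
Proof.
move=> Sp b; have [fi fg gs] := Sp _ (@representable_fp b).
have gf0 (x : sqL S b) : sqg S b (sqf S b x) = 0.
  have /fg/mhom_app/(_ b (unit_elt b)) : exists u, hom_act _ (sqf S) u =
      hom_act (representable b) (sqf S) (yoneda x) by exists (yoneda x).
  by rewrite !hom_actE yonedaE.
split.
- apply: injective_ker0 => x fx.
  have /(injective_eq0 fi)/mhom_app/(_ b (unit_elt b)) :
    hom_act (representable b) (sqf S) (yoneda x) = 0.
    by apply: yoneda_ext; rewrite !hom_actE yonedaE.
  by rewrite yonedaE.
- move=> y; split=> [gy|[x <-]]; last exact: gf0.
  have /fg[u uE] : hom_act (representable b) (sqg S) (yoneda y) = 0.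
    by apply: yoneda_ext; rewrite !hom_actE yonedaE.
  exists (u b (unit_elt b)).
  by have /mhom_app/(_ b (unit_elt b)) := uE; rewrite !hom_actE yonedaE.
- move=> z; have [v vE] := gs (yoneda z).
  exists (v b (unit_elt b)).
  by have /mhom_app/(_ b (unit_elt b)) := vE; rewrite !hom_actE yonedaE.
Qed.

Lemma pure_exact_system_pure (S : sequence A) : pure_exact S -> system_pure S.
Proof.
move=> Sp; split; first exact: pure_exact_short.
move=> n a l c r x xS.
have [_ _ gs] := Sp _ (@presented_fp _ _ _ _ r).
have [v vE] := gs (presented_desc xS).
exists (fun i => v _ (generator r i)); split; first exact: presented_solves.
move=> i; have /mhom_app/(_ _ (generator r i)) := vE.
by rewrite hom_actE presented_descE.
Qed.

Section LimitsOfSplit.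
Variables (d : Order.disp_t) (I : porderType d) (dirI : directed I).
Variables (D : diagram (Seq A) I) (S : sequence A) (c : cocone D S).
Hypothesis D_split : forall i, split_exact (D i).
Hypothesis cc : is_colimit c.

Let Dq i : sequence A := D i.
Let tr i j (ij : (i <= j)%O) : sqhom (Dq i) (Dq j) := dg_map D ij.
Let lg i : sqhom (Dq i) S := leg c i.

Let eL := colimit_elementwise dirI (seq_colimit_L cc).
Let eM := colimit_elementwise dirI (seq_colimit_M cc).
Let eN := colimit_elementwise dirI (seq_colimit_N cc).

Lemma stage_L b (x : sqL S b) : exists i e, shL (lg i) b e = x.
Proof. exact: eL.1. Qed.
Lemma stage_M b (x : sqM S b) : exists i e, shM (lg i) b e = x.
Proof. exact: eM.1. Qed.
Lemma stage_N b (x : sqN S b) : exists i e, shN (lg i) b e = x.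
Proof. exact: eN.1. Qed.
Lemma null_M i b (e : sqM (Dq i) b) : shM (lg i) b e = 0 ->
  exists j (ij : (i <= j)%O), shM (tr ij) b e = 0.
Proof. exact: eM.2. Qed.
Lemma null_N i b (e : sqN (Dq i) b) : shN (lg i) b e = 0 ->
  exists j (ij : (i <= j)%O), shN (tr ij) b e = 0.
Proof. exact: eN.2. Qed.
Lemma lg_L i j (ij : (i <= j)%O) b e : shL (lg j) b (shL (tr ij) b e) = shL (lg i) b e.
Proof. by rewrite /lg -(leg_map c ij). Qed.
Lemma lg_M i j (ij : (i <= j)%O) b e : shM (lg j) b (shM (tr ij) b e) = shM (lg i) b e.
Proof. by rewrite /lg -(leg_map c ij). Qed.
Lemma lg_N i j (ij : (i <= j)%O) b e : shN (lg j) b (shN (tr ij) b e) = shN (lg i) b e.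
Proof. by rewrite /lg -(leg_map c ij). Qed.
Lemma tr_N i j k (ij : (i <= j)%O) (jk : (j <= k)%O) (ik : (i <= k)%O) b e :
  shN (tr jk) b (shN (tr ij) b e) = shN (tr ik) b e.
Proof. by rewrite /tr -(dg_comp D ij jk ik). Qed.
Lemma sqhom_f (T U : sequence A) (h : sqhom T U) b e :
  shM h b (sqf T b e) = sqf U b (shL h b e).
Proof. exact (mhom_app (sh_f h) e). Qed.
Lemma sqhom_g (T U : sequence A) (h : sqhom T U) b e :
  shN h b (sqg T b e) = sqg U b (shM h b e).
Proof. exact (mhom_app (sh_g h) e). Qed.

(** Exactness passes to the limit: an element that vanishes in the limit
    vanishes at some stage, where the sequence is exact. *)
Lemma limit_of_split_short : short_exact S.
Proof.
move=> b; split.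
- apply: injective_ker0 => x; have [i [e <-]] := stage_L x.
  rewrite -sqhom_f => /null_M[j [ij]]; rewrite sqhom_f.
  have [/(_ b)[fi _ _] _] := D_split j.
  by move=> /(injective_eq0 fi); rewrite -(lg_L ij) => ->; rewrite raddf0.
- move=> y; split=> [|[x <-]].
    have [i [e <-]] := stage_M y; rewrite -sqhom_g => /null_N[j [ij]].
    have [/(_ b)[_ fg _] _] := D_split j.
    rewrite sqhom_g => /fg[u uE].
    by exists (shL (lg j) b u); rewrite -sqhom_f uE lg_M.
  have [i [e <-]] := stage_L x.
  rewrite -sqhom_f -sqhom_g.
  have [/(_ b)[_ fg _] _] := D_split i.
  by have /fg-> : exists u, sqf (Dq i) b u = sqf (Dq i) b e; [exists e | rewrite raddf0].
- move=> z; have [i [e <-]] := stage_N z.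
  have [/(_ b)[_ _ gs] _] := D_split i.
  by have [u <-] := gs e; exists (shM (lg i) b u); rewrite -sqhom_g.
Qed.

(** A solution in [sqN S] is the image of a solution at some stage; lift it
    there by the section, and map the result to [sqM S]. *)
Lemma limit_of_split_lifting : solution_lifting S.
Proof.
move=> n a l s r x xS.
have [i iP] : exists i, forall k, exists e, shN (lg i) (a k) e = x k.
  apply: (directed_common dirI) => k; last exact: stage_N.
  by move=> i j ij [e eE]; exists (shN (tr ij) _ e); rewrite lg_N.
have [e eE] := dep_choice iP.
have xe : pp_map_fun (shN (lg i)) e = x.
  by apply: functional_extensionality_dep => k; exact: eE.
have [j jP] : exists j, forall k, exists ij : (i <= j)%O,
    shN (tr ij) (s k) (system_map r _ e k) = 0.
  apply: (directed_common dirI) => k.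
    move=> j m jm [ij E]; have im := Order.POrderTheory.le_trans ij jm.
    by exists im; rewrite -(tr_N ij jm im) E raddf0.
  apply: null_N; have := system_map_nat r (shN (lg i)) e.
  by move=> /(congr1 (fun f => f k)); rewrite xe xS.
have [m [im jm]] := dirI.2 i j.
have e'S : system_map r _ (pp_map_fun (shN (tr im)) e) = 0.
  apply: functional_extensionality_dep => k; rewrite system_map_nat /pp_map_fun.
  by have [ij E] := jP k; rewrite -(tr_N ij jm im) E raddf0.
have [_ [sec secE]] := D_split m.
pose y := pp_map_fun (shM (lg m)) (pp_map_fun sec (pp_map_fun (shN (tr im)) e)).
exists y; split=> [|k].
  rewrite /y system_map_nat system_map_nat e'S; apply: functional_extensionality_dep => k.
  by rewrite /pp_map_fun /= !raddf0.
rewrite /y /pp_map_fun -sqhom_g.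
by rewrite [sqg _ _ (sec _ _)](mhom_app secE) lg_N eE.
Qed.

End LimitsOfSplit.

Lemma limit_of_split_system_pure (S : sequence A) :
  is_direct_limit_of (C := Seq A) (@split_exact A) S -> system_pure S.
Proof.
move=> [d [I [D [c [dirI Ds cc]]]]]; split.
  exact (limit_of_split_short dirI Ds cc).
exact (limit_of_split_lifting dirI Ds cc).
Qed.

End Purity.

(** * Free modules and submodules spanned by finitely many elements *)

Section FiniteSupportSums.
Variables (T : choiceType) (Z : zmodType).

Definition supported_in (G : T -> zmodType) (F : forall t, G t) (s : seq T) :=
  forall t, t \notin s -> F t = 0.

Definition fsum (F : T -> Z) : Z :=
  if pselect (exists s, @supported_in (fun _ => Z) F s) is left e
  then \sum_(t <- undup (projT1 (cid e))) F t else 0.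

Lemma fsum_widen (F : T -> Z) s s' : uniq s -> uniq s' -> {subset s <= s'} ->
  supported_in F s -> \sum_(t <- s) F t = \sum_(t <- s') F t.
Proof.
move=> us us' ss' Fs; rewrite [RHS](bigID (mem s)) /= [X in _ + X]big1.
  rewrite addr0 -[RHS]big_filter; apply: perm_big; apply: uniq_perm => //.
    exact: filter_uniq.
  by move=> t; rewrite mem_filter /=; case: (boolP (t \in s)) => // /ss' ->.
by move=> t /Fs.
Qed.

Lemma fsumE (F : T -> Z) s : uniq s -> supported_in F s ->
  fsum F = \sum_(t <- s) F t.
Proof.
move=> us Fs; rewrite /fsum; case: pselect => [e|[]]; last by exists s.
case: (cid e) => /= s' Fs'.
rewrite (@fsum_widen F s (undup (s ++ s'))) ?undup_uniq //; last first.
  by move=> t ts; rewrite mem_undup mem_cat ts.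
apply: fsum_widen; rewrite ?undup_uniq //.
  by move=> t; rewrite !mem_undup mem_cat orbC => ->.
by move=> t; rewrite mem_undup; exact: Fs'.
Qed.

End FiniteSupportSums.

Section FreeModule.
Variables (A : preadditive) (T : choiceType) (a : T -> A).

Definition finite_support b (v : dep_prod (fun t => Hom (a t) b)) : Prop :=
  exists s : seq T, supported_in v s.

Fact finite_support0 b : @finite_support b 0.
Proof. by exists [::]. Qed.

Fact finite_supportB b v w :
  @finite_support b v -> @finite_support b w -> @finite_support b (v - w).
Proof.
move=> [s vs] [s' ws']; exists (s ++ s') => t; rewrite mem_cat negb_or.
by move=> /andP[ts ts']; rewrite -[LHS]/(v t - w t) vs // ws' // subr0.
Qed.

Definition sum_pred b : zmodClosed (dep_prod (fun t => Hom (a t) b)) :=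
  mk_subgroup (@finite_support0 b) (@finite_supportB b).

Definition sum_map_val b b' (f : Hom b b') (v : dep_prod (fun t => Hom (a t) b)) :
  dep_prod (fun t => Hom (a t) b') := fun t => circ f (v t).

Fact sum_map_subproof b b' (f : Hom b b') (v : subgroup (sum_pred b)) :
  sum_map_val f (val v) \in sum_pred b'.
Proof.
have /mk_subgroupP[s vs] := valP v; apply/mk_subgroupP; exists s => t /vs E.
by rewrite /sum_map_val E circ0r.
Qed.

Definition sum_map_fun b b' (f : Hom b b') (v : subgroup (sum_pred b)) :
  subgroup (sum_pred b') := Sub (sum_map_val f (val v)) (sum_map_subproof f v).

Fact sum_map_zmod b b' (f : Hom b b') : zmod_morphism (sum_map_fun f).
Proof.
move=> v w; apply: val_inj; rewrite [RHS]raddfB.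
apply: functional_extensionality_dep => t.
rewrite [LHS](_ : _ = circ_l _ f (val v t - val w t)); last first.
  by rewrite -[LHS]/(circ f (val (v - w) t)) raddfB.
exact: raddfB.
Qed.

(** The direct sum over [t : T] of the representables Hom(a t, -), realised as
    finitely supported families; it is the free module on generators
    [sum_basis t] of sort [a t]. *)
Definition sum_mod : lmod A.
Proof.
exists (fun b => subgroup (sum_pred b) : zmodType)
       (fun b b' f => mk_addhom (sum_map_zmod f)).
- move=> b; apply: addhom_ext => v; apply: val_inj.
  apply: functional_extensionality_dep => t; exact: circ_onel.
- move=> b b' b'' g f; apply: addhom_ext => v; apply: val_inj.
  apply: functional_extensionality_dep => t; exact/esym/circA.
- move=> b b' f g; apply: addhom_ext => v; apply: val_inj.
  apply: functional_extensionality_dep => t; exact: circDl.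
Defined.

Definition coef b (v : sum_mod b) : dep_prod (fun t => Hom (a t) b) := val v.

Lemma coefB b (v w : sum_mod b) t : coef (v - w) t = coef v t - coef w t.
Proof. by rewrite /coef [val _]raddfB. Qed.

Lemma coef_map b b' (f : Hom b b') (v : sum_mod b) t :
  coef (lm_map sum_mod f v) t = circ f (coef v t).
Proof. by []. Qed.

Lemma coef_supp b (v : sum_mod b) : exists2 s, uniq s & supported_in (coef v) s.
Proof.
have /mk_subgroupP[s vs] := valP v; exists (undup s); first exact: undup_uniq.
by move=> t; rewrite mem_undup; exact: vs.
Qed.

Lemma sum_mod_ext b (v w : sum_mod b) : (forall t, coef v t = coef w t) -> v = w.
Proof. by move=> E; apply: val_inj; apply: functional_extensionality_dep. Qed.

Definition sum_basis_val t : dep_prod (fun t' => Hom (a t') (a t)) := delta a t.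

Fact sum_basis_subproof t : sum_basis_val t \in sum_pred (a t).
Proof.
apply/mk_subgroupP; exists [:: t] => t'; rewrite inE => tt'; apply: delta_neq.
by rewrite eq_sym.
Qed.

Definition sum_basis t : sum_mod (a t) :=
  (Sub (sum_basis_val t) (sum_basis_subproof t) : subgroup (sum_pred (a t))).

Lemma sum_span b (v : sum_mod b) s : uniq s -> supported_in (coef v) s ->
  v = \sum_(t <- s) lm_map sum_mod (coef v t) (sum_basis t).
Proof.
move=> us vs; apply: sum_mod_ext => t.
have cB : zmod_morphism (fun v : sum_mod b => coef v t).
  by move=> x y; exact: coefB.
rewrite -[RHS]/(mk_addhom cB _) raddf_sum /=.
have [ts|ts] := boolP (t \in s); last first.
  rewrite vs // big_seq big1 // => t' t's; rewrite coef_map.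
  have -> : coef (sum_basis t') t = 0.
    by apply: delta_neq; apply: contraNneq ts => <-.
  exact: circ0r.
rewrite (bigD1_seq t) //= big1 ?addr0 => [|t' t't].
  by rewrite coef_map -[coef (sum_basis t) t]/(delta a t t) delta_diag circ_oner.
rewrite coef_map -[coef (sum_basis t') t]/(delta a t' t) delta_neq //.
exact: circ0r.
Qed.

Section Descent.
Variables (M : lmod A) (x : forall t, M (a t)).

Definition sum_eval b (v : sum_mod b) : M b :=
  fsum (fun t => lm_map M (coef v t) (x t)).

Lemma sum_evalE b (v : sum_mod b) s : uniq s -> supported_in (coef v) s ->
  sum_eval v = \sum_(t <- s) lm_map M (coef v t) (x t).
Proof.
move=> us vs; apply: fsumE => // t /vs ->; exact: raddf0 (lm_act _ (x t)).
Qed.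

Fact sum_eval_zmod b : zmod_morphism (@sum_eval b).
Proof.
move=> v w; have [s _ vs] := coef_supp v; have [s' _ ws] := coef_supp w.
have us := undup_uniq (s ++ s').
have ss t : t \notin undup (s ++ s') -> t \notin s /\ t \notin s'.
  by rewrite mem_undup mem_cat negb_or => /andP.
have vs' : supported_in (coef v) (undup (s ++ s')) by move=> t /ss[/vs].
have ws' : supported_in (coef w) (undup (s ++ s')) by move=> t /ss[_ /ws].
rewrite !(sum_evalE us) //; last first.
  by move=> t ts; rewrite coefB vs' // ws' // subr0.
rewrite -sumrB; apply: eq_bigr => t _; rewrite coefB.
exact: (raddfB (lm_act _ (x t))).
Qed.

Fact sum_eval_nat b b' (f : Hom b b') (v : sum_mod b) :
  mk_addhom (@sum_eval_zmod b') (lm_map sum_mod f v)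
  = lm_map M f (mk_addhom (@sum_eval_zmod b) v).
Proof.
have [s us vs] := coef_supp v; rewrite /= (sum_evalE us vs) (sum_evalE us).
  rewrite raddf_sum; apply: eq_bigr => t _.
  by rewrite coef_map lm_mapM.
by move=> t /vs E; rewrite coef_map E circ0r.
Qed.

Definition sum_desc : mhom sum_mod M := MHom sum_eval_nat.

Lemma sum_desc_basis t : sum_desc _ (sum_basis t) = x t.
Proof.
rewrite /= (@sum_evalE _ _ [:: t]) // ?big_seq1.
  by rewrite -[coef _ t]/(delta a t t) delta_diag lm_map1.
by move=> t'; rewrite inE => tt'; apply: delta_neq; rewrite eq_sym.
Qed.

End Descent.

Lemma sum_mod_hom_ext (M : lmod A) (h h' : mhom sum_mod M) :
  (forall t, h _ (sum_basis t) = h' _ (sum_basis t)) -> h = h'.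
Proof.
move=> E; apply: mhom_ext => b v; have [s us vs] := coef_supp v.
rewrite [v](sum_span us vs) !raddf_sum; apply: eq_bigr => t _.
by rewrite !mh_nat E.
Qed.

End FreeModule.

Section Elements.
Variables (A : preadditive) (M : lmod A).
Record element := Element { elt_ob : A; elt_val : M elt_ob }.
HB.instance Definition _ := gen_eqMixin element.
HB.instance Definition _ := gen_choiceMixin element.
End Elements.
Arguments Element {A M elt_ob}.

Section Span.
Variables (A : preadditive) (P : lmod A) (Q : element P -> Prop).

(** The intersection of all submodules containing [Q]: with this form a map
    that kills [Q] is seen at once to kill the whole span, with no linear
    combinations. *)
Definition span b (p : P b) : Prop := forall J : forall b, P b -> Prop,
  (forall b, J b 0) -> (forall b x y, J b x -> J b y -> J b (x - y)) ->
  (forall b b' (f : Hom b b') x, J b x -> J b' (lm_map P f x)) ->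
  (forall u, Q u -> J _ (elt_val u)) -> J b p.

Fact span0 b : @span b 0.
Proof. by move=> J J0 *. Qed.

Fact spanB b (x y : P b) : span x -> span y -> span (x - y).
Proof. by move=> sx sy J J0 JB Jf JQ; apply: (JB); [exact: (sx J)|exact: (sy J)]. Qed.

Definition span_sub b : zmodClosed (P b) := mk_subgroup (@span0 b) (@spanB b).

Fact span_stable b b' (f : Hom b b') x : x \in span_sub b -> lm_map P f x \in span_sub b'.
Proof.
move=> /mk_subgroupP sx; apply/mk_subgroupP => J J0 JB Jf JQ; apply: (Jf); exact: (sx J).
Qed.

Definition span_quot : lmod A := quotient_mod span_stable.
Definition span_proj : mhom P span_quot := quotient_proj span_stable.

Lemma span_proj_eq0 b (x : P b) : span_proj b x = 0 <-> span x.
Proof.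
by split=> [/(quotient_proj_eq0 span_stable)/mk_subgroupP//|sx]; apply/(quotient_proj_eq0 span_stable)/mk_subgroupP.
Qed.

Lemma span_mem u : Q u -> span (elt_val u).
Proof. by move=> Qu J _ _ _; apply. Qed.

Lemma span_kernel (M : lmod A) (h : mhom P M) :
  (forall u, Q u -> h _ (elt_val u) = 0) -> forall b (x : P b), span x -> h b x = 0.
Proof.
move=> hQ b x sx; apply: (sx (fun b y => h b y = 0)) => // [c|c y z hy hz|c c' f y hy].
- exact: raddf0.
- by rewrite raddfB hy hz subrr.
- by rewrite mh_nat hy raddf0.
Qed.

Section Lift.
Variables (M : lmod A) (h : mhom P M).
Hypothesis hQ : forall u, Q u -> h _ (elt_val u) = 0.

Fact span_kernel_sub b x : x \in span_sub b -> h b x = 0.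
Proof. by move=> /mk_subgroupP; exact: span_kernel. Qed.

Definition span_lift : mhom span_quot M := quotient_desc span_stable span_kernel_sub.

Lemma span_liftE b x : span_lift b (span_proj b x) = h b x.
Proof. exact: quotient_descE. Qed.

End Lift.
End Span.

(** * Approximation of a module by finitely many relations *)

Section Lifting.
Variables (A : preadditive) (S : sequence A) (Sp : system_pure S).

(** The system involves only the indices in [s]; elsewhere any preimage will
    do. The solution on [s] is transported along the numbering of [s]. *)
Lemma pure_lift_family (T : choiceType) (a : T -> A) (x : forall t, sqN S (a t))
    (s : seq T) l (c : 'I_l -> A) (r : forall k t, Hom (a t) (c k)) :
  uniq s -> (forall k, \sum_(t <- s) lm_map (sqN S) (r k t) (x t) = 0) ->
  exists y : forall t, sqM S (a t), (forall t, sqg S _ (y t) = x t) /\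
    forall k, \sum_(t <- s) lm_map (sqM S) (r k t) (y t) = 0.
Proof.
move=> us xs.
have /dep_choice[z zx] : forall t, exists z, sqg S _ z = x t.
  by move=> t; have [_ _ gs] := Sp.1 (a t); exact: gs.
pose tn := tnth (in_tuple s).
have [|y0 [y0s y0x]] := Sp.2 _ (fun i => a (tn i)) _ c (fun k i => r k (tn i))
  (fun i => x (tn i)).
  by apply: functional_extensionality_dep => k; rewrite -[RHS](xs k) big_tnth.
pose y t := if pselect (exists i, tn i = t) is left e
  then eq_rect _ (fun t => sqM S (a t)) (y0 (projT1 (cid e))) _ (projT2 (cid e))
  else z t.
have tn_inj : injective tn by apply/tuple_uniqP.
have yE i : y (tn i) = y0 i.
  rewrite /y; case: pselect => [e|[]]; last by exists i.
  move: (projT2 (cid e)); move: (projT1 (cid e)) => j /= ji.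
  have ij := tn_inj _ _ ji; subst j; by rewrite (Prop_irrelevance ji erefl).
exists y; split=> [t|k].
  rewrite /y; case: pselect => [e|_]; last exact: zx.
  move: (projT2 (cid e)); move: (projT1 (cid e)) => j /= ji.
  by subst t; exact: y0x.
rewrite big_tnth; have /(congr1 (fun f => f k)) y0k := y0s.
apply: etrans y0k; apply: eq_bigr => i _; congr (lm_map _ _ _); exact: yE.
Qed.

(** The quotient of a free module by finitely many relations is
    pure-projective: a map from it to [sqN S] is a family of values of the
    generators that solves finitely many equations, each in finitely many of
    the unknowns. Lift this solution on the generators that occur, and lift
    the others arbitrarily. *)
Lemma pure_lift_span_quot (T : choiceType) (a : T -> A)
    (Q : element (sum_mod a) -> Prop) (u : mhom (span_quot Q) (sqN S)) :
  (exists s : seq (element (sum_mod a)), forall q, Q q <-> q \in s) ->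
  exists v : mhom (span_quot Q) (sqM S), mhom_comp (sqg S) v = u.
Proof.
move=> [qs Qqs].
pose x t := u _ (span_proj Q _ (sum_basis a t)).
have xE : mhom_comp u (span_proj Q) = sum_desc x.
  by apply: sum_mod_hom_ext => t; rewrite sum_desc_basis.
pose q k := tnth (in_tuple qs) k.
(* The finitely many generators that occur in the relations. *)
have [F uF Fq] : exists2 F : seq T, uniq F &
    forall k, supported_in (coef (elt_val (q k))) F.
  have /choice[f fP] : forall k, exists s, supported_in (coef (elt_val (q k))) s.
    by move=> k; have [s _ sP] := coef_supp (elt_val (q k)); exists s.
  exists (undup (flatten [seq f k | k <- enum 'I_(size qs)])); first exact: undup_uniq.
  move=> k t; rewrite mem_undup => tF; apply: (fP k); apply: contraNN tF => tf.
  by apply/flatten_mapP; exists k; rewrite ?mem_enum.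
have [|y [yx yq]] := @pure_lift_family T a x F _ (fun k => elt_ob (q k))
  (fun k t => coef (elt_val (q k)) t) uF.
  move=> k; rewrite -(sum_evalE x uF (Fq k)).
  rewrite -[LHS]/(sum_desc x _ _) -xE /=.
  have /span_proj_eq0-> : span Q (elt_val (q k)); last exact: raddf0.
  by apply: span_mem; apply/Qqs; exact: mem_tnth.
have yQ p : Q p -> sum_desc y _ (elt_val p) = 0.
  move=> /Qqs /(tnthP (in_tuple qs))[k ->].
  by rewrite -(yq k); exact: sum_evalE (Fq k).
exists (span_lift yQ); apply: mhom_ext => b p.
have [p0 <-] := quotient_proj_surj p.
rewrite -[LHS]/(sqg S b (span_lift yQ b (span_proj Q b p0))) span_liftE.
rewrite -[RHS]/(mhom_comp u (span_proj Q) b p0) xE.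
rewrite -[LHS]/(mhom_comp (sqg S) (sum_desc y) b p0).
congr (mh_fun _ _ _); apply: sum_mod_hom_ext => t.
rewrite -[LHS]/(sqg S _ (sum_desc y _ (sum_basis a t))).
by rewrite !sum_desc_basis yx.
Qed.

End Lifting.

Section Approximation.
Variables (A : preadditive) (N : lmod A).

Definition cover : lmod A := sum_mod (@elt_ob A N).
Definition cover_map : mhom cover N := sum_desc (@elt_val A N).

Lemma cover_surj b (x : N b) : exists p, cover_map b p = x.
Proof. by exists (sum_basis _ (Element x)); exact: (sum_desc_basis _ (Element x)). Qed.

(** Only the relations are cut down to finite sets, not the generators, so the
    modules [approx Q] are pure-projective but in general not finitely
    presented. Indices are predicates, rather than lists, because the order on
    them has to be antisymmetric. *)
Record finite_relations := FiniteRelations {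
  fr_rel : element cover -> Prop;
  fr_fin : exists s : seq (element cover), forall q, fr_rel q <-> q \in s;
  fr_ker : forall q, fr_rel q -> cover_map _ (elt_val q) = 0 }.
HB.instance Definition _ := gen_eqMixin finite_relations.
HB.instance Definition _ := gen_choiceMixin finite_relations.

Definition fr_le (Q R : finite_relations) : bool :=
  `[< forall q, fr_rel Q q -> fr_rel R q >].

Fact fr_le_refl : reflexive fr_le.
Proof. by move=> Q; apply/asboolP. Qed.
Fact fr_le_anti : antisymmetric fr_le.
Proof.
move=> [Q Qf Qk] [R Rf Rk] /andP[/asboolP /= QR /asboolP /= RQ].
have E : Q = R by apply/funext => q; apply/propext; split; [exact: QR|exact: RQ].
by subst R; rewrite (Prop_irrelevance Qf Rf) (Prop_irrelevance Qk Rk).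
Qed.
Fact fr_le_trans : transitive fr_le.
Proof. by move=> R Q U /asboolP QR /asboolP RU; apply/asboolP => q /QR/RU. Qed.

Fact fr_display : Order.disp_t. Proof. exact: Order.Disp tt tt. Qed.
HB.instance Definition _ := Order.Le_isPOrder.Build fr_display finite_relations
  fr_le_refl fr_le_anti fr_le_trans.

Lemma fr_leP (Q R : finite_relations) :
  reflect (forall q, fr_rel Q q -> fr_rel R q) (Q <= R)%O.
Proof. exact: asboolP. Qed.

Definition fr_empty : finite_relations.
Proof.
by exists (fun _ => False); [exists [::] | ].
Defined.

Definition fr_join (Q R : finite_relations) : finite_relations.
Proof.
exists (fun q => fr_rel Q q \/ fr_rel R q).
  have [s sE] := fr_fin Q; have [s' s'E] := fr_fin R; exists (s ++ s') => q.
  rewrite mem_cat; split=> [[/sE->|/s'E->]//|/orP[/sE|/s'E]]; rewrite ?orbT //; tauto.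
by move=> q [/fr_ker|/fr_ker].
Defined.

Definition fr_one b (p : cover b) (p0 : cover_map b p = 0) : finite_relations.
Proof.
exists (fun q => q = Element p); last by move=> q ->.
by exists [:: Element p] => q; rewrite inE; split=> /eqP.
Defined.

Lemma fr_join_l Q R : (Q <= fr_join Q R)%O.
Proof. by apply/fr_leP => q; left. Qed.
Lemma fr_join_r Q R : (R <= fr_join Q R)%O.
Proof. by apply/fr_leP => q; right. Qed.

Lemma fr_directed : directed finite_relations.
Proof.
split; first exact: inhabits fr_empty.
by move=> Q R; exists (fr_join Q R); split; [exact: fr_join_l | exact: fr_join_r].
Qed.

Definition approx (Q : finite_relations) : lmod A := span_quot (fr_rel Q).
Definition approx_proj Q : mhom cover (approx Q) := span_proj (fr_rel Q).

Definition approx_to Q : mhom (approx Q) N := span_lift (@fr_ker Q).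

Lemma approx_toE Q b p : approx_to Q b (approx_proj Q b p) = cover_map b p.
Proof. exact: span_liftE. Qed.

Fact approx_map_subproof Q R (QR : (Q <= R)%O) q :
  fr_rel Q q -> approx_proj R _ (elt_val q) = 0.
Proof.
move=> Qq; have /fr_leP/(_ q Qq) Rq := QR.
by apply/span_proj_eq0; exact: span_mem.
Qed.

Definition approx_map Q R (QR : (Q <= R)%O) : mhom (approx Q) (approx R) :=
  span_lift (approx_map_subproof QR).

Lemma approx_mapE Q R (QR : (Q <= R)%O) b p :
  approx_map QR b (approx_proj Q b p) = approx_proj R b p.
Proof. exact: span_liftE. Qed.

Lemma approx_surj Q b (x : approx Q b) : exists p, approx_proj Q b p = x.
Proof. exact: quotient_proj_surj. Qed.

Lemma approx_map_id Q (QQ : (Q <= Q)%O) : approx_map QQ = mhom_id (approx Q).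
Proof.
by apply: mhom_ext => b x; have [p <-] := approx_surj x; rewrite approx_mapE.
Qed.

Lemma approx_map_comp Q R U (QR : (Q <= R)%O) (RU : (R <= U)%O) (QU : (Q <= U)%O) :
  mhom_comp (approx_map RU) (approx_map QR) = approx_map QU.
Proof.
apply: mhom_ext => b x; have [p <-] := approx_surj x.
by rewrite -[LHS]/(approx_map RU b (approx_map QR b _)) !approx_mapE.
Qed.

Lemma approx_to_map Q R (QR : (Q <= R)%O) :
  mhom_comp (approx_to R) (approx_map QR) = approx_to Q.
Proof.
apply: mhom_ext => b x; have [p <-] := approx_surj x.
by rewrite -[LHS]/(approx_to R b (approx_map QR b _)) approx_mapE !approx_toE.
Qed.

Lemma approx_to_surj Q b (x : N b) : exists y, approx_to Q b y = x.
Proof.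
by have [p <-] := cover_surj x; exists (approx_proj Q b p); exact: approx_toE.
Qed.

(** An element of [approx Q] that dies in [N] comes from an element of the
    kernel of [cover_map]; adding it to the relations kills it. *)
Lemma approx_to_eq0 Q b (y : approx Q b) : approx_to Q b y = 0 ->
  exists R (QR : (Q <= R)%O), approx_map QR b y = 0.
Proof.
have [p <-] := approx_surj y; rewrite approx_toE => p0.
exists (fr_join Q (fr_one p0)), (fr_join_l _ _); rewrite approx_mapE.
by apply/span_proj_eq0; apply: (@span_mem _ _ _ (Element p)); right.
Qed.

Definition approx_diagram : diagram (Mod A) finite_relations :=
  @Diagram (Mod A) _ finite_relations approx approx_map approx_map_id approx_map_comp.

Definition approx_cocone : cocone approx_diagram N :=
  @Cocone (Mod A) _ finite_relations approx_diagram N approx_to approx_to_map.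

Lemma approx_colimit : is_colimit approx_cocone.
Proof.
apply: (elementwise_colimit fr_directed); split=> [b x|Q b y].
  by exists fr_empty; exact: approx_to_surj.
exact: approx_to_eq0.
Qed.

Lemma pure_lift_approx (S : sequence A) (Q : finite_relations)
    (u : mhom (approx Q) (sqN S)) : system_pure S ->
  exists v : mhom (approx Q) (sqM S), mhom_comp (sqg S) v = u.
Proof. by move=> Sp; apply: pure_lift_span_quot => //; exact: fr_fin. Qed.

End Approximation.

(** A finitely presented [X] is the direct limit of the modules [approx Q], so
    its identity factors as X -> approx Q -> X, and lifting of maps passes
    from [approx Q] to its retract [X]. Left exactness of Hom is automatic. *)
Lemma system_pure_pure_exact (A : preadditive) (S : sequence A) :
  system_pure S -> pure_exact S.
Proof.
move=> Sp X Xfp.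
have [Q [i iE]] : exists Q (i : mhom X (approx Q)),
    mhom_comp (approx_to Q) i = mhom_id X.
  exact (Ab_colimit_surj (fr_directed X)
    (Xfp _ _ (fr_directed X) _ _ _ (@approx_colimit _ X)) (mhom_id X)).
split.
- apply: injective_ker0 => u fu; apply: mhom_ext => b x.
  have [fi _ _] := Sp.1 b; apply: fi; rewrite raddf0.
  by have /mhom_app/(_ b x) := fu.
- move=> v; split=> [gv|[u <-]]; last first.
    apply: mhom_ext => b x; have [_ fg _] := Sp.1 b.
    by apply/fg; exists (u b x).
  exact: (kernel_factor Sp.1 gv).
- move=> w; have [v vE] := pure_lift_approx (mhom_comp w (approx_to Q)) Sp.
  exists (mhom_comp v i).
  rewrite -[LHS]/(mhom_comp (sqg S) (mhom_comp v i)) mhom_compA vE -mhom_compA iE.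
  exact: mhom_idr.
Qed.

(** * Pure sequences as direct limits of split ones *)

(** The sequence [S] pulled back along [nu : X -> sqN S]. It splits as soon as
    [nu] lifts to [sqM S]. *)
Section Pullback.
Variables (A : preadditive) (S : sequence A) (X : lmod A) (nu : mhom X (sqN S)).

Definition pb_rel b (z : (sqM S b * X b)%type) : Prop := sqg S b z.1 = nu b z.2.

Fact pb_rel0 b : @pb_rel b 0.
Proof. by rewrite /pb_rel /= !raddf0. Qed.

Fact pb_relB b z w : @pb_rel b z -> @pb_rel b w -> @pb_rel b (z - w).
Proof. by rewrite /pb_rel /= !raddfB => -> ->. Qed.

Definition pb_sub b : zmodClosed (sqM S b * X b)%type := mk_subgroup (@pb_rel0 b) (@pb_relB b).

Fact pb_map_subproof b b' (f : Hom b b') (z : subgroup (pb_sub b)) :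
  (lm_map (sqM S) f (val z).1, lm_map X f (val z).2) \in pb_sub b'.
Proof.
have /mk_subgroupP zr := valP z; apply/mk_subgroupP.
by rewrite /pb_rel /= !mh_nat zr.
Qed.

Definition pb_map_fun b b' (f : Hom b b') (z : subgroup (pb_sub b)) : subgroup (pb_sub b') :=
  Sub (lm_map (sqM S) f (val z).1, lm_map X f (val z).2) (pb_map_subproof f z).

Fact pb_map_zmod b b' (f : Hom b b') : zmod_morphism (pb_map_fun f).
Proof.
move=> z w; apply: val_inj; rewrite [RHS]raddfB.
rewrite -[LHS]/(lm_map (sqM S) f (val (z - w)).1, lm_map X f (val (z - w)).2).
by rewrite [val (z - w)]raddfB /= !raddfB.
Qed.

Definition pullback : lmod A.
Proof.
exists (fun b => subgroup (pb_sub b) : zmodType) (fun b b' f => mk_addhom (pb_map_zmod f)).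
- move=> b; apply: addhom_ext => z; apply: val_inj; apply: etrans (esym (surjective_pairing _)).
  by apply: (congr2 pair); rewrite lm_map1.
- move=> b b' b'' g f; apply: addhom_ext => z; apply: val_inj.
  by apply: (congr2 pair); rewrite lm_mapM.
- move=> b b' f g; apply: addhom_ext => z; apply: val_inj.
  by apply: (congr2 pair); rewrite lm_mapD.
Defined.

Definition pb_M b (z : pullback b) : sqM S b := (val z).1.
Definition pb_X b (z : pullback b) : X b := (val z).2.

Lemma pb_eq b (z w : pullback b) : pb_M z = pb_M w -> pb_X z = pb_X w -> z = w.
Proof.
move=> E F; apply: val_inj; rewrite [LHS]surjective_pairing [RHS]surjective_pairing.
exact: (congr2 pair).
Qed.

Lemma pb_eqn b (z : pullback b) : sqg S b (pb_M z) = nu b (pb_X z).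
Proof. exact: (mk_subgroupP _ _ _ (valP z)). Qed.

Definition pb_pair b (m : sqM S b) (x : X b) (E : sqg S b m = nu b x) : pullback b :=
  Sub (m, x) (introT (mk_subgroupP _ _ _) E) : subgroup (pb_sub b).

Fact pb_M_zmod b : zmod_morphism (@pb_M b).
Proof. by move=> z w; rewrite /pb_M [val _]raddfB. Qed.
Fact pb_X_zmod b : zmod_morphism (@pb_X b).
Proof. by move=> z w; rewrite /pb_X [val _]raddfB. Qed.

Definition pb_toM : mhom pullback (sqM S) :=
  @MHom A pullback (sqM S) (fun b => mk_addhom (@pb_M_zmod b)) (fun _ _ _ _ => erefl).
Definition pb_toX : mhom pullback X :=
  @MHom A pullback X (fun b => mk_addhom (@pb_X_zmod b)) (fun _ _ _ _ => erefl).

Section Pairing.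
Variables (Z : lmod A) (m : mhom Z (sqM S)) (x : mhom Z X).
Hypothesis E : mhom_comp (sqg S) m = mhom_comp nu x.

Definition pb_pairing_fun b (z : Z b) : pullback b := pb_pair (mhom_app E z).

Fact pb_pairing_zmod b : zmod_morphism (@pb_pairing_fun b).
Proof.
move=> z w; apply: pb_eq.
- by rewrite [RHS]pb_M_zmod; exact: raddfB.
- by rewrite [RHS]pb_X_zmod; exact: raddfB.
Qed.

Fact pb_pairing_nat b b' (f : Hom b b') (z : Z b) :
  mk_addhom (@pb_pairing_zmod b') (lm_map Z f z)
  = lm_map pullback f (mk_addhom (@pb_pairing_zmod b) z).
Proof. by apply: pb_eq; exact: mh_nat. Qed.

Definition pb_pairing : mhom Z pullback := MHom pb_pairing_nat.

End Pairing.

Hypothesis Se : short_exact S.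

Fact pb_incl_subproof : mhom_comp (sqg S) (sqf S) = mhom_comp nu (0 : mhom (sqL S) X).
Proof.
by apply: mhom_ext => b x; rewrite [LHS](short_exact_comp0 Se) [RHS]raddf0.
Qed.

Definition pb_seq : sequence A := Sequence (pb_pairing pb_incl_subproof) pb_toX.

Lemma pb_seq_split (v : mhom X (sqM S)) : mhom_comp (sqg S) v = nu -> split_exact pb_seq.
Proof.
move=> vE; split.
  move=> b; have [fi fg _] := Se b; split.
  - apply: injective_ker0 => x /(congr1 (@pb_M b)) E; apply: (injective_eq0 fi).
    by rewrite -[LHS]/(pb_M (pb_pairing pb_incl_subproof b x)) E.
  - move=> z; split=> [zX|[x <-]] //.
    have /fg[x xE] : sqg S b (pb_M z) = 0.
      by rewrite pb_eqn -[pb_X z]/(sqg pb_seq b z) zX raddf0.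
    exists x; apply: pb_eq => //.
  - move=> x; have E : sqg S b (v b x) = nu b x by rewrite -vE.
    by exists (pb_pair E).
have vE' : mhom_comp (sqg S) v = mhom_comp nu (mhom_id X) by rewrite mhom_idr.
exists (pb_pairing vE'); exact: mhom_ext.
Qed.

End Pullback.

Section PullbackDiagram.
Variables (A : preadditive) (S : sequence A) (Sp : system_pure S).
Let N := sqN S.

Definition pb_stage (Q : finite_relations N) : sequence A := pb_seq (approx_to Q) Sp.1.

Fact pb_stage_map_subproof (Q R : finite_relations N) (QR : (Q <= R)%O) :
  mhom_comp (sqg S) (pb_toM (approx_to Q)) =
  mhom_comp (approx_to R) (mhom_comp (approx_map QR) (pb_toX (approx_to Q))).
Proof.
rewrite mhom_compA approx_to_map; apply: mhom_ext => b z; exact: pb_eqn.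
Qed.

Definition pb_stage_map (Q R : finite_relations N) (QR : (Q <= R)%O) :
  sqhom (pb_stage Q) (pb_stage R).
Proof.
refine (@SqHom A (pb_stage Q) (pb_stage R) (mhom_id (sqL S))
  (pb_pairing (pb_stage_map_subproof QR)) (approx_map QR) _ _).
- apply: mhom_ext => b x; apply: pb_eq => //.
  exact: (raddf0 (approx_map QR b)).
- exact: mhom_ext.
Defined.

Lemma pb_stage_map_id Q (QQ : (Q <= Q)%O) : pb_stage_map QQ = sqhom_id (pb_stage Q).
Proof.
apply: sqhom_ext => //; last exact: approx_map_id.
apply: mhom_ext => b z; apply: pb_eq => //.
by rewrite -[LHS]/(approx_map QQ b (pb_X z)) approx_map_id.
Qed.

Lemma pb_stage_map_comp Q R U (QR : (Q <= R)%O) (RU : (R <= U)%O) (QU : (Q <= U)%O) :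
  sqhom_comp (pb_stage_map RU) (pb_stage_map QR) = pb_stage_map QU.
Proof.
apply: sqhom_ext; [exact: mhom_ext| |exact: approx_map_comp].
apply: mhom_ext => b z; apply: pb_eq => //.
by rewrite -[RHS]/(approx_map QU b (pb_X z)) -(approx_map_comp QR RU QU).
Qed.

Definition pb_stage_diagram : diagram (Seq A) (finite_relations N) :=
  @Diagram (Seq A) _ (finite_relations N) pb_stage pb_stage_map pb_stage_map_id pb_stage_map_comp.

Definition pb_stage_leg (Q : finite_relations N) : sqhom (pb_stage Q) S.
Proof.
refine (@SqHom A (pb_stage Q) S (mhom_id (sqL S)) (pb_toM (approx_to Q)) (approx_to Q) _ _).
- exact: mhom_ext.
- by apply: mhom_ext => b z; exact/esym/pb_eqn.
Defined.

Lemma pb_stage_leg_map Q R (QR : (Q <= R)%O) :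
  sqhom_comp (pb_stage_leg R) (pb_stage_map QR) = pb_stage_leg Q.
Proof. by apply: sqhom_ext; [exact: mhom_ext|exact: mhom_ext|exact: approx_to_map]. Qed.

Definition pb_stage_cocone : cocone pb_stage_diagram S :=
  @Cocone (Seq A) _ (finite_relations N) pb_stage_diagram S pb_stage_leg pb_stage_leg_map.

(** The pullbacks of [S] along the maps approx Q -> sqN S form a diagram with
    constant left-hand term. In the middle, an element of a stage that is
    killed in [sqM S] has its second component killed in [sqN S], hence at a
    later stage. *)
Lemma pb_stage_colimit : is_colimit pb_stage_cocone.
Proof.
have dirI := fr_directed N.
apply: seq_colimit_components; apply: (elementwise_colimit dirI); split.
- by move=> b x; exists (fr_empty N), x.
- by move=> Q b x x0; exists Q, (Order.POrderTheory.lexx Q).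
- move=> b m; have [x xE] := approx_to_surj (fr_empty N) (sqg S b m).
  by exists (fr_empty N), (pb_pair (esym xE)).
- move=> Q b z z0; have zM : pb_M z = 0 by [].
  have /approx_to_eq0[R [QR zR]] : approx_to Q b (pb_X z) = 0.
    by rewrite -pb_eqn zM raddf0.
  by exists R, QR; apply: pb_eq.
- by move=> b x; exists (fr_empty N); exact: approx_to_surj.
- by move=> Q b y; exact: approx_to_eq0.
Qed.

Lemma system_pure_limit_of_split :
  is_direct_limit_of (C := Seq A) (@split_exact A) S.
Proof.
exists fr_display, (finite_relations N), pb_stage_diagram, pb_stage_cocone.
split; [exact: fr_directed | | exact: pb_stage_colimit].
move=> Q; have [v vE] := pure_lift_approx (approx_to Q) Sp.
exact: pb_seq_split vE.
Qed.

End PullbackDiagram.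

(** * Pairs of pp formulas *)

#[local] Arguments pp_sol {A n s} M phi.

Section PPExactness.
Variable A : preadditive.

Lemma pp_quot_mapE n (s : 'I_n -> A) (M N : lmod A) (h : mhom M N) (p : pp_pair s) x :
  pp_quot_map h p (proj _ x) = proj _ (pp_sub h (pp_num p) x).
Proof. exact: (quot_map_pi (@pp_sub_den _ _ _ M N h p)). Qed.

Section PureToPP.
Variables (S : sequence A) (Sp : system_pure S) (n : nat) (s : 'I_n -> A).

(** The free and the bound variables of [phi] together solve one linear
    system, which lifts. They are indexed by a sum type. *)
Lemma pp_sol_lift (phi : pp_formula s) (z : pp_tuples s (sqN S)) :
  z \in pp_sol (sqN S) phi ->
  exists2 x, x \in pp_sol (sqM S) phi & pp_map_fun (sqg S) x = z.
Proof.
move=> /asboolP[w zw].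
pose T : choiceType := ('I_n + 'I_(pp_m phi))%type.
pose a (t : T) : A := match t with inl i => s i | inr j => pp_B j end.
pose v (t : T) : sqN S (a t) := match t with inl i => z i | inr j => w j end.
pose r k (t : T) : Hom (a t) (pp_C k) :=
  match t with inl i => pp_r k i | inr j => pp_s k j end.
have sumE (M : lmod A) (u : forall t, M (a t)) k :
    \sum_(t <- enum T) lm_map M (r k t) (u t)
    = \sum_i lm_map M (pp_r k i) (u (inl i)) + \sum_j lm_map M (pp_s k j) (u (inr j)).
  by rewrite big_enum big_sumType.
have [|u [uv ur]] := pure_lift_family Sp (x := v) (s := enum T) (r := r) (enum_uniq _).
  by move=> k; rewrite sumE; exact: zw.
exists (fun i => u (inl i)).
  by apply/asboolP; exists (fun j => u (inr j)) => k; rewrite -(sumE (sqM S) u) ur.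
by apply: functional_extensionality_dep => i; exact: (uv (inl i)).
Qed.

Lemma tuple_exact m (t : 'I_m -> A) (y : pp_tuples t (sqM S)) :
  pp_map_fun (sqg S) y = 0 -> exists x : pp_tuples t (sqL S), pp_map_fun (sqf S) x = y.
Proof.
move=> gy.
have /dep_choice[x xE] : forall i, exists x, sqf S (t i) x = y i.
  move=> i; have [_ fg _] := Sp.1 (t i); apply/fg.
  exact: (congr1 (fun f => f i) gy).
by exists x; apply: functional_extensionality_dep.
Qed.

Lemma tuple_injective m (t : 'I_m -> A) (x : pp_tuples t (sqL S)) :
  pp_map_fun (sqf S) x = 0 -> x = 0.
Proof.
move=> fx; apply: functional_extensionality_dep => i.
have [fi _ _] := Sp.1 (t i); apply: (injective_eq0 fi).
exact: (congr1 (fun f => f i) fx).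
Qed.

Lemma pp_map_funD m (t : 'I_m -> A) (M N : lmod A) (h : mhom M N)
    (x y : pp_tuples t M) :
  pp_map_fun h (x + y) = pp_map_fun h x + pp_map_fun h y.
Proof. exact: raddfD. Qed.

Lemma pp_map_funB m (t : 'I_m -> A) (M N : lmod A) (h : mhom M N)
    (x y : pp_tuples t M) :
  pp_map_fun h (x - y) = pp_map_fun h x - pp_map_fun h y.
Proof. exact: raddfB. Qed.

(** Let [y] be a witness in [sqM S]. Its image solves the homogeneous system
    of the bound variables, so it lifts to a solution [y'] of that system;
    then [y - y'] is again a witness, and it comes from [sqL S]. *)
Lemma pp_sol_reflect (phi : pp_formula s) (x : pp_tuples s (sqL S)) :
  pp_map_fun (sqf S) x \in pp_sol (sqM S) phi -> x \in pp_sol (sqL S) phi.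
Proof.
move=> /asboolP[y xy].
have {}xy : system_map (@pp_r _ _ _ phi) _ (pp_map_fun (sqf S) x)
    + system_map (@pp_s _ _ _ phi) _ y = 0.
  by apply: functional_extensionality_dep => k; exact: xy.
have gf0 m (t : 'I_m -> A) (u : pp_tuples t (sqL S)) :
    pp_map_fun (sqg S) (pp_map_fun (sqf S) u) = 0.
  apply: functional_extensionality_dep => i; exact (short_exact_comp0 Sp.1 _).
have sgy : system_map (@pp_s _ _ _ phi) _ (pp_map_fun (sqg S) y) = 0.
  rewrite system_map_nat; have /(congr1 (pp_map_fun (sqg S))) := xy.
  rewrite pp_map_funD !system_map_nat gf0 add0r => ->.
  by apply: functional_extensionality_dep => k; exact: raddf0.
have [y' [y's gy']] := Sp.2 _ _ _ _ _ _ sgy.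
have [|z zE] := @tuple_exact _ _ (y - y').
  rewrite pp_map_funB; apply/eqP; rewrite subr_eq0; apply/eqP/esym.
  by apply: functional_extensionality_dep => i; exact: gy'.
suff E : system_map (@pp_r _ _ _ phi) _ x + system_map (@pp_s _ _ _ phi) _ z = 0.
  by apply/asboolP; exists z => k; exact: (congr1 (fun f => f k) E).
apply: tuple_injective; rewrite pp_map_funD.
rewrite -[X in X + _]system_map_nat -[X in _ + X]system_map_nat zE.
by rewrite [X in _ + X]raddfB y's subr0.
Qed.

(** Solutions lift and are reflected; the only remaining point is the middle:
    if [g x] satisfies the denominator, correct [x] by a lift of [g x] in the
    denominator, and what is left comes from [sqL S]. *)
Lemma system_pure_pp_exact (p : pp_pair s) :
  exact_Ab (pp_quot_map (sqf S) p) (pp_quot_map (sqg S) p).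
Proof.
split.
- apply: injective_ker0 => q; have [x <-] := proj_surj q; rewrite pp_quot_mapE.
  by move=> /proj_eq0 fx; apply/proj_eq0; exact: pp_sol_reflect fx.
- move=> q; have [x <-] := proj_surj q; split=> [|[q' <-]]; last first.
    have [y <-] := proj_surj q'; rewrite !pp_quot_mapE; apply/proj_eq0.
    rewrite (_ : pp_sub (sqg S) _ _ = 0) ?rpred0 //; apply: val_inj.
    by apply: functional_extensionality_dep => i; exact (short_exact_comp0 Sp.1 _).
  rewrite pp_quot_mapE => /proj_eq0/pp_sol_lift[x' x'd gx'].
  have [|z zE] := @tuple_exact _ _ (val x - x').
    by rewrite pp_map_funB gx' subrr.
  have zn : z \in pp_sol (sqL S) (pp_num p).
    apply: pp_sol_reflect; rewrite zE; apply: rpredB; first exact: valP x.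
    exact: pp_incl x'd.
  exists (proj _ (Sub z zn : subgroup _)); rewrite pp_quot_mapE.
  apply/eqP; rewrite eq_sym -subr_eq0 -raddfB; apply/eqP/proj_eq0.
  rewrite -[_ \in _]/(val (x - pp_sub (sqf S) (pp_num p) (Sub z zn)) \in pp_sol _ (pp_den p)).
  have -> : val (x - pp_sub (sqf S) (pp_num p) (Sub z zn)) = x'; last by [].
  transitivity (val x - pp_map_fun (sqf S) z); first exact: raddfB.
  by rewrite zE opprB addrC subrK.
- move=> q; have [z <-] := proj_surj q.
  have [x xn gx] := pp_sol_lift (valP z).
  exists (proj _ (Sub x xn : subgroup _)); rewrite pp_quot_mapE; congr (proj _ _).
  exact: val_inj.
Qed.

End PureToPP.

Section PPToPure.
Variables (n : nat) (a : 'I_n -> A).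

Definition pp_system l (c : 'I_l -> A) (r : forall k i, Hom (a i) (c k)) : pp_formula a :=
  @PPFormula A n a 0 (fun j : 'I_0 => False_rect A (notF (ltn_ord j))) l c r
    (fun k j => 0).

Lemma pp_systemP l (c : 'I_l -> A) (r : forall k i, Hom (a i) (c k)) (M : lmod A) x :
  x \in pp_sol M (pp_system r) <-> system_map r M x = 0.
Proof.
split=> [/asboolP[y xy]|xs].
  apply: functional_extensionality_dep => k; have := xy k.
  by rewrite [X in _ + X]big_ord0 addr0.
apply/asboolP; exists 0 => k.
by rewrite [X in _ + X]big_ord0 addr0; exact: (congr1 (fun f => f k) xs).
Qed.

(** The formula saying that all free variables are 0: with it as denominator,
    the functor of a pair is the solution set of its numerator. *)
Definition pp_zero : pp_formula a := pp_system (delta a).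

Lemma pp_zeroP (M : lmod A) x : x \in pp_sol M pp_zero <-> x = 0.
Proof.
have E : system_map (delta a) M x = x.
  apply: functional_extensionality_dep => k; rewrite /= /system_map_fun.
  rewrite (sum_delta_l (phi := fun j d => lm_map M d (x j))) ?lm_map1 //.
  by move=> j; exact: raddf0 (lm_act _ (x j)).
by split=> [/pp_systemP|x0]; [rewrite E | apply/pp_systemP; rewrite E].
Qed.

Definition pp_system_pair l (c : 'I_l -> A) (r : forall k i, Hom (a i) (c k)) : pp_pair a.
Proof.
exists (pp_system r) pp_zero => M x /pp_zeroP ->; exact: rpred0.
Defined.

Variables (l : nat) (c : 'I_l -> A) (r : forall k i, Hom (a i) (c k)).
Let p := pp_system_pair r.

Definition pp_class (M : lmod A) (x : pp_tuples a M) (xs : system_map r M x = 0) : pp_quot M p :=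
  proj _ (Sub x (proj2 (pp_systemP r x) xs) : subgroup (pp_sol M (pp_num p))).

Lemma pp_class_inj (M : lmod A) (x y : pp_tuples a M) (xs : system_map r M x = 0)
    (ys : system_map r M y = 0) : pp_class xs = pp_class ys -> x = y.
Proof.
rewrite /pp_class; set X := Sub x _; set Y := Sub y _ => /eqP; rewrite -subr_eq0 -raddfB.
move=> /eqP/proj_eq0 XY; have {}XY : val (X - Y) \in pp_sol M pp_zero by [].
by move: XY; rewrite raddfB => /pp_zeroP/eqP; rewrite subr_eq0 => /eqP.
Qed.

Lemma pp_class_surj (M : lmod A) (q : pp_quot M p) :
  exists x (xs : system_map r M x = 0), pp_class xs = q.
Proof.
have [x <-] := proj_surj q; have xs := proj1 (pp_systemP r (val x)) (valP x).
by exists (val x), xs; congr (proj _ _); exact: val_inj.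
Qed.

Lemma pp_class_map (M N : lmod A) (h : mhom M N) x (xs : system_map r M x = 0)
    (hxs : system_map r N (pp_map_fun h x) = 0) :
  pp_quot_map h p (pp_class xs) = pp_class hxs.
Proof. by rewrite pp_quot_mapE; congr (proj _ _); exact: val_inj. Qed.

Lemma system_solution_map (M N : lmod A) (h : mhom M N) x (xs : system_map r M x = 0) :
  system_map r N (pp_map_fun h x) = 0.
Proof.
by rewrite system_map_nat xs; apply: functional_extensionality_dep => k; exact: raddf0.
Qed.

End PPToPure.

Section PPShort.
Variables (S : sequence A).
Hypothesis Spp : forall (n : nat) (s : 'I_n -> A) (p : pp_pair s),
  exact_Ab (pp_quot_map (sqf S) p) (pp_quot_map (sqg S) p).

(** The pairs (system) / 0 give the lifting of solutions, and the pair (x = x)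
    / 0 in one variable of sort [b] gives short exactness at [b]. *)
Lemma pp_exact_system_pure : system_pure S.
Proof.
split=> [b|n a l c r x xs]; last first.
  have [_ _ gs] := Spp (pp_system_pair r).
  have [q] := gs (pp_class xs); have [y [ys <-]] := pp_class_surj q.
  rewrite (pp_class_map ys (system_solution_map (sqg S) ys)) => /pp_class_inj E.
  by exists y; split=> // i; rewrite -E.
pose a (i : 'I_1) := b; pose c (k : 'I_0) := b.
pose r (k : 'I_0) (i : 'I_1) : Hom (a i) (c k) := 0.
have any (M : lmod A) (x : pp_tuples a M) : system_map r M x = 0.
  by apply: functional_extensionality_dep => -[].
(* The system has no equation, so its solutions are all the elements of M b. *)
pose cst (M : lmod A) (x : M b) : pp_tuples a M := fun _ => x.
have [fi fg gs] := Spp (pp_system_pair r).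
have cst0 (M : lmod A) (x : M b) : pp_class (any M (cst M x)) = 0 <-> x = 0.
  have c0 : pp_class (any M 0) = 0 by rewrite -(raddf0 (proj _)); congr (proj _ _); exact: val_inj.
  split=> [|->]; last by [].
  by rewrite -c0 => /pp_class_inj/(congr1 (fun f => f ord0)).
have cstM (M N : lmod A) (h : mhom M N) (x : M b) :
    pp_quot_map h (pp_system_pair r) (pp_class (any M (cst M x)))
    = pp_class (any N (cst N (h b x))) by exact: pp_class_map.
have cst_surj (M : lmod A) q : exists x : M b, pp_class (any M (cst M x)) = q.
  have [x [xs <-]] := pp_class_surj q; exists (x ord0); congr (proj _ _); apply: val_inj.
  by apply: functional_extensionality_dep => i; rewrite (ord1 i).
have cst_inj (M : lmod A) (x y : M b) :
  pp_class (any M (cst M x)) = pp_class (any M (cst M y)) -> x = y.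
  by move=> /pp_class_inj/(congr1 (fun f => f ord0)).
split.
- by move=> x y E; apply: cst_inj; apply: fi; rewrite !cstM E.
- move=> y; rewrite -cst0 -cstM fg; split=> [[q]|[x <-]].
    have [x <-] := cst_surj _ q; rewrite cstM => /cst_inj xy; by exists x.
  by exists (pp_class (any _ (cst _ x))); rewrite cstM.
- move=> z; have [q] := gs (pp_class (any _ (cst _ z))).
  have [y <-] := cst_surj _ q; rewrite cstM => /cst_inj yz; by exists y.
Qed.

End PPShort.
End PPExactness.

(** * Tensor products along direct limits *)

Section TensorFunctor.
Variables (A : preadditive) (Y : rmod A).

Lemma tensor_ind (M : lmod A) (P : tensor Y M -> Prop) : P 0 ->
  (forall s t, P s -> P t -> P (s - t)) ->
  (forall a (y : Y a) (m : M a), P (tens y m)) -> forall t, P t.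
Proof.
move=> P0 PB Pt t; have [x <-] := proj_surj t.
elim/tfree_ind: x => [|x y Hx Hy|a y m]; first by rewrite raddf0.
  by rewrite raddfB; exact: PB.
exact: Pt.
Qed.

Lemma tensor_hom_ext (M : lmod A) (T : zmodType) (h h' : addhom (tensor Y M) T) :
  (forall a (y : Y a) (m : M a), h (tens y m) = h' (tens y m)) -> forall t, h t = h' t.
Proof.
move=> E; elim/tensor_ind => [|s t Hs Ht|//]; first by rewrite !raddf0.
by rewrite !raddfB Hs Ht.
Qed.

Lemma tensor_map_comp (L M N : lmod A) (g : mhom M N) (f : mhom L M) t :
  tensor_map Y (mhom_comp g f) t = tensor_map Y g (tensor_map Y f t).
Proof.
apply: (tensor_hom_ext (h' := addhom_comp (tensor_map Y g) (tensor_map Y f))) => a y m.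
by rewrite -[RHS]/(tensor_map Y g (tensor_map Y f _)) !tensor_mapE.
Qed.

Lemma tensor_map_id (M : lmod A) t : tensor_map Y (mhom_id M) t = t.
Proof.
by apply: (tensor_hom_ext (h' := addhom_id _)) => a y m; rewrite tensor_mapE.
Qed.

Lemma tensDr (M : lmod A) a (y : Y a) (m m' : M a) :
  tens y (m + m') = tens y m + tens y m'.
Proof. by have [_ H _] := tens_balanced Y M; exact: H. Qed.

Lemma tensDl (M : lmod A) a (y y' : Y a) (m : M a) :
  tens (y + y') m = tens y m + tens y' m.
Proof. by have [H _ _] := tens_balanced Y M; exact: H. Qed.

Lemma tens_ract (M : lmod A) (a b : A) (f : Hom a b) (y : Y b) (m : M a) :
  tens (ract Y f y) m = tens y (lm_map M f m).
Proof. by have [_ _ H] := tens_balanced Y M; exact: H. Qed.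

Fact tens_r_zmod (M : lmod A) a (y : Y a) : zmod_morphism (fun m : M a => tens y m).
Proof.
move=> m m'; apply/eqP; rewrite eq_sym subr_eq; apply/eqP.
by rewrite -tensDr subrK.
Qed.
Definition tens_r (M : lmod A) a (y : Y a) : addhom (M a) (tensor Y M) :=
  mk_addhom (@tens_r_zmod M a y).

Fact tens_l_zmod (M : lmod A) a (m : M a) : zmod_morphism (fun y : Y a => tens y m).
Proof.
move=> y y'; apply/eqP; rewrite eq_sym subr_eq; apply/eqP.
by rewrite -tensDl subrK.
Qed.
Definition tens_l (M : lmod A) a (m : M a) : addhom (Y a) (tensor Y M) :=
  mk_addhom (@tens_l_zmod M a m).

Lemma tensor_map0 (M N : lmod A) t : tensor_map Y (0 : mhom M N) t = 0.
Proof.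
apply: (tensor_hom_ext (h' := 0)) => a y m; rewrite tensor_mapE.
exact: raddf0 (tens_r N y).
Qed.

Lemma tensor_mapD (M N : lmod A) (f g : mhom M N) t :
  tensor_map Y (f + g) t = tensor_map Y f t + tensor_map Y g t.
Proof.
apply: (tensor_hom_ext (h' := tensor_map Y f + tensor_map Y g)) => a y m.
rewrite -[RHS]/(tensor_map Y f _ + tensor_map Y g _) !tensor_mapE.
exact: tensDr.
Qed.

Section DirectLimits.
Variables (d : Order.disp_t) (I : porderType d) (dirI : directed I).
Variables (D : diagram (Mod A) I) (X : lmod A) (c : cocone D X).
Hypothesis ce : elementwise c.

Lemma tensor_leg_map i j (ij : (i <= j)%O) t :
  tensor_map Y (leg_hom c j) (tensor_map Y (dg_hom D ij) t) = tensor_map Y (leg_hom c i) t.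
Proof.
rewrite -tensor_map_comp; congr (addhom_fun (tensor_map Y _) t).
by apply: mhom_ext => a x; exact: leg_hom_map.
Qed.

Lemma tensor_trans i j k (ij : (i <= j)%O) (jk : (j <= k)%O) (ik : (i <= k)%O) t :
  tensor_map Y (dg_hom D jk) (tensor_map Y (dg_hom D ij) t) = tensor_map Y (dg_hom D ik) t.
Proof.
rewrite -tensor_map_comp; congr (addhom_fun (tensor_map Y _) t).
by apply: mhom_ext => a x; exact: dg_homM.
Qed.

Lemma tensor_limit_surj (t : tensor Y X) :
  exists i (e : tensor Y (D i)), tensor_map Y (leg_hom c i) e = t.
Proof.
elim/tensor_ind: t => [|s t [i [e <-]] [j [e' <-]]|a y m].
- by case: dirI => [[i] _]; exists i, 0; rewrite raddf0.
- have [k [ik jk]] := dirI.2 i j.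
  exists k, (tensor_map Y (dg_hom D ik) e - tensor_map Y (dg_hom D jk) e').
  by rewrite raddfB !tensor_leg_map.
- have [i [e <-]] := ce.1 a m; exists i, (tens y e).
  exact: tensor_mapE.
Qed.

(** There is an additive map from the tensor product with [X] to the group of
    germs of the tensor products with the stages, sending [y (x) e] to the
    germ of [y (x) e]. So an element of a stage that vanishes in the limit has
    germ 0, and vanishes at a later stage. *)
Lemma tensor_limit_eq0 i (t : tensor Y (D i)) : tensor_map Y (leg_hom c i) t = 0 ->
  exists j (ij : (i <= j)%O), tensor_map Y (dg_hom D ij) t = 0.
Proof.
pose G j := tensor Y (D j).
pose tr j k (jk : (j <= k)%O) : addhom (G j) (G k) := tensor_map Y (dg_hom D jk).
have trM j k l (jk : (j <= k)%O) (kl : (k <= l)%O) (jl : (j <= l)%O) x :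
  tr k l kl (tr j k jk x) = tr j l jl x by exact: tensor_trans.
pose gm j : addhom (G j) (germ_group dirI G) := germ dirI tr j.
(* For a fixed y, the map e |-> germ of y (x) e descends from the stages to X. *)
have /dep_choice[b0 b0P] (z : {a : A & Y a}) : exists u : addhom (X (tag z)) (germ_group dirI G),
    forall j e, u (leg_hom c j _ e) = gm j (tens (tagged z) e).
  have [||u [uE _]] := @elementwise_descent d I dirI (fun j => (D j : lmod A) (tag z))
    (fun j k jk => dg_hom D jk (tag z)) (X (tag z)) (fun j => leg_hom c j (tag z))
    (fun j k jk => @leg_hom_map _ _ _ _ _ c j k jk _) (ce.1 (tag z)) _
    (germ_group dirI G) (fun j => addhom_comp (gm j) (tens_r (D j) (tagged z))).
  - by move=> j e; exact: ce.2.
  - move=> j k jk x.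
    rewrite -[LHS]/(gm k (tens (tagged z) (dg_hom D jk _ x))) -tensor_mapE.
    exact: (germ_map dirI trM jk).
  - by exists u.
pose beta (a : A) (y : Y a) : addhom (X a) (germ_group dirI G) := b0 (@existT A (fun a => Y a) a y).
have betaE (a : A) (y : Y a) j e : beta a y (leg_hom c j a e) = gm j (tens y e).
  exact: (b0P (@existT A (fun a => Y a) a y)).
have [h [hE _]] : exists! h : addhom (tensor Y X) (germ_group dirI G),
    forall (a : A) (y : Y a) (m : X a), h (tens y m) = beta a y m.
  apply: tensor_universal; split=> [a y y' m|a y m m'|a b f y m].
  - have [j [e <-]] := ce.1 a m; rewrite !betaE -raddfD; congr (gm j _).
    exact: tensDl.
  - exact: raddfD.
  - have [j [e <-]] := ce.1 a m; rewrite -mh_nat !betaE; congr (gm j _).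
    exact: tens_ract.
have hgm j : forall s, h (tensor_map Y (leg_hom c j) s) = gm j s.
  apply: (tensor_hom_ext (h := addhom_comp h (tensor_map Y (leg_hom c j)))) => a y m.
  by rewrite -[LHS]/(h (tensor_map Y _ _)) tensor_mapE hE betaE.
move=> t0; have : gm i t = 0 by rewrite -hgm t0 raddf0.
exact: (@germ_eq0 _ _ dirI G tr).
Qed.

End DirectLimits.

(** At each stage the sequence stays exact because it is split; elements of
    the limit come from stages, and relations in the limit hold at later
    stages. *)
Lemma limit_of_split_tensor_exact (S : sequence A) :
  is_direct_limit_of (C := Seq A) (@split_exact A) S ->
  exact_Ab (tensor_map Y (sqf S)) (tensor_map Y (sqg S)).
Proof.
move=> lS; have [Se _] := limit_of_split_system_pure lS.
case: lS => d [I [D [c [dirI Ds cc]]]].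
have eL := colimit_elementwise dirI (seq_colimit_L cc).
have eM := colimit_elementwise dirI (seq_colimit_M cc).
have eN := colimit_elementwise dirI (seq_colimit_N cc).
pose Dq i : sequence A := D i.
pose lg i : sqhom (Dq i) S := leg c i.
pose tr i j (ij : (i <= j)%O) : sqhom (Dq i) (Dq j) := dg_map D ij.
have natf (T U : sequence A) (h : sqhom T U) t :
    tensor_map Y (shM h) (tensor_map Y (sqf T) t)
    = tensor_map Y (sqf U) (tensor_map Y (shL h) t).
  by rewrite -!tensor_map_comp sh_f.
have natg (T U : sequence A) (h : sqhom T U) t :
    tensor_map Y (shN h) (tensor_map Y (sqg T) t)
    = tensor_map Y (sqg U) (tensor_map Y (shM h) t).
  by rewrite -!tensor_map_comp sh_g.
split.
- apply: injective_ker0 => t; have [i [e <-]] := tensor_limit_surj dirI eL t.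
  rewrite -[leg_hom _ i]/(shL (lg i)) -natf => /(tensor_limit_eq0 dirI eM)[j [ij]].
  rewrite -[dg_hom _ ij]/(shM (tr i j ij)) natf => f0.
  have [Sj [s /(split_retraction Sj)[r [rf _]]]] := Ds j.
  have e0 : tensor_map Y (shL (tr i j ij)) e = 0.
    by rewrite -[LHS]tensor_map_id -rf tensor_map_comp f0 raddf0.
  by rewrite -(tensor_leg_map (map_cocone (evL A) c) ij) [X in tensor_map _ _ X]e0 raddf0.
- move=> t; split=> [|[u <-]]; last first.
    rewrite -tensor_map_comp (_ : mhom_comp _ _ = 0) ?tensor_map0 //.
    by apply: mhom_ext => a x; exact: short_exact_comp0.
  have [i [e <-]] := tensor_limit_surj dirI eM t.
  rewrite -[leg_hom _ i]/(shM (lg i)) -natg => /(tensor_limit_eq0 dirI eN)[j [ij]].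
  rewrite -[dg_hom _ ij]/(shN (tr i j ij)) natg => g0.
  have [Sj [s /(split_retraction Sj)[r [_ idE]]]] := Ds j.
  have frx x : tensor_map Y (sqg (Dq j)) x = 0 ->
      tensor_map Y (sqf (Dq j)) (tensor_map Y r x) = x.
    move=> x0; rewrite -[RHS]tensor_map_id idE tensor_mapD !tensor_map_comp x0.
    by rewrite raddf0 addr0.
  exists (tensor_map Y (shL (lg j)) (tensor_map Y r (tensor_map Y (shM (tr i j ij)) e))).
  rewrite -natf frx //; exact: (tensor_leg_map (map_cocone (evM A) c) ij).
- move=> t; have [i [e <-]] := tensor_limit_surj dirI eN t.
  have [_ [s sE]] := Ds i.
  exists (tensor_map Y (shM (lg i)) (tensor_map Y s e)).
  have gs : tensor_map Y (sqg (Dq i)) (tensor_map Y s e) = e.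
    by rewrite -tensor_map_comp sE tensor_map_id.
  by rewrite -natg gs.
Qed.

End TensorFunctor.

(** * Tensor products with finitely presented right modules *)

Section TensorWithPresented.
Variables (A : preadditive) (n : nat) (a : 'I_n -> A) (l : nat) (c : 'I_l -> A).
Variable r : forall k i, Hom (a i) (c k).

(** The right module with generators of sorts [c k] and relations [\sum_k e_k
    r_ki = 0]: the transpose of the system [r]. *)
Definition presented_right : rmod A :=
  @presented (op A) l c n a (fun i k => r k i).

Definition gen_right k : presented_right (c k) :=
  @generator (op A) l c n a (fun i k => r k i) k.

Lemma presented_right_fp : @finitely_presented (op A) presented_right.
Proof. exact: presented_fp. Qed.

Section Module.
Variable M : lmod A.

Definition in_image (z : pp_tuples c M) : Prop := exists w, z = system_map r M w.

Fact in_image0 : in_image 0. Proof. by exists 0; rewrite raddf0. Qed.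
Fact in_imageB z z' : in_image z -> in_image z' -> in_image (z - z').
Proof. by move=> [w ->] [w' ->]; exists (w - w'); rewrite raddfB. Qed.

Definition image : zmodClosed (pp_tuples c M) := mk_subgroup in_image0 in_imageB.

Definition row_act (b : A) (m : M b) (v : @free_mod (op A) l c b) : pp_tuples c M :=
  fun k => lm_map M (v k : Hom b (c k)) m.

Fact row_act_zmod b m : zmod_morphism (@row_act b m).
Proof.
move=> v w; apply: functional_extensionality_dep => k.
exact: (raddfB (lm_act (c k) m) (v k) (w k)).
Qed.

Fact row_act_rel b (m : M b) v : v \in @relations (op A) l c n a (fun i k => r k i) b ->
  addhom_comp (proj image) (mk_addhom (@row_act_zmod b m)) v = 0.
Proof.
move=> /mk_subgroupP[w wE]; apply/proj_eq0/mk_subgroupP; exists (fun i => lm_map M (w i : Hom b (a i)) m).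
apply: functional_extensionality_dep => k.
rewrite -[LHS]/(lm_act (c k) m (v k)) wE raddf_sum; apply: eq_bigr => i _.
by rewrite -[LHS]/(lm_map M (circ (r k i) (w i : Hom b (a i))) m) lm_mapM.
Qed.

(** The pairing that identifies the tensor product with the cokernel of the
    system [r] on [M]. *)
Definition image_pairing (b : A) (y : presented_right b) (m : M b) : Quotient.quot image :=
  quot_lift (@row_act_rel b m) y.

Lemma image_pairingE (b : A) (v : @free_mod (op A) l c b) (m : M b) :
  image_pairing (quotient_proj (@relations_stable (op A) l c n a (fun i k => r k i)) b v) m
  = proj image (row_act m v).
Proof. exact: quot_liftE. Qed.

Lemma image_pairing_balanced : balanced image_pairing.
Proof.
split=> [b y y' m|b y m m'|b b' f y m].
- exact: raddfD.
- have [v <-] := quotient_proj_surj y; rewrite !image_pairingE -raddfD; congr (proj _ _).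
  by apply: functional_extensionality_dep => k; exact: raddfD.
- have [v <-] := quotient_proj_surj y; rewrite [RHS]image_pairingE /ract -mh_nat [LHS]image_pairingE.
  congr (proj _ _); apply: functional_extensionality_dep => k.
  by rewrite -[LHS]/(lm_map M (circ (v k : Hom b' (c k)) f) m) lm_mapM.
Qed.

Definition tens_gens (z : pp_tuples c M) : tensor presented_right M :=
  \sum_k tens (gen_right k) (z k).

(** The tensor product of [presented_right] with [M] is the cokernel of
    [system_map r M]: [image_pairing] detects non-vanishing, and conversely
    the relations between the generators kill the image of the system. *)
Lemma tens_gens_eq0 z : tens_gens z = 0 <-> in_image z.
Proof.
split=> [z0|[w ->]].
  have [h [hE _]] := tensor_universal image_pairing_balanced.
  have : h (tens_gens z) = proj image z.
    rewrite raddf_sum.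
    transitivity (\sum_k proj image
      (row_act (z k) (@delta (op A) _ c k : @free_mod (op A) l c (c k)))).
      by apply: eq_bigr => k _; rewrite hE; exact: image_pairingE.
    rewrite -raddf_sum; congr (proj _ _); apply: functional_extensionality_dep => k.
    have evB : zmod_morphism (fun z : pp_tuples c M => z k) by [].
    rewrite -[LHS]/(mk_addhom evB _) raddf_sum.
    rewrite [LHS](@sum_delta_r (op A) l c k (M (c k))
      (fun j (d : Hom (c j) (c k)) => lm_map M d (z j))) ?lm_map1 //.
    by move=> j; exact: raddf0 (lm_act _ (z j)).
  by rewrite z0 raddf0 => /esym/proj_eq0/mk_subgroupP.
transitivity (\sum_k \sum_i tens (ract presented_right (r k i) (gen_right k)) (w i)).
  apply: eq_bigr => k _; rewrite -[LHS]/(tens_r M (gen_right k) _) raddf_sum.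
  by apply: eq_bigr => i _; rewrite /= tens_ract.
rewrite exchange_big big1 // => i _.
rewrite -[LHS](raddf_sum (tens_l presented_right (w i))).
have /(congr1 (fun f => f i)) E := @generator_solves (op A) l c n a (fun i k => r k i).
have {}E : \sum_k ract presented_right (r k i) (gen_right k) = 0 by [].
by rewrite E raddf0.
Qed.

Lemma tens_gens_surj t : exists z, tens_gens z = t.
Proof.
have sB : zmod_morphism tens_gens.
  move=> z z'; rewrite /tens_gens -sumrB; apply: eq_bigr => k _.
  exact: (raddfB (tens_r M (gen_right k))).
elim/tensor_ind: t => [|s t [z <-] [z' <-]|b y m].
- by exists 0; exact: raddf0 (mk_addhom sB).
- by exists (z - z'); exact: sB.
- have [v <-] := quotient_proj_surj y.
  exists (row_act m v); rewrite /tens_gens presented_span.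
  rewrite -[RHS]/(tens_l presented_right m _) raddf_sum.
  apply: eq_bigr => k _; exact/esym/tens_ract.
Qed.

End Module.

Lemma tens_gens_map (M N : lmod A) (h : mhom M N) z :
  tensor_map presented_right h (tens_gens z) = tens_gens (pp_map_fun h z).
Proof. by rewrite raddf_sum; apply: eq_bigr => k _; exact: tensor_mapE. Qed.

(** Lift [x] to arbitrary [y]; then [system_map r y] comes from some [z] in
    [sqL S]. By [tens_gens_eq0] the class of [z] in the tensor product with
    [presented_right r] dies in that of [sqM S], so it is 0 and [z] is
    [system_map r w] for some [w]; subtracting [w] corrects [y]. *)
Lemma tensor_injective_lifting (S : sequence A) : short_exact S ->
  injective (tensor_map presented_right (sqf S)) ->
  forall x : pp_tuples a (sqN S), system_map r (sqN S) x = 0 ->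
  exists y : pp_tuples a (sqM S),
    system_map r (sqM S) y = 0 /\ forall i, sqg S (a i) (y i) = x i.
Proof.
move=> Se fi x xs.
have /dep_choice[y yx] : forall i, exists y, sqg S (a i) y = x i.
  by move=> i; have [_ _ gs] := Se (a i); exact: gs.
have /dep_choice[z zE] : forall k, exists z, sqf S (c k) z = system_map r (sqM S) y k.
  move=> k; have [_ fg _] := Se (c k); apply/fg.
  have yx' : pp_map_fun (sqg S) y = x by apply: functional_extensionality_dep.
  have := congr1 (fun f => f k) (system_map_nat r (sqg S) y).
  by rewrite yx' xs => /esym.
have /(injective_eq0 fi)/tens_gens_eq0[w wE] :
    tensor_map presented_right (sqf S) (tens_gens z) = 0.
  rewrite tens_gens_map; apply/tens_gens_eq0; exists y.
  exact: functional_extensionality_dep.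
have zE' : pp_map_fun (sqf S) z = system_map r (sqM S) y by apply: functional_extensionality_dep.
exists ((y : pp_tuples a (sqM S)) - pp_map_fun (sqf S) w); split=> [|i].
  by rewrite raddfB [X in _ - X]system_map_nat -wE zE' subrr.
rewrite -[X in sqg S _ X]/(y i - sqf S (a i) (w i)) raddfB yx.
by rewrite (short_exact_comp0 Se) subr0.
Qed.

End TensorWithPresented.

Section TensorRepresentable.
Variables (A : preadditive) (S : sequence A) (b : A).
Let a (i : 'I_0) := b.
Let c (k : 'I_1) := b.
Let r (k : 'I_1) (i : 'I_0) : Hom (a i) (c k) := 0.

(** The tensor product of M with the right module Hom(-, b), presented by one
    generator and no relation, is M b. *)
Lemma tensor_representable_exact :
  exact_Ab (tensor_map (presented_right r) (sqf S)) (tensor_map (presented_right r) (sqg S)) ->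
  exact_Ab (sqf S b) (sqg S b).
Proof.
move=> [fi fg gs].
pose e (M : lmod A) (m : M b) := tens_gens r (fun _ => m : M (c _)).
have e0 (M : lmod A) (m : M b) : e M m = 0 <-> m = 0.
  split=> [/tens_gens_eq0[w /(congr1 (fun f => f ord0)) E]|->].
    by rewrite E; exact: big_ord0.
  by apply/tens_gens_eq0; exists 0; rewrite raddf0.
have eB (M : lmod A) (m m' : M b) : e M (m - m') = e M m - e M m'.
  rewrite /e /tens_gens -sumrB; apply: eq_bigr => k _.
  exact: (raddfB (tens_r M (gen_right r k))).
have eM (M N : lmod A) (h : mhom M N) m :
    tensor_map (presented_right r) h (e M m) = e N (h b m) by exact: tens_gens_map.
have e_surj (M : lmod A) t : exists m, e M m = t.
  have [z <-] := tens_gens_surj t; exists (z ord0).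
  by apply: eq_bigr => k _; rewrite (ord1 k).
have e_inj (M : lmod A) (m m' : M b) : e M m = e M m' -> m = m'.
  by move/eqP; rewrite -subr_eq0 -eB => /eqP/e0/eqP; rewrite subr_eq0 => /eqP.
split.
- by move=> x y E; apply: e_inj; apply: fi; rewrite !eM E.
- move=> y; rewrite -e0 -eM fg; split=> [[t]|[x <-]].
    by have [x <-] := e_surj _ t; rewrite eM => /e_inj E; exists x.
  by exists (e _ x); rewrite eM.
- move=> z; have [t] := gs (e _ z).
  by have [y <-] := e_surj _ t; rewrite eM => /e_inj E; exists y.
Qed.

End TensorRepresentable.

Lemma fp_tensor_exact_system_pure (A : preadditive) (S : sequence A) :
  (forall Y : rmod A, finitely_presented Y ->
     exact_Ab (tensor_map Y (sqf S)) (tensor_map Y (sqg S))) ->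
  system_pure S.
Proof.
move=> H; have Se : short_exact S.
  by move=> b; apply: tensor_representable_exact; apply: H; exact: presented_right_fp.
split=> // n a l c r; apply: tensor_injective_lifting => //.
by have [] := H _ (@presented_right_fp _ _ _ _ _ r).
Qed.

(** * Character duals *)

Section Currying.
Variables (A : preadditive) (Y : rmod A) (M : lmod A).

Section Curry.
Variable chi : addhom (tensor Y M) QZ.

Definition curry_fun (a : A) (y : Y a) : dual M a := addhom_comp chi (tens_r M y).

Fact curry_zmod (a : A) : zmod_morphism (@curry_fun a).
Proof.
move=> y y'; apply: addhom_ext => m.
exact: (raddfB (addhom_comp chi (tens_l Y m))).
Qed.

Fact curry_nat (a b : op A) (f : Hom a b) (y : Y a) :
  mk_addhom (@curry_zmod b) (lm_map Y f y)
  = lm_map (dual M) f (mk_addhom (@curry_zmod a) y).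
Proof. by apply: addhom_ext => m; congr (chi _); exact: (@tens_ract A Y M b a f). Qed.

(** With [uncurry], the adjunction between characters of the tensor product of
    [Y] and [M], and maps of right modules from [Y] to the dual of [M]. *)
Definition curry : mhom Y (dual M) := @MHom (op A) Y (dual M) _ curry_nat.

End Curry.

Lemma uncurry (h : mhom Y (dual M)) : exists chi : addhom (tensor Y M) QZ,
  forall (a : A) (y : Y a) (m : M a), chi (tens y m) = (h a y : addhom _ _) m.
Proof.
have [|chi [chiE _]] := @tensor_universal A Y M QZ (fun a y m => (h a y : addhom _ _) m).
  split=> [a y y' m|a y m m'|a b f y m].
  - by rewrite raddfD.
  - exact: raddfD.
  - by rewrite /ract (mh_nat h).
by exists chi.
Qed.

End Currying.

Section Evaluation.
Variables (A : preadditive) (M : lmod A).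

Lemma evaluation : exists ev : addhom (tensor (dual M) M) QZ,
  forall (a : A) (phi : addhom (M a) QZ) (m : M a), ev (@tens A (dual M) M a phi m) = phi m.
Proof.
by have [chi chiE] := uncurry (@mhom_id (op A) (dual M)); exists chi.
Qed.

(** Evaluation is a character of the tensor product of the dual of [M] with
    [M], and characters separate elements. *)
Lemma tens_eq0_detects (a : A) (m : M a) :
  (forall phi : addhom (M a) QZ, @tens A (dual M) M a phi m = 0) -> m = 0.
Proof.
move=> m0; apply: character_detects => phi.
by have [ev evE] := evaluation; rewrite -evE m0 raddf0.
Qed.

End Evaluation.

Section Cokernel.
Variables (A : preadditive) (M N : lmod A) (f : mhom M N).

Definition in_range a (y : N a) : Prop := exists x, f a x = y.

Fact in_range0 a : @in_range a 0. Proof. by exists 0; rewrite raddf0. Qed.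
Fact in_rangeB a x y : @in_range a x -> @in_range a y -> @in_range a (x - y).
Proof. by move=> [u <-] [v <-]; exists (u - v); rewrite raddfB. Qed.
Definition range_sub a : zmodClosed (N a) := mk_subgroup (@in_range0 a) (@in_rangeB a).

Fact range_stable a b (r : Hom a b) x : x \in range_sub a -> lm_map N r x \in range_sub b.
Proof. by move=> /mk_subgroupP[u <-]; apply/mk_subgroupP; exists (lm_map M r u); rewrite mh_nat. Qed.

Definition cokernel : lmod A := quotient_mod range_stable.
Definition coker_proj : mhom N cokernel := quotient_proj range_stable.

Lemma coker_proj_eq0 a y : coker_proj a y = 0 <-> exists x, f a x = y.
Proof.
split=> [/(quotient_proj_eq0 range_stable)/mk_subgroupP//|H].
by apply/(quotient_proj_eq0 range_stable)/mk_subgroupP.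
Qed.

Lemma coker_proj_comp : mhom_comp coker_proj f = 0.
Proof. by apply: mhom_ext => a x; apply/coker_proj_eq0; exists x. Qed.

(** Map the equality to the tensor product with the cokernel: the left-hand
    side dies there, so every character of the cokernel vanishes at the class
    of [y]. *)
Lemma cokernel_detects a (y : N a) :
  (forall phi : addhom (cokernel a) QZ, exists t : tensor (dual cokernel) M,
     tensor_map (dual cokernel) f t = @tens A (dual cokernel) N a phi y) ->
  exists x, f a x = y.
Proof.
move=> H; apply/coker_proj_eq0; apply: tens_eq0_detects => phi.
have [t tE] := H phi; rewrite -tensor_mapE -tE -tensor_map_comp coker_proj_comp.
exact: tensor_map0.
Qed.

End Cokernel.

Section DualPureInjective.
Variables (A : preadditive) (L : lmod A).

(** [L] seen as a right module over the opposite of [A], which turns the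
    tensor product into a functor of the right [A]-module while keeping a
    single construction. *)
Definition op_op : rmod (op A) :=
  @LMod (op (op A)) L (@lm_map A L) (@lm_map1 A L) (@lm_mapM A L) (@lm_mapD A L).

(** A map U -> dual L is a character of the tensor product of U with L. For a
    pure U -> V this product embeds into that of V with L, and characters
    extend because Q/Z is injective. *)
Lemma dual_pure_injective : @pure_injective (op A) (dual L).
Proof.
move=> S Sp h.
have [fi _ _] := limit_of_split_tensor_exact op_op
  (system_pure_limit_of_split (pure_exact_system_pure Sp)).
have [|chi [chiE _]] := @tensor_universal (op A) op_op (sqL S) QZ
  (fun a l u => (h a u : addhom _ _) l).
  split=> [a l l' u|a l u u'|a b f l u].
  - exact: raddfD.
  - by rewrite raddfD.
  - by rewrite mh_nat.
have [psi psiE] := divisible_injective chi QZ_divisible fi.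
pose k (a : op A) (v : sqM S a) : dual L a := addhom_comp psi (@tens_l (op A) op_op (sqM S) a v).
have kB (a : op A) : zmod_morphism (k a).
  move=> v v'; apply: addhom_ext => l.
  exact: (raddfB (addhom_comp psi (@tens_r (op A) op_op (sqM S) a l))).
have kN (a b : op A) (f : Hom a b) v :
    mk_addhom (kB b) (lm_map (sqM S) f v) = lm_map (dual L) f (mk_addhom (kB a) v).
  apply: addhom_ext => l; congr (psi _).
  exact/esym/(@tens_ract (op A) op_op (sqM S) a b f).
exists (@MHom (op A) (sqM S) (dual L) _ kN).
apply: mhom_ext => a u; apply: addhom_ext => l.
by rewrite -chiE -psiE tensor_mapE.
Qed.

End DualPureInjective.

Section DualSequence.
Variables (A : preadditive) (S : sequence A).

(** It suffices to use the pure-injective modules that are duals: of the terms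
    of [S] and of the cokernels of its two maps. Their characters separate the
    elements to be tested. *)
Lemma pure_injective_tensor_short :
  (forall Y : rmod A, pure_injective Y ->
     exact_Ab (tensor_map Y (sqf S)) (tensor_map Y (sqg S))) -> short_exact S.
Proof.
move=> H a.
have HD (L : lmod A) := H (dual L) (@dual_pure_injective A L).
have tens0 (L M : lmod A) (phi : dual L a) : @tens A (dual L) M a phi 0 = 0.
  exact: raddf0 (tens_r M phi).
have gf0 x : sqg S a (sqf S a x) = 0.
  apply: tens_eq0_detects => phi; rewrite -!tensor_mapE.
  have [_ fg _] := HD (sqN S); apply/fg.
  by exists (@tens A (dual (sqN S)) (sqL S) a phi x).
split.
- apply: injective_ker0 => x fx; apply: tens_eq0_detects => phi.
  have [fi _ _] := HD (sqL S); apply: (injective_eq0 fi).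
  by rewrite tensor_mapE fx tens0.
- move=> y; split=> [gy|[x <-]]; last exact: gf0.
  apply: cokernel_detects => phi; have [_ fg _] := HD (cokernel (sqf S)).
  by apply/fg; rewrite tensor_mapE gy tens0.
- move=> z; apply: cokernel_detects => phi.
  by have [_ _ gs] := HD (cokernel (sqg S)); exact: gs.
Qed.

Lemma dual_short_exact : short_exact S -> short_exact (dual_seq S).
Proof.
move=> Se a; have [fi fg gs] := Se a; split.
- apply: injective_ker0 => phi phi0; apply: addhom_ext => z.
  have [y <-] := gs z.
  exact: (congr1 (fun u : addhom _ _ => u y) phi0).
- move=> psi; split=> [psi0|[phi <-]]; last first.
    apply: addhom_ext => x; rewrite -[LHS]/(phi (sqg S a (sqf S a x))).
    by rewrite short_exact_comp0 // raddf0.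
  have psi0' y : sqg S a y = 0 -> (psi : addhom _ _) y = 0.
    move=> /fg[x <-]; exact: (congr1 (fun u : addhom _ _ => u x) psi0).
  have /choice[s sE] := gs.
  have sB : zmod_morphism (fun z => (psi : addhom _ _) (s z)).
    move=> z z'; apply/eqP; rewrite -subr_eq0 -!raddfB; apply/eqP/psi0'.
    by rewrite raddfB sE [X in _ - X]raddfB !sE subrr.
  exists (mk_addhom sB); apply: addhom_ext => y.
  apply/eqP; rewrite -subr_eq0 -[X in X - _]/((psi : addhom _ _) (s (sqg S a y))) -raddfB.
  by apply/eqP/psi0'; rewrite raddfB sE subrr.
- move=> phi; have [psi psiE] := divisible_injective phi QZ_divisible fi.
  by exists psi; apply: addhom_ext => x; exact: psiE.
Qed.

(** Tensoring with the dual of [sqL S] preserves the injectivity of [sqf S],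
    so the evaluation character extends to the tensor product with [sqM S];
    curried, the extension is a section. *)
Lemma pure_injective_tensor_dual_split :
  (forall Y : rmod A, pure_injective Y ->
     exact_Ab (tensor_map Y (sqf S)) (tensor_map Y (sqg S))) ->
  split_exact (dual_seq S).
Proof.
move=> H; split; first exact/dual_short_exact/pure_injective_tensor_short.
have [fi _ _] := H _ (@dual_pure_injective A (sqL S)).
have [ev evE] := evaluation (sqL S).
have [psi psiE] := divisible_injective ev QZ_divisible fi.
exists (curry psi); apply: mhom_ext => a phi; apply: addhom_ext => x.
rewrite -[LHS]/(psi (@tens A (dual (sqL S)) (sqM S) a phi (sqf S a x))).
by rewrite -tensor_mapE psiE evE.
Qed.

(** Each failure of exactness in [S] is witnessed by a character that vanishes
    on the relevant subgroup but not on the offending element, and exactness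
    of the dual sequence excludes it. *)
Lemma dual_short_exact_reflect : short_exact (dual_seq S) -> short_exact S.
Proof.
move=> De a; have [gi gf fs] := De a.
have gf0 x : sqg S a (sqf S a x) = 0.
  apply: character_detects => phi.
  have /gf E : exists u : dual (sqN S) a, dual_map (sqg S) a u = dual_map (sqg S) a phi.
    by exists phi.
  exact: (congr1 (fun u : addhom _ _ => u x) E).
split.
- apply: injective_ker0 => x fx; apply: character_detects => phi.
  have [psi <-] := fs phi.
  by rewrite -[LHS]/((psi : addhom _ _) (sqf S a x)) fx raddf0.
- move=> y; split=> [gy|[x <-]]; last exact: gf0.
  apply: contrapT => noy.
  have [||psi [psi0 psiy]] := @character_separates _ (@in_range A _ _ (sqf S) a) y _ _ noy.
  + exact: in_range0.
  + exact: in_rangeB.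
  apply: psiy; have /gf[phi <-] : dual_map (sqf S) a psi = 0.
    by apply: addhom_ext => x; apply: psi0; exists x.
  by rewrite -[LHS]/((phi : addhom _ _) (sqg S a y)) gy raddf0.
- move=> z; apply: contrapT => noz.
  have [||psi [psi0 psiz]] := @character_separates _ (@in_range A _ _ (sqg S) a) z _ _ noz.
  + exact: in_range0.
  + exact: in_rangeB.
  apply: psiz; have -> : psi = 0; last by [].
  by apply: gi; apply: addhom_ext => y; apply: psi0; exists y.
Qed.

(** Through currying and the section, every character of the tensor product of
    [Y] with [sqL S] extends to the one with [sqM S]; an element killed by
    [sqf S] is thus killed by all characters. *)
Lemma dual_split_tensor_injective (Y : rmod A) :
  split_exact (dual_seq S) -> injective (tensor_map Y (sqf S)).
Proof.
move=> [_ [s sE]]; apply: injective_ker0 => t ft; apply: character_detects => chi.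
have [psi psiE] := uncurry (mhom_comp s (curry chi)).
have E : forall t, addhom_comp psi (tensor_map Y (sqf S)) t = chi t.
  apply: tensor_hom_ext => a y x.
  rewrite -[LHS]/(psi (tensor_map Y (sqf S) (tens y x))) tensor_mapE psiE.
  have /(congr1 (fun u : addhom _ _ => u x)) := mhom_app sE (curry chi a y).
  exact.
by rewrite -E /= ft raddf0.
Qed.

Lemma dual_split_system_pure : split_exact (dual_seq S) -> system_pure S.
Proof.
move=> Ds; have Se := dual_short_exact_reflect Ds.1; split=> // n a l c r.
by apply: tensor_injective_lifting => //; exact: dual_split_tensor_injective.
Qed.

End DualSequence.

Theorem corollary1 (A : preadditive) (S : sequence A) :
  [<-> pure_exact S;
       is_direct_limit_of (C := Seq A) (@split_exact A) S;
       forall (n : nat) (s : 'I_n -> A) (p : pp_pair s),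
         exact_Ab (pp_quot_map (sqf S) p) (pp_quot_map (sqg S) p);
       forall Y : rmod A,
         exact_Ab (tensor_map Y (sqf S)) (tensor_map Y (sqg S));
       forall Y : rmod A, pure_injective Y ->
         exact_Ab (tensor_map Y (sqf S)) (tensor_map Y (sqg S));
       split_exact (dual_seq S)]
  /\
  (pure_exact S <->
   forall Y : rmod A, finitely_presented Y ->
     exact_Ab (tensor_map Y (sqf S)) (tensor_map Y (sqg S))).
Proof.
split.
  tfae.
  - by move=> /pure_exact_system_pure/system_pure_limit_of_split.
  - by move=> /limit_of_split_system_pure Sp n s p; exact: system_pure_pp_exact.
  - move=> /pp_exact_system_pure/system_pure_limit_of_split lS Y.
    exact: limit_of_split_tensor_exact.
  - by move=> H Y _; exact: H.
  - exact: pure_injective_tensor_dual_split.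
  - by move=> /dual_split_system_pure/system_pure_pure_exact.
split=> [/pure_exact_system_pure/system_pure_limit_of_split lS Y _|].
  exact: limit_of_split_tensor_exact.
by move=> /fp_tensor_exact_system_pure/system_pure_pure_exact.
Qed.
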